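(* Let $m>0$. Assume that there exist $q'\in[0,1)$, $q\in[0,1]$, $C_{\tilde\sigma,\beta}>0$ and $\underline{\sigma}>0$ such that $|\alpha(t)|=\mathcal{O}((\ln t)^{q'})$ as $t\to\infty$ and, for all $t$ large enough, $$\underline{\sigma}\le\tilde\sigma(t)\le C_{\tilde\sigma,\beta}\,t^{q/4},\qquad |\beta(t)|\le C_{\tilde\sigma,\beta}\,t^{q/4}.$$ Assume moreover that there exists $\chi_m>0$ such that, for all $t$ large enough, $$\inf_{s\in[t,t+m]}\tilde\sigma(s)\ \ge\ \chi_m\sup_{s\in[t,t+m]}\tilde\sigma(s).$$ Then for any $\tilde q>q$ there exists a constant $C_{\tilde q}>0$ such that the number of steps $N_\epsilon$ of the walk on spheroids with parameter $m$ (defined in the context) satisfies $$\mathbb{E}\big[N_\epsilon^{1-\tilde q}\big]\le C_{\tilde q}\,|\log(\epsilon)|$$ for any $\epsilon>0$ small enough.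
   Context: Let $a<b$ be real numbers, $x_0\in(a,b)$, $m>0$ and $0<\gamma<1$ fixed. Let $\alpha,\beta:[0,\infty)\to\mathbb{R}$ be continuous and $\tilde\sigma:[0,\infty)\to(0,\infty)$ be continuous. The associated L-class diffusion is the solution of $dX_t=(\alpha(t)X_t+\beta(t))\,dt+\tilde\sigma(t)\,dW_t$, $X_0=x_0$, with $W$ a one-dimensional Brownian motion. Set $$\theta(t)=-\int_0^t\alpha(s)\,ds,\qquad c(t)=e^{-\theta(t)}\int_0^t\beta(s)e^{\theta(s)}\,ds,\qquad \rho(t)=\int_0^t\tilde\sigma(s)^2e^{2\theta(s)}\,ds .$$ Brownian spheroid of size $d>0$: $\psi_\pm(u)=\pm\sqrt{u\log(d^2/u)}$ for $u\in(0,d^2]$, $\psi_\pm(0)=0$; its Brownian exit time is $\tau=\inf\{u>0: W_u\notin[\psi_-(u),\psi_+(u)]\}$ for a standard Brownian motion $W$ started at $0$ (so $\tau\le d^2$). Spheroid for the diffusion, started at $(t_0,x)$: with the same $d$, for $0\le t\le\rho^{-1}(d^2+\rho(t_0))-t_0$, $$\psi^L_\pm(t;t_0,x)=e^{-\theta(t+t_0)}\psi_\pm(\rho(t+t_0)-\rho(t_0))+c(t+t_0)+(x-c(t_0))e^{\int_{t_0}^{t+t_0}\alpha(s)ds}.$$ Choice of size: for $t_0\ge0$ and $x\in(a,b)$ put $a_{\gamma,x}=a+\gamma(x-a)$, $b_{\gamma,x}=b-\gamma(b-x)$, $$\Delta_m=\Delta_m(t_0,x)=e^{-\theta(t_0)}e^{\int_{t_0}^{t_0+m}|\alpha(s)|ds}\left(\frac1{\sqrt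 e}+\sqrt{\int_{t_0}^{t_0+m}\frac{|\beta(s)+x\,\alpha(s)|^2}{\tilde\sigma(s)^2}ds}\right),$$ let $\kappa_\pm$ be defined by $\kappa_+(b_{\gamma,x}-x)=\kappa_-(x-a_{\gamma,x})=\Delta_m\sqrt{\rho(t_0+m)-\rho(t_0)}$, and let $$d(t_0,x)=\frac{\min(1,\kappa_+)}{\Delta_m}(b_{\gamma,x}-x)\ \text{ if } b-x\le x-a,\qquad d(t_0,x)=\frac{\min(1,\kappa_-)}{\Delta_m}(x-a_{\gamma,x})\ \text{ if } x-a\le b-x .$$ Walk on spheroids (algorithm with parameter $m$): $(T_0,X_0)=(0,x_0)$. Given $(T_n,X_n)$, use the spheroid of size $d=d(T_n,X_n)$; sample, with fresh randomness, $\tau_{n+1}$ distributed as the Brownian exit time $\tau$ of the Brownian spheroid of that size $d$, and an independent fair coin. Set $\tau^L_{n+1}=\rho^{-1}(\tau_{n+1}+\rho(T_n))-T_n$, $T_{n+1}=T_n+\tau^L_{n+1}$, and $X_{n+1}=\psi^L_-(\tau^L_{n+1};T_n,X_n)$ or $X_{n+1}=\psi^L_+(\tau^L_{n+1};T_n,X_n)$ according to the coin (probability $1/2$ each). For $\epsilon>0$, the number of steps is $N_\epsilon=\inf\{n\ge0: X_n\notin[a+\epsilon,b-\epsilon]\}$. *)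

(* Defs.v *)
From HB Require Import structures.
From mathcomp Require Import all_boot all_order all_algebra.
From mathcomp Require Import all_classical all_reals all_analysis.

Set Implicit Arguments.
Unset Strict Implicit.
Unset Printing Implicit Defensive.

Import Order.TTheory GRing.Theory Num.Theory.
Import numFieldNormedType.Exports.

Local Open Scope classical_set_scope.
Local Open Scope ring_scope.

(* Standard one-dimensional Brownian motion started at 0, indexed by the
   nonnegative reals (values at negative indices are irrelevant).
   [normal_prob] takes the standard deviation, not the variance.
   Taking [B i = setT] in [bm_indep] gives the product rule for every subfamily
   of the increments. *)
Record brownian_motion (R : realType) (d : measure_display)
    (Omega : measurableType d) (P : probability Omega R)
    (W : R -> Omega -> R) : Prop := BrownianMotion {
  bm_measurable : forall t : R, 0 <= t -> measurable_fun setT (W t) ;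
  bm_start : forall w, W 0 w = 0 ;
  bm_continuous : forall w, {within `[0, +oo[, continuous (fun t => W t w)} ;
  bm_normal : forall (s t : R) (B : set R), 0 <= s -> s < t -> measurable B ->
    P [set w | B (W t w - W s w)] = normal_prob 0 (Num.sqrt (t - s)) B ;
  bm_indep : forall (k : nat) (t : nat -> R) (B : nat -> set R),
    0 <= t 0%N -> (forall i, t i <= t i.+1) -> (forall i, measurable (B i)) ->
    P [set w | forall i, (i < k)%N -> B i (W (t i.+1) w - W (t i) w)] =
    (\prod_(i < k) P [set w | B i (W (t i.+1) w - W (t i) w)%R])%E }.

(* Upper boundary [psi_+] of the Brownian spheroid of size [d]; the lower one is
   its opposite.  The conventions [x / 0 = 0], [ln x = 0] for [x <= 0] and
   [sqrt x = 0] for [x <= 0] give the value 0 at [u = 0], and extend the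
   boundary by 0 after [d ^+ 2]. *)
Definition psi (R : realType) (d u : R) : R := Num.sqrt (u * ln (d ^+ 2 / u)).

Definition brownian_exit_time (R : realType) (Omega : Type)
    (W : R -> Omega -> R) (d : R) (w : Omega) : R :=
  inf [set u | 0 < u /\ W u w \notin `[- psi d u, psi d u]].

Definition brownian_exit_law (R : realType) (disp : measure_display)
    (Omega : measurableType disp) (P : probability Omega R)
    (W : R -> Omega -> R) (d : R) (B : set R) : \bar R :=
  P (brownian_exit_time W d @^-1` B).

Section diffusion.
Context {R : realType}.
Variables alpha beta sigma : R -> R.

Local Notation mu := (@lebesgue_measure R).

Definition theta (t : R) : R := - \int[mu]_(s in `[0, t]) alpha s.

Definition cdrift (t : R) : R :=
  expR (- theta t) * \int[mu]_(s in `[0, t]) (beta s * expR (theta s)).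

Definition rho (t : R) : R :=
  \int[mu]_(s in `[0, t]) (sigma s ^+ 2 * expR (2 * theta s)).

Definition rho_inv : R -> R := 'pinv_(fun=> 0) `[0, +oo[%classic rho.

(* [sgn = 1] for the upper boundary and [sgn = -1] for the lower one. *)
Definition psiL (sgn d t0 x t : R) : R :=
  expR (- theta (t + t0)) * (sgn * psi d (rho (t + t0) - rho t0)) +
  cdrift (t + t0) +
  (x - cdrift t0) * expR (\int[mu]_(s in `[t0, t + t0]) alpha s).

Variables a b m gamma : R.

Definition Delta (t0 x : R) : R :=
  expR (- theta t0) * expR (\int[mu]_(s in `[t0, t0 + m]) `|alpha s|) *
  ((Num.sqrt (expR 1))^-1 +
   Num.sqrt (\int[mu]_(s in `[t0, t0 + m])
     (`|beta s + x * alpha s| ^+ 2 / sigma s ^+ 2))).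

Definition a_gamma (x : R) : R := a + gamma * (x - a).
Definition b_gamma (x : R) : R := b - gamma * (b - x).

(* The solutions of [kappa_+ (b_gamma - x) = kappa_- (x - a_gamma)
   = Delta sqrt(rho (t0 + m) - rho t0)]; both coefficients are positive for
   [a < x < b]. *)
Definition kappa_plus (t0 x : R) : R :=
  Delta t0 x * Num.sqrt (rho (t0 + m) - rho t0) / (b_gamma x - x).
Definition kappa_minus (t0 x : R) : R :=
  Delta t0 x * Num.sqrt (rho (t0 + m) - rho t0) / (x - a_gamma x).

(* The two formulas agree when [b - x = x - a]. *)
Definition spheroid_size (t0 x : R) : R :=
  if b - x <= x - a
  then Num.min 1 (kappa_plus t0 x) / Delta t0 x * (b_gamma x - x)
  else Num.min 1 (kappa_minus t0 x) / Delta t0 x * (x - a_gamma x).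

End diffusion.

(* Events determined by [(T 0, X 0), ..., (T n, X n)]. *)
Definition history (R : realType) (Omega : Type) (T X : nat -> Omega -> R)
    (n : nat) : set (set Omega) :=
  <<s [set A | exists (k : nat) (B : set R), [/\ (k <= n)%N, measurable B &
                 A = T k @^-1` B \/ A = X k @^-1` B]] >>.

(* [T], [X] is a walk on spheroids, driven by the sampled Brownian times [tau]
   and the coins [coin] ([true] selects the upper boundary).  [ws_law] is the
   sampling rule with fresh randomness: conditionally on the past, [tau n.+1]
   has the law of the exit time of the Brownian motion [W] (living on an
   auxiliary probability space) from the spheroid of size
   [spheroid_size (T n) (X n)], and [coin n.+1] is an independent fair coin. *)
Record walk_on_spheroids (R : realType) (alpha beta sigma : R -> R)
    (a b x0 m gamma : R)
    (dB : measure_display) (OmegaB : measurableType dB)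
    (PB : probability OmegaB R) (W : R -> OmegaB -> R)
    (d : measure_display) (Omega : measurableType d) (P : probability Omega R)
    (tau : nat -> Omega -> R) (coin : nat -> Omega -> bool)
    (T X : nat -> Omega -> R) : Prop := WalkOnSpheroids {
  ws_tau_measurable : forall n, measurable_fun setT (tau n) ;
  ws_coin_measurable : forall n, measurable_fun setT (coin n) ;
  ws_T_measurable : forall n, measurable_fun setT (T n) ;
  ws_X_measurable : forall n, measurable_fun setT (X n) ;
  ws_T0 : forall w, T 0%N w = 0 ;
  ws_X0 : forall w, X 0%N w = x0 ;
  ws_T : forall n w, let tauL :=
      rho_inv alpha sigma (tau n.+1 w + rho alpha sigma (T n w)) - T n w in
    T n.+1 w = T n w + tauL ;
  ws_X : forall n w, let tauL :=
      rho_inv alpha sigma (tau n.+1 w + rho alpha sigma (T n w)) - T n w in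
    let size := spheroid_size alpha beta sigma a b m gamma (T n w) (X n w) in
    X n.+1 w = psiL alpha beta sigma (if coin n.+1 w then 1 else -1)
                 size (T n w) (X n w) tauL ;
  ws_law : forall n (A : set Omega) (B : set R) (c : bool),
    history T X n A -> measurable B ->
    P (A `&` tau n.+1 @^-1` B `&` [set w | coin n.+1 w = c]) =
    (2^-1%:E * \int[P]_(w in A) brownian_exit_law PB W
       (spheroid_size alpha beta sigma a b m gamma (T n w) (X n w)) B)%E }.

(* [N_epsilon], equal to [+oo] when the walk never leaves [a + e, b - e]. *)
Definition nb_steps (R : realType) (a b : R) (Omega : Type)
    (X : nat -> Omega -> R) (e : R) (w : Omega) : \bar R :=
  ereal_inf [set n%:R%:E | n in [set n | X n w \notin `[a + e, b - e]]].

(* [poweR] sends [+oo] to [+oo] for negative exponents; here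
   [+oo ^ r = 0] for [r < 0]. *)
Definition epow (R : realType) (x : \bar R) (r : R) : \bar R :=
  if (x == +oo%E) && (r < 0) then 0%E else poweR x r.

(* Main.v *)
(* In the coordinates s = rho(t), z = e^theta(t) (x - c(t)) one step of the walk
   adds the exit time tau to s and +-psi(tau) to z, like a Brownian motion run
   until it leaves the spheroid.  Since |v|^(-1/2) exp (- y^2 / 2v) solves the
   backward heat equation, optional stopping gives exact identities at the exit
   time.  They show that E tau and E psi(tau)^2 are at least c d^2, so that the
   function - ln (b - x) - ln (x - a) + K (1 + t)^13 increases in mean by at
   least c (1 + t)^-6 at each step; up to the exit from [a + e, b - e] its mean
   is O(|ln e|), hence so is the mean of the sum of the (1 + T_j)^-6 over the
   steps before N_e.  They also provide, for each time block [t_k, t_k+1], a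
   barrier made of two heat kernels showing that the walk never leaves the block
   with probability at least c k^(-1/2); therefore all moments of T_n are
   bounded uniformly in n.  For 0 < p < 1 both facts combine through
   y^p <= y / L + L^(p / (1 - p)) with L = (1 + T_n)^6. *)

Require Import Defs.
From mathcomp Require Import all_boot all_order all_algebra.
From mathcomp Require Import all_classical all_reals all_analysis.
From mathcomp Require Import measurable_realfun ring lra.

Import Order.TTheory GRing.Theory Num.Theory.
Import numFieldNormedType.Exports.

Local Open Scope classical_set_scope.
Local Open Scope ring_scope.

Set Implicit Arguments.
Unset Strict Implicit.
Unset Printing Implicit Defensive.

(** The mean increase per step has no uniform positive lower bound: as the coefficients grow, the
    spheroids may shrink with time. So only a weighted count of steps is controlled directly, and
    moments of [T n] are needed to remove the weight. The power k^(-1/2) has the following origin.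
    Let K bound |alpha| before the end of a block. Over the last 1 / (1 + K) time units e^theta is
    constant up to a factor e, and the intrinsic time gained there dictates the sharpness A of the
    barrier, affine in K; the walk stays in the block with probability at least exp(- A) / 2. Since
    alpha is o(ln t), K can be taken with any small multiple of ln t, and the multiple is tuned to
    give exp(- A) of order k^(-1/2). The product of the factors 1 - c k^(-1/2) then decays faster
    than any power. [brownian_motion] speaks only of increments over finitely many times. Identities
    are therefore proved for the path stopped on a grid, where nonnegativity replaces integrability,
    and then passed to the limit. The limit is taken only for kernels bounded up to the horizon; the
    growing kernels (v < 0) are used on the grid alone. *)

(** * Transfer of joint laws and Gaussian integrals *)

Lemma integral_mrestr d (T : measurableType d) (R : realType)
    (P : {measure set T -> \bar R}) (E : set T) (mE : measurable E) (f : T -> \bar R) :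
  measurable_fun setT f -> (forall x, 0 <= f x)%E ->
  (\int[mrestr P mE]_w f w = \int[P]_(w in E) f w)%E.
Proof.
move=> mf f0.
have mC : measurable (~` E) by exact: measurableC.
rewrite (@ge0_negligible_integral _ _ _ (mrestr P mE) _ (~` E))//; last first.
  by rewrite /= /mrestr setICl measure0.
rewrite setTD setCK; apply: eq_measure_integral => A mA AE.
by change (P (A `&` E) = P A); rewrite setIidl.
Qed.

(** On rectangles the hypothesis identifies the law of [(Y, V)] under [P] restricted to [E] with
    that of [(Y, Z (Y, b))], [b] being independent of law [PB]. Rectangles form a generating
    pi-system, so the two image measures agree. Used for a Brownian increment ([Z = snd]) and for
    the fresh exit time of the walk. *)
Lemma joint_law d dB d' d'' (T : measurableType d) (TB : measurableType dB)
    (S : measurableType d') (U : measurableType d'') (R : realType)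
    (P : probability T R) (PB : probability TB R)
    (E : set T) (Y : T -> S) (V : T -> U) (Z : S * TB -> U) (f : S * U -> \bar R) :
  measurable E -> measurable_fun setT Y -> measurable_fun setT V ->
  measurable_fun setT Z ->
  (forall C B, measurable C -> measurable B ->
    P (E `&` Y @^-1` C `&` V @^-1` B) =
    (\int[P]_(w in E `&` Y @^-1` C) PB [set b | B (Z (Y w, b))])%E) ->
  measurable_fun [set: S * U] f -> (forall x, 0 <= f x)%E ->
  (\int[P]_(w in E) f (Y w, V w) =
   \int[P]_(w in E) \int[PB]_b f (Y w, Z (Y w, b)))%E.
Proof.
move=> mE mY mV mZ H mf f0.
pose phi1 w := (Y w, V w).
pose phi2 (z : T * TB) := (Y z.1, Z (Y z.1, z.2)).
have mphi1 : measurable_fun setT phi1 by exact: measurable_fun_pair.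
have mY1 : measurable_fun setT (fun z : T * TB => Y z.1).
  exact: (measurableT_comp mY).
have mphi2 : measurable_fun setT phi2.
  apply: measurable_fun_pair => //.
  by apply: (measurableT_comp mZ); exact: measurable_fun_pair.
pose mu1 := pushforward (mrestr P mE) phi1.
pose mu2 := pushforward (mrestr P mE \x PB)%E phi2.
pose G := [set A `*` B | A in (@measurable _ S) & B in (@measurable _ U)].
have eqmu A : measurable A -> mu1 A = mu2 A.
  apply: (measure_unique G (fun=> setT)) => //.
  - by rewrite measurable_prod_measurableType.
  - move=> _ _ [A1 mA1 [B1 mB1 <-]] [A2 mA2 [B2 mB2 <-]].
    exists (A1 `&` A2); first exact: measurableI.
    exists (B1 `&` B2); first exact: measurableI.
    by rewrite setXI.
  - move=> _; exists setT => //; exists setT => //; exact: setXTT.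
  - by rewrite bigcup_const//; exists O.
  - move=> _ [C mC [B mB <-]].
    have mY1C : measurable (Y @^-1` C) by rewrite -[X in measurable X]setTI; exact: mY.
    change (mrestr P mE (phi1 @^-1` (C `*` B)) =
      (mrestr P mE \x PB)%E [set z | C (Y z.1) /\ B (Z (Y z.1, z.2))]).
    rewrite /product_measure1 /=.
    have mX : measurable [set z : T * TB | C (Y z.1) /\ B (Z (Y z.1, z.2))].
      have := mphi2 measurableT (C `*` B); rewrite setTI; apply; exact: measurableX.
    transitivity (P (E `&` Y @^-1` C `&` V @^-1` B)).
      rewrite /mrestr; congr (P _); apply/seteqP; split => w /=; tauto.
    rewrite H// setIC integral_mkcondl.
    have mg : measurable_fun setT (PB \o xsection [set z : T * TB | C (Y z.1) /\ B (Z (Y z.1, z.2))]).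
      exact: measurable_fun_xsection.
    transitivity (\int[P]_(w in E) ((PB \o xsection [set z : T * TB | C (Y z.1) /\ B (Z (Y z.1, z.2))]) w))%E.
      apply: eq_integral => w _; rewrite patchE /= /xsection.
      case: ifPn => [/set_mem Cw|/negP Cw].
        congr (PB _); apply/seteqP; split=> b /=; rewrite inE/=.
          by move=> Bb; split.
        by case.
      rewrite -[LHS](measure0 PB); congr (PB _); apply/seteqP; split=> b //=.
      rewrite inE /= => -[Cb]; exfalso; apply: Cw; exact/mem_set.
    by rewrite -(integral_mrestr P mE).
  - move=> _; change (P (phi1 @^-1` setT `&` E) < +oo)%E.
    by rewrite preimage_setT setTI (le_lt_trans (probability_le1 P mE))// ltry.
transitivity (\int[mrestr P mE]_w (f \o phi1) w)%E.
  rewrite (integral_mrestr P mE (f := f \o phi1))//; first exact: (measurableT_comp mf mphi1).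
  by move=> w; exact: f0.
transitivity (\int[mu1]_y f y)%E.
  by rewrite ge0_integral_pushforward// preimage_setT.
transitivity (\int[mu2]_y f y)%E.
  by apply: eq_measure_integral => A mA _; exact: eqmu.
rewrite ge0_integral_pushforward// preimage_setT fubini_tonelli1//; last 2 first.
- exact: (measurableT_comp mf mphi2).
- by move=> z; exact: f0.
rewrite integral_mrestr//.
- exact: (measurable_fun_fubini_tonelli_F (m2 := PB) (f \o phi2) (measurableT_comp mf mphi2) (fun=> f0 _)).
- by move=> w; apply: integral_ge0 => b _; exact: f0.
Qed.

Lemma integral_normal_prob (R : realType) (m s : R) (f : R -> \bar R) :
  measurable_fun setT f -> (forall x, 0 <= f x)%E ->
  (\int[normal_prob m s]_x f x = \int[lebesgue_measure]_x (f x * (normal_pdf m s x)%:E))%E.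
Proof.
move=> mf f0.
have dom := normal_prob_dominates m s.
rewrite -(Radon_Nikodym_SigmaFinite.change_of_variables (mu := lebesgue_measure) dom)//.
apply: ae_eq_integral => //.
- apply: emeasurable_funM => //.
  exact: measurable_int (Radon_Nikodym_SigmaFinite.f_integrable dom).
- apply: emeasurable_funM => //.
  by apply/measurable_EFinP; exact: measurable_normal_pdf.
- apply: ae_eqe_mul2l.
  apply: integral_ae_eq => //.
  + exact: (Radon_Nikodym_SigmaFinite.f_integrable dom).
  + by apply/measurable_EFinP; exact: measurable_normal_pdf.
  + by move=> A _ mA; rewrite -(Radon_Nikodym_SigmaFinite.f_integral dom).
Qed.

(** * Optional stopping along a grid *)

(* For [v < 0] this is [expR (y ^+ 2 / (2 * `|v|)) / Num.sqrt `|v|], space-time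
   harmonic as well. *)
Definition heat (R : realType) (v y : R) : R :=
  (Num.sqrt `|v|)^-1 * expR (- y ^+ 2 / (2 * v)).

Lemma heat_ge0 (R : realType) (v y : R) : 0 <= heat v y.
Proof. by rewrite mulr_ge0 ?invr_ge0 ?sqrtr_ge0 ?expR_ge0. Qed.

Lemma measurable_invr (R : realType) : measurable_fun setT (@GRing.inv R).
Proof.
have -> : [set: R] = [set~ 0] `|` [set 0] by rewrite setUC setUv.
apply/measurable_funU => //; first exact: measurableC.
split; last exact: measurable_fun_set1.
apply: open_continuous_measurable_fun; first exact/closed_openC/closed_eq.
by move=> x /set_mem /eqP x0; apply: inv_continuous.
Qed.

Lemma heatN (R : realType) (v y : R) : heat v (- y) = heat v y.
Proof. by rewrite /heat sqrrN. Qed.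

Lemma measurable_heat2 d (T : measurableType d) (R : realType) (V Y : T -> R) :
  measurable_fun setT V -> measurable_fun setT Y ->
  measurable_fun setT (fun w => heat (V w) (Y w)).
Proof.
move=> mV mY; apply: measurable_funM.
  apply: (measurableT_comp (@measurable_invr R)).
  apply: (measurableT_comp (continuous_measurable_fun (@sqrt_continuous R))).
  exact: measurableT_comp.
apply: measurableT_comp => //; apply: measurable_funM.
  by apply: measurableT_comp => //; exact: measurable_funX.
by apply: (measurableT_comp (@measurable_invr R)); exact: measurable_funM.
Qed.

Lemma measurable_psi d (T : measurableType d) (R : realType) (D U : T -> R) :
  measurable_fun setT D -> measurable_fun setT U ->
  measurable_fun setT (fun w => psi (D w) (U w)).
Proof.
move=> mD mU.
apply: (measurableT_comp (continuous_measurable_fun (@sqrt_continuous R))).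
apply: measurable_funM => //; apply: (measurableT_comp (@measurable_ln R)).
apply: measurable_funM; first exact: measurable_funX.
exact: (measurableT_comp (@measurable_invr R)).
Qed.

Lemma measurable_heat (R : realType) (v : R) : measurable_fun setT (heat v).
Proof.
apply: measurable_funM => //; apply: measurableT_comp => //.
by apply: measurable_funM => //; apply: measurableT_comp.
Qed.

(** Completing the square: the kernel times the centred Gaussian density of variance h is [heat v y]
    times the Gaussian density of mean [mm] and variance h (v - h) / v. The condition
    [0 < v * (v - h)] says that the singular time 0 is not crossed, which makes this variance
    positive, also for [v < 0]. *)
Lemma heat_normal (R : realType) (h v y : R) : 0 < h -> 0 < v * (v - h) ->
  (\int[normal_prob 0 (Num.sqrt h)]_x (heat (v - h) (y + x))%:E = (heat v y)%:E)%E.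
Proof.
move=> h0 vh.
have v0 : v != 0 by apply/eqP => ve; move: vh; rewrite ve mul0r ltxx.
have u0 : v - h != 0 by apply/eqP => ve; move: vh; rewrite ve mulr0 ltxx.
have s0 : 0 < h * (v - h) / v.
  have -> : h * (v - h) / v = h * (v * (v - h)) / v ^+ 2 by field.
  by apply: divr_gt0; [exact: mulr_gt0|rewrite exprn_even_gt0].
pose s := Num.sqrt (h * (v - h) / v); pose mm := - (y * h / v).
have ss0 : s != 0 by rewrite gt_eqF// sqrtr_gt0.
have sh0 : Num.sqrt h != 0 by rewrite gt_eqF// sqrtr_gt0.
have key x : heat (v - h) (y + x) * normal_pdf 0 (Num.sqrt h) x =
    heat v y * normal_pdf mm s x.
  rewrite !normal_pdfE// /heat /normal_peak /normal_fun.
  rewrite !sqr_sqrtr ?ltW//.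
  rewrite mulrACA -expRD [RHS]mulrACA -expRD.
  congr (_ * expR _).
    rewrite -!invfM -!sqrtrM ?normr_ge0//; congr (Num.sqrt _)^-1.
    have -> : h * (v - h) / v = h * `|v - h| / `|v|.
      have : 0 < (v - h) / v.
        by have -> : (v - h) / v = v * (v - h) / v ^+ 2; [field | apply: divr_gt0 => //; rewrite exprn_even_gt0].
      by move=> /gtr0_norm; rewrite normrM normfV -!mulrA => ->.
    by field; rewrite normr_eq0.
  by rewrite /mm; field; rewrite u0 v0 gt_eqF.
rewrite integral_normal_prob; last 2 first.
- apply/measurable_EFinP; apply: measurableT_comp; first exact: measurable_heat.
  exact: measurable_funD.
- by move=> x; rewrite lee_fin heat_ge0.
under eq_integral do rewrite -EFinM key EFinM.
rewrite ge0_integralZl//.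
- by rewrite integral_normal_pdf mule1.
- by apply/measurable_EFinP; exact: measurable_normal_pdf.
- by move=> x _; rewrite lee_fin normal_pdf_ge0.
- by rewrite lee_fin heat_ge0.
Qed.

Section brownian_grid.
Context (R : realType) (dB : measure_display) (OmegaB : measurableType dB)
  (PB : probability OmegaB R) (W : R -> OmegaB -> R).
Hypothesis hW : brownian_motion PB W.
Variable h : R.
Hypothesis h0 : 0 < h.

Let x (i : nat) : OmegaB -> R := W (i%:R * h).
Let inc (i : nat) (w : OmegaB) : R := x i.+1 w - x i w.
Local Notation N := (normal_prob (0 : R) (Num.sqrt h)).
(** The cylinder events of the first [j] increments. They form a pi-system on which [bm_indep] gives
    the product rule; [indep] extends the rule to the generated sigma-algebra, which stands for the
    past at the [j]-th grid point. *)
Let G (j : nat) : set (set OmegaB) := [set E | exists B : nat -> set R,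
  (forall i, measurable (B i)) /\ E = [set w | forall i, (i < j)%N -> B i (inc i w)]].

Let mx i : measurable_fun setT (x i).
Proof. by apply: (bm_measurable hW); rewrite mulr_ge0// ltW. Qed.

Let minc i : measurable_fun setT (inc i).
Proof. exact: measurable_funB. Qed.

Let inc_law i B : measurable B -> PB (inc i @^-1` B) = N B.
Proof.
move=> mB; have := @bm_normal _ _ _ _ _ hW (i%:R * h) (i.+1%:R * h) B.
rewrite -mulrBl -natrB// subSnn mul1r; apply => //.
  by rewrite mulr_ge0// ltW.
by rewrite ltr_pM2r// ltr_nat.
Qed.

Let G_law j B : (forall i, measurable (B i)) ->
  PB [set w | forall i, (i < j)%N -> B i (inc i w)] = (\prod_(i < j) N (B i))%E.
Proof.
move=> mB; have := @bm_indep _ _ _ _ _ hW j (fun i => i%:R * h) B.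
move=> -> //.
- by apply: eq_bigr => i _; exact: inc_law.
- by rewrite mul0r.
- by move=> i; rewrite ler_pM2r// ler_nat.
Qed.

Let G_measurable j : G j `<=` measurable.
Proof.
move=> _ [B [mB ->]].
have -> : [set w | forall i, (i < j)%N -> B i (inc i w)] =
    \bigcap_(i in [set i | (i < j)%N]) (inc i @^-1` B i).
  by apply/seteqP; split => w /=.
apply: bigcap_measurableType => i _.
by rewrite -[X in measurable X]setTI; exact: minc.
Qed.

Let sG_measurable j : <<s G j >> `<=` measurable.
Proof.
apply: smallest_sub; first exact: sigma_algebra_measurable.
exact: G_measurable.
Qed.

Let indep j E B : <<s G j >> E -> measurable B ->
  PB (E `&` inc j @^-1` B) = (PB E * N B)%E.
Proof.
move=> sE mB.
have mI : measurable (inc j @^-1` B).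
  by rewrite -[X in measurable X]setTI; exact: minc.
have NBfin : N B \is a fin_num.
  exact: fin_num_measure.
have NB0 : 0 <= fine (N B) by rewrite fine_ge0// measure_ge0.
have NBE : N B = (fine (N B))%:E by rewrite fineK.
pose m1 := mrestr PB mI.
pose m2 := mscale (NngNum NB0) PB.
suff : m1 E = m2 E.
  by rewrite /m1 /m2 /mrestr /mscale/= => ->; rewrite muleC -NBE.
apply: (g_sigma_algebra_measure_unique (G j) _ (fun=> setT)) => //.
- by move=> _; exists (fun=> setT); split => //; apply/seteqP; split.
- by rewrite bigcup_const//; exists O.
- move=> _ _ [B1 [mB1 ->]] [B2 [mB2 ->]].
  exists (fun i => B1 i `&` B2 i); split; first by move=> i; exact: measurableI.
  apply/seteqP; split => w /=.
    by move=> [h1 h2] i ij; split; [exact: h1|exact: h2].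
  by move=> h12; split => i ij; have [] := h12 i ij.
- move=> _ [C [mC ->]].
  rewrite /m1 /m2 /= /mrestr /mscale /= -NBE G_law//.
  pose C' i := if i == j then B else C i.
  have -> : [set w | forall i, (i < j)%N -> C i (inc i w)] `&` inc j @^-1` B =
      [set w | forall i, (i < j.+1)%N -> C' i (inc i w)].
    apply/seteqP; split => w /=.
      move=> [h1 h2] i; rewrite ltnS leq_eqVlt /C'.
      by case: eqVneq => [->//|_ /= /h1].
    move=> h12; split.
      by move=> i ij; have := h12 i (ltnW ij); rewrite /C' ltn_eqF.
    by have := h12 j (ltnSn j); rewrite /C' eqxx.
  rewrite G_law; last by move=> i; rewrite /C'; case: ifP.
  rewrite big_ord_recr/= {2}/C' eqxx muleC; congr (_ * _)%E.
  by apply: eq_bigr => i _; rewrite /C' ltn_eqF.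
- move=> _; change (PB (setT `&` inc j @^-1` B) < +oo)%E.
  by rewrite setTI (le_lt_trans (probability_le1 PB mI))// ltry.
Qed.

(** As [W 0 = 0], a grid value is the sum of the increments before it. *)
Let x_sub j i : (i <= j)%N ->
  measurable_fun setT (x i : g_sigma_algebraType (G j) -> R).
Proof.
elim: i => [_|i IH ij].
  rewrite (_ : x 0%N = cst 0); first exact: measurable_cst.
  by apply/funext => w; rewrite /x mul0r (bm_start hW).
rewrite (_ : x i.+1 = x i \+ inc i); last first.
  by apply/funext => w; rewrite /= /inc addrC subrK.
apply: measurable_funD; first exact: IH (ltnW ij).
move=> _ B mB; rewrite setTI; apply: sub_sigma_algebra.
exists (fun k => if k == i then B else setT); split; first by move=> k; case: ifP.
apply/seteqP; split => w /=.
  by move=> Bw k _; case: eqVneq => [->|].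
by move=> /(_ i ij); rewrite eqxx.
Qed.

Let step j E (f : R -> \bar R) : <<s G j >> E ->
  measurable_fun setT f -> (forall y, 0 <= f y)%E ->
  (\int[PB]_(w in E) f (x j.+1 w) = \int[PB]_(w in E) \int[N]_y f (x j w + y)%R)%E.
Proof.
move=> sE mf f0.
have madd : measurable_fun setT (fun z : R * R => z.1 + z.2).
  by apply: measurable_funD; [exact: measurable_fst|exact: measurable_snd].
pose f2 (z : R * R) := f (z.1 + z.2).
transitivity (\int[PB]_(w in E) f2 (x j w, inc j w))%E.
  by apply: eq_integral => w _; rewrite /f2 /= /inc addrC subrK.
rewrite (@joint_law _ _ _ _ _ _ R R R PB N E (x j) (inc j) snd)//.
- exact: (@sG_measurable j _ sE).
- move=> C B mC mB /=.
  have sEC : <<s G j >> (E `&` x j @^-1` C).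
    have -> : E `&` x j @^-1` C = ~` (~` E `|` ~` (x j @^-1` C)).
      by rewrite setCU !setCK.
    have sC : <<s G j >> (x j @^-1` C).
      by have := x_sub (leqnn j) measurableT mC; rewrite setTI.
    have [s0 sCc sU] := smallest_sigma_algebra setT (G j).
    rewrite -setTD; apply: (sCc).
    rewrite -bigcup2E; apply: sU => -[|[|]]//=; rewrite -setTD; exact: (sCc).
  rewrite (indep sEC mB) muleC; apply/esym.
  exact: (integral_cst PB (@sG_measurable j _ sEC) (N B)).
- exact: (measurableT_comp mf).
- by move=> z; exact: f0.
Qed.

Variables (stay : nat -> R -> bool) (F : nat -> R -> \bar R) (n : nat).
Hypothesis mstay : forall j, measurable [set y | stay j y].
Hypothesis mF : forall j, measurable_fun setT (F j).
Hypothesis F0 : forall j y, (0 <= F j y)%E.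
Hypothesis FN : forall j y, (j < n)%N -> F j y = (\int[N]_z F j.+1 (y + z)%R)%E.

(** [find] returns the length [k] when no test succeeds, so this is the first exit index capped at
    [k]. *)
Definition grid_exit (k : nat) (w : OmegaB) : nat :=
  find (fun j => ~~ stay j (x j w)) (iota 0 k).

Let H k := [set w | ~~ has (fun j => ~~ stay j (x j w)) (iota 0 k.+1)].

Let grid_exitS k w : grid_exit k.+1 w = if w \in H k then k.+1 else grid_exit k w.
Proof.
rewrite /grid_exit; case: ifPn => [/set_mem Hw|/negP Hw].
  by rewrite hasNfind// size_iota.
have {Hw} : has (fun j => ~~ stay j (x j w)) (iota 0 k.+1).
  by apply/negPn/negP => Hw'; apply: Hw; exact/mem_set.
rewrite -addn1 iotaD find_cat has_cat add0n /= orbF.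
case: ifP => //= /negbT hasN.
by move=> ->; rewrite addn0 hasNfind// size_iota.
Qed.

Let grid_exitH k w : w \in H k -> grid_exit k w = k.
Proof.
move=> /set_mem Hw; have : ~~ has (fun j => ~~ stay j (x j w)) (iota 0 k.+1) by [].
rewrite -addn1 iotaD has_cat negb_or => /andP[hN _].
by rewrite /grid_exit hasNfind// size_iota.
Qed.

Let sH k : <<s G k >> (H k).
Proof.
have [s0 sCc sU] := smallest_sigma_algebra setT (G k).
suff HH m : (m <= k)%N -> <<s G k >> (H m) by exact: HH.
have sS j : (j <= k)%N -> <<s G k >> (~` (x j @^-1` [set y | stay j y])).
  by move=> jk; rewrite -setTD; apply: (sCc); have := x_sub jk measurableT (mstay j); rewrite setTI.
move=> mk.
have -> : H m = ~` (\bigcup_j (if (j <= m)%N then ~` (x j @^-1` [set y | stay j y]) else set0)).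
  apply/seteqP; split => w /=.
    move=> /hasPn Hw [j _]; case: ifP => // jm /= ns.
    have := Hw j; rewrite mem_iota /= add0n ltnS jm negbK => /(_ isT) s; exact: ns.
  move=> Hw; apply/hasPn => j; rewrite mem_iota /= add0n ltnS => jm.
  by rewrite negbK; apply: contrapT => ns; apply: Hw; exists j => //; rewrite jm.
rewrite -setTD; apply: (sCc); apply: sU => j; case: ifP => // jm.
by apply: sS; exact: leq_trans jm mk.
Qed.

Let Fk k w := F (grid_exit k w) (x (grid_exit k w) w).

Let FkS k w : Fk k.+1 w = if w \in H k then F k.+1 (x k.+1 w) else Fk k w.
Proof. by rewrite /Fk grid_exitS; case: ifP. Qed.

Lemma measurable_grid_stopped k : measurable_fun setT (Fk k).
Proof.
elim: k => [|k IH]; first exact: (measurableT_comp (mF 0) (mx 0)).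
rewrite (_ : Fk k.+1 = fun w => if w \in H k then F k.+1 (x k.+1 w) else Fk k w); last first.
  by apply/funext => w; rewrite FkS.
apply: measurable_fun_ifT => //; last exact: (measurableT_comp (mF k.+1) (mx k.+1)).
apply: (measurable_fun_bool true); rewrite setTI.
rewrite (_ : _ @^-1` _ = H k); first exact: (@sG_measurable k _ (@sH k)).
by apply/seteqP; split => w /=; [move/set_mem|move/mem_set].
Qed.

Lemma grid_optional_stopping k : (k <= n)%N -> (\int[PB]_w Fk k w = F 0%N 0)%E.
Proof.
elim: k => [_|k IH kn].
  rewrite (eq_integral (cst (F 0%N 0))); last first.
    by move=> w _; rewrite /Fk /grid_exit /= /x mul0r (bm_start hW).
  by rewrite integral_cst//= probability_setT mule1.
rewrite -(IH (ltnW kn)).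
have mH : measurable (H k) by exact: (@sG_measurable k _ (@sH k)).
have mHC : measurable (~` H k) by exact: measurableC.
rewrite -(setUv (H k)) !ge0_integral_setU//; last 6 first.
- by rewrite setUv; exact: measurable_grid_stopped.
- by move=> w _; exact: F0.
- by rewrite disj_set2E setICr.
- by rewrite setUv; exact: measurable_grid_stopped.
- by move=> w _; exact: F0.
- by rewrite disj_set2E setICr.
congr (_ + _)%E; last first.
  by apply: eq_integral => w /set_mem Hw; rewrite FkS memNset.
transitivity (\int[PB]_(w in H k) F k.+1 (x k.+1 w))%E.
  by apply: eq_integral => w Hw; rewrite FkS Hw.
rewrite (step (@sH k))//.
by apply: eq_integral => w Hw; rewrite /Fk grid_exitH// FN.
Qed.

End brownian_grid.

(** * Exit time of a Brownian spheroid *)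

Lemma ge0_integral_full d (T : measurableType d) (R : realType)
    (P : {measure set T -> \bar R}) (D : set T) (f : T -> \bar R) :
  measurable D -> P (~` D) = 0 -> measurable_fun setT f ->
  (forall x, 0 <= f x)%E -> (\int[P]_x f x = \int[P]_(x in D) f x)%E.
Proof.
move=> mD PD mf f0; rewrite (@ge0_negligible_integral _ _ _ P _ (~` D))//.
  by rewrite setTD setCK.
exact: measurableC.
Qed.

(** Meant for functionals of the path that are limits only on a full event of good paths; the limit
    gets its measurability there from the approximations. *)
Lemma full_bounded_cvg d (T : measurableType d) (R : realType)
    (P : probability T R) (D : set T) (f_ : nat -> T -> R) (f : T -> R) (M : R) :
  measurable D -> P (~` D) = 0 -> (forall k, measurable_fun setT (f_ k)) ->
  (forall k x, 0 <= f_ k x <= M) ->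
  (forall x, D x -> f_ k x @[k --> \oo] --> f x) ->
  measurable_fun D f /\
  (\int[P]_x (f_ k x)%:E @[k --> \oo] --> \int[P]_(x in D) (f x)%:E)%E.
Proof.
move=> mD PD mf bf cf.
have mg : measurable_fun D f.
  apply: (measurable_fun_cvg (h := f_)) => // k; exact: measurable_funTS.
split=> //.
have [//|||||_ _] := @dominated_convergence _ _ _ P D mD
  (fun k => EFin \o f_ k) (EFin \o f) (EFin \o cst M).
- by move=> k; apply/measurable_EFinP; exact: measurable_funTS.
- exact/measurable_EFinP.
- by apply: aeW => x Dx /=; apply: cvg_EFin; [exact: nearW|exact: cf].
- exact: finite_measure_integrable_cst.
- by apply: aeW => x k _ /=; rewrite lee_fin; have /andP[f0 fM] := bf k x; rewrite ger0_norm.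
rewrite /= => H; have -> // : (fun k => \int[P]_x (f_ k x)%:E)%E =
  (fun k => \int[P]_(x in D) (f_ k x)%:E)%E.
apply/funext => k.
rewrite (@ge0_integral_full _ _ _ P D (fun x => (f_ k x)%:E))//.
- exact/measurable_EFinP.
- by move=> x; rewrite lee_fin; have /andP[] := bf k x.
Qed.

Lemma continuous_maxr0 (R : realType) (f : R -> R) :
  {within `[0, +oo[, continuous f} -> continuous (fun t : R => f (Num.max t 0)).
Proof.
move=> /subspace_continuousP cf t.
apply: (@cvg_comp _ _ _ (fun s : R => Num.max s 0) f _
  (within `[0, +oo[%classic (nbhs (Num.max t 0)))); last first.
  by apply: cf; rewrite /= in_itv/= le_max lexx orbT.
have cm : {for t, continuous ((id : R -> R^o) \max cst 0)}.
  by apply: continuous_max; [exact: cvg_id|exact: cvg_cst].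
move=> U /= /cm HU.
apply: (@filterS _ (nbhs t) _ _ _ _ HU) => s.
have hs : `[0, +oo[%classic (Num.max s 0) by rewrite /= in_itv/= le_max lexx orbT.
by move/(_ hs).
Qed.

Section psi_theory.
Context {R : realType}.
Implicit Types d u : R.

Lemma psi_ge0 d u : 0 <= psi d u.
Proof. exact: sqrtr_ge0. Qed.

Lemma psi0 d : psi d 0 = 0.
Proof. by rewrite /psi mul0r sqrtr0. Qed.

Lemma psi_sqr d u : 0 < u -> u <= d ^+ 2 -> psi d u ^+ 2 = u * ln (d ^+ 2 / u).
Proof.
move=> u0 ud; rewrite /psi sqr_sqrtr//; apply: mulr_ge0; first exact: ltW.
by apply: ln_ge0; rewrite ler_pdivlMr// mul1r.
Qed.

Lemma psi_out d u : 0 < d -> d ^+ 2 <= u -> psi d u = 0.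
Proof.
move=> d0 du; apply/eqP; rewrite sqrtr_eq0.
have d20 : 0 < d ^+ 2 by rewrite exprn_gt0.
have u0 : 0 < u by exact: lt_le_trans du.
rewrite pmulr_rle0//; apply: ln_le0.
by rewrite ler_pdivrMr// mul1r.
Qed.

(** The maximum of u ln(d^2 / u) is d^2 / e, reached at u = d^2 / e. It comes here from ln r <= r /
    e with r = d^2 / u, that is exp x >= 1 + x at x = ln r - 1. *)
Lemma psi_bound d u : 0 < d -> psi d u <= d / Num.sqrt (expR 1).
Proof.
move=> d0; have e0 : 0 < expR 1 :> R by exact: expR_gt0.
have bnd0 : 0 <= d / Num.sqrt (expR 1) by rewrite divr_ge0 ?sqrtr_ge0 ?ltW.
rewrite -(@ler_pXn2r _ 2) ?nnegrE ?psi_ge0//.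
have [u0|u0] := leP u 0.
  rewrite /psi (_ : _ * _ = 0) ?sqrtr0 ?expr0n ?exprn_ge0//.
  by rewrite ln0 ?mulr0// mulr_ge0_le0 ?sqr_ge0// invr_le0.
have [ud|/ltW du] := leP u (d ^+ 2); last first.
  by rewrite psi_out// expr0n/= exprn_ge0.
rewrite psi_sqr// expr_div_n (sqr_sqrtr (ltW e0)).
set r := d ^+ 2 / u.
have r0 : 0 < r by rewrite divr_gt0// exprn_gt0.
have lnr : ln r <= r / expR 1.
  have := @expR_ge1Dx R (ln r - 1).
  by rewrite addrC subrK expRB lnK ?posrE.
have -> : d ^+ 2 / expR 1 = u * (r / expR 1) by rewrite /r; field; rewrite !gt_eqF.
by rewrite ler_pM2l.
Qed.

Lemma psi_continuous d u : 0 < u -> {for u, continuous (psi d)}.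
Proof.
move=> u0; have [->|d0] := eqVneq d 0.
  have -> : psi 0 = cst 0 :> (R -> R).
    by apply/funext => v; rewrite /psi expr0n/= mul0r ln0// mulr0 sqrtr0.
  exact: cvg_cst.
apply: (@continuous_comp _ _ _ (fun u => u * ln (d ^+ 2 / u)) Num.sqrt); last first.
  exact: sqrt_continuous.
apply: cvgM; first exact: cvg_id.
apply: (@continuous_comp _ _ _ (fun u => d ^+ 2 / u) (@ln R)).
  apply: cvgM; first exact: cvg_cst.
  by apply: cvgV; [rewrite gt_eqF|exact: cvg_id].
by apply: continuous_ln; rewrite divr_gt0// exprn_even_gt0.
Qed.

End psi_theory.

Section exit_time.
Context (R : realType) (dB : measure_display) (OmegaB : measurableType dB)
  (PB : probability OmegaB R) (W : R -> OmegaB -> R).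
Hypothesis hW : brownian_motion PB W.
Implicit Types (d u : R) (w : OmegaB).

(** By continuity of the path and of [psi] this set of times is open; the properties of its infimum
    rest on that. *)
Let S d w := [set u | 0 < u /\ psi d u < `|W u w|].
Local Notation tau d w := (brownian_exit_time W d w).

Let tauE d w : tau d w = inf (S d w).
Proof.
rewrite /brownian_exit_time; congr inf; apply/seteqP; split => u /= [u0].
  by rewrite in_itv/= -ler_norml -ltNge.
by move=> h; split=> //; rewrite in_itv/= -ler_norml -ltNge.
Qed.

Let lbS d w : lbound (S d w) 0.
Proof. by move=> u [/ltW]. Qed.

Let has_infS d w : S d w !=set0 -> has_inf (S d w).
Proof. by move=> ne; split => //; exists 0. Qed.

Lemma brownian_exit_time_ge0 d w : 0 <= tau d w.
Proof.
rewrite tauE; have [->|/set0P ne] := eqVneq (S d w) set0; first by rewrite inf0.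
by apply: lb_le_inf.
Qed.

Let tau_le d w u : S d w u -> tau d w <= u.
Proof. by move=> Su; rewrite tauE; apply: ge_inf => //; exists 0. Qed.

Let tau_lt d w c : S d w !=set0 -> tau d w < c -> exists2 u, S d w u & u < c.
Proof.
move=> ne; rewrite tauE -subr_gt0 => tc.
have [u Su] := inf_adherent tc (has_infS ne).
by rewrite addrC subrK => uc; exists u.
Qed.

Let inside d w u : 0 < u -> u < tau d w -> `|W u w| <= psi d u.
Proof.
move=> u0 ut; rewrite leNgt; apply/negP => h.
by have := @tau_le d w u (conj u0 h); rewrite leNgt ut.
Qed.

Let Wcont w : continuous (fun t : R => W (Num.max t 0) w).
Proof. by apply: (@continuous_maxr0 R (W^~ w)); exact: (bm_continuous hW). Qed.

Let gap d w u : 0 < u -> {for u, continuous (fun v : R => `|W (Num.max v 0) w| - psi d v)}.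
Proof.
move=> u0; apply: cvgB; last exact: psi_continuous.
by apply: cvg_norm; exact: Wcont.
Qed.

Let open_near d w u : S d w u -> \forall v \near u, S d w v.
Proof.
move=> [u0 h].
have h' : 0 < `|W (Num.max u 0) w| - psi d u by rewrite subr_gt0 max_l// ltW.
have H := cvgr_gt _ (@gap d w u u0) _ h'.
near=> v; have v0 : 0 < v by near: v; exact: lt_nbhsr.
have : 0 < `|W (Num.max v 0) w| - psi d v by near: v; exact: H.
by rewrite subr_gt0 max_l ?ltW// => hv; split.
Unshelve. all: by end_near. Qed.

Let open_near2 d w u : 0 < u -> `|W u w| < psi d u -> \forall v \near u, ~ S d w v.
Proof.
move=> u0 h.
have h' : `|W (Num.max u 0) w| - psi d u < 0 by rewrite subr_lt0 max_l// ltW.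
have H := cvgr_lt _ (@gap d w u u0) _ h'.
near=> v; have v0 : 0 < v by near: v; exact: lt_nbhsr.
have : `|W (Num.max v 0) w| - psi d v < 0 by near: v; exact: H.
rewrite subr_lt0 max_l ?ltW// => hv.
by move=> [_]; rewrite ltNge ltW.
Unshelve. all: by end_near. Qed.

(** Strictly outside at [tau], openness would give exits before [tau]; strictly inside, there would
    be none just after it, against the infimum. At [tau = 0] both sides vanish. *)
Let W_tau d w : S d w !=set0 -> `|W (tau d w) w| = psi d (tau d w).
Proof.
move=> ne; have [t0|t0] := leP (tau d w) 0.
  have -> : tau d w = 0 by apply/eqP; rewrite eq_le t0 brownian_exit_time_ge0.
  by rewrite psi0 (bm_start hW) normr0.
apply/eqP; rewrite eq_le !leNgt; apply/andP; split; apply/negP => h.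
  have /nbhs_ballP[e /= e0 be] := open_near (conj t0 h).
  pose v := tau d w - e / 2.
  have /be/tau_le : ball (tau d w) e v.
    by rewrite /ball/= /v opprB addrC subrK gtr0_norm ?divr_gt0// ltr_pdivrMr// mulr_natr mulr2n ltrDl.
  by rewrite /v lerBrDr gerDl leNgt divr_gt0.
have /nbhs_ballP[e /= e0 be] := open_near2 t0 h.
have [u Su ut] : exists2 u, S d w u & u < tau d w + e.
  by apply: tau_lt => //; rewrite ltrDl.
apply: (be u) => //; rewrite /ball/= distrC ger0_norm; last by rewrite subr_ge0 tau_le.
by rewrite ltrBlDl.
Qed.

(** [psi] is 0 after d^2, so a path nonzero at all the times d^2 + 1 / (n + 1) has exited by each of
    them. This gives [tau <= d ^+ 2] and excludes the default [inf set0 = 0]. The excluded paths are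
    negligible because a Gaussian law has no atom. *)
Let good d := [set w | forall n, W (d ^+ 2 + n.+1%:R^-1) w != 0].

Let good_measurable d : measurable (good d).
Proof.
have -> : good d = \bigcap_n (W (d ^+ 2 + n.+1%:R^-1) @^-1` (~` [set 0])).
  by apply/seteqP; split => w /=; [move=> h n _; exact/eqP/h|move=> h n; apply/eqP/h].
apply: bigcap_measurableType => n _.
rewrite -[X in measurable X]setTI.
apply: (bm_measurable hW) => //; first by rewrite addr_ge0 ?sqr_ge0.
by apply: measurableC.
Qed.

Let goodC d : PB (~` good d) = 0.
Proof.
apply/negligibleP; first exact: measurableC.
have -> : ~` good d = \bigcup_n (W (d ^+ 2 + n.+1%:R^-1) @^-1` [set 0]).
  apply/seteqP; split => w /=.
    by move=> /existsNP[n /negP]; rewrite negbK => /eqP h; exists n.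
  by move=> [n _ /= h] /(_ n); rewrite h eqxx.
apply: negligible_bigcup => n; set u := _ + _.
have u0 : 0 < u by rewrite ltr_wpDl ?sqr_ge0 ?invr_gt0.
have m0 : measurable ([set 0] : set R) by [].
apply/negligibleP.
  by rewrite -[X in measurable X]setTI; apply: (bm_measurable hW) => //; exact: ltW.
have := @bm_normal _ _ _ _ _ hW 0 u [set 0] (lexx _) u0 m0.
rewrite subr0 (_ : [set w | _] = W u @^-1` [set 0]); last first.
  by apply/seteqP; split => w /=; rewrite (bm_start hW) subr0.
by move=> E; apply: (etrans E); rewrite /normal_prob integral_set1.
Qed.

Let goodS d w : 0 < d -> good d w -> S d w !=set0.
Proof.
move=> d0 /(_ 0%N) h; exists (d ^+ 2 + 1%:R^-1); split.
  by rewrite ltr_wpDl ?sqr_ge0 ?invr_gt0.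
by rewrite psi_out ?normr_gt0// lerDl.
Qed.

Let good_le d w : 0 < d -> good d w -> tau d w <= d ^+ 2.
Proof.
move=> d0 h; apply/ler_addgt0Pr => e e0.
have [n ne] : exists n : nat, n.+1%:R^-1 < e.
  by have [n _ hn] := near_infty_natSinv_lt (PosNum e0); exists n; apply: hn => /=.
apply: (@le_trans _ _ (d ^+ 2 + n.+1%:R^-1)); last by rewrite lerD2l ltW.
apply: tau_le; split; first by rewrite ltr_wpDl ?sqr_ge0 ?invr_gt0.
by rewrite psi_out ?normr_gt0// lerDl.
Qed.

(** Joint in the size and the path, since the size is itself random along the walk. The exit times
    forming an open set, an infimum below [c] is witnessed by a rational. *)
Lemma measurable_brownian_exit_time :
  measurable_fun setT (fun p : R * OmegaB => tau p.1 p.2).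
Proof.
have mS q : 0 < q -> measurable [set p : R * OmegaB | psi p.1 q < `|W q p.2|].
  move=> q0.
  have m1 : measurable_fun setT (fun p : R * OmegaB => psi p.1 q).
    exact: (@measurable_psi _ _ R fst (cst q)).
  have m2 : measurable_fun setT (fun p : R * OmegaB => `|W q p.2|).
    apply: measurableT_comp => //; apply: (measurableT_comp (bm_measurable hW (ltW q0))).
    exact: measurable_snd.
  have mt : measurable [set true] by [].
  by have := measurable_fun_ltr m1 m2 measurableT mt; rewrite setTI.
have ratS d w u : S d w u -> forall c, u < c -> exists2 q : rat, (0 : R) < ratr q < c & psi d (ratr q) < `|W (ratr q) w|.
  move=> Su c uc; have /nbhs_ballP[e /= e0 be] := open_near Su.
  have : u < Num.min c (u + e) by rewrite lt_min uc ltrDl.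
  move=> /rat_in_itvoo[q]; rewrite in_itv/= lt_min => /and3P[uq qc que].
  have [q0 hq] : S d w (ratr q).
    by apply: be; rewrite /ball/= distrC gtr0_norm ?subr_gt0// ltrBlDl.
  by exists q => //; rewrite qc andbT.
pose A (q : rat) := [set p : R * OmegaB | psi p.1 (ratr q) < `|W (ratr q) p.2|].
(* The paths that never exit. There [inf set0 = 0], so they belong to every event [tau < c] with
   [0 < c]. *)
pose N := ~` (\bigcup_q (if 0 < ratr q :> R then A q else set0)).
have mN : measurable N.
  by apply: measurableC; apply: bigcupT_measurable_rat => q; case: ifP => // q0; exact: mS.
apply: (measurability _ (RGenInftyO.measurableE R)) => //.
move=> _ [_ [c ->] <-]; rewrite setTI.
have [c0|c0] := leP c 0.
  rewrite (_ : _ @^-1` _ = set0)//; apply/seteqP; split => p //=.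
  by rewrite in_itv/= ltNge (le_trans c0)// brownian_exit_time_ge0.
rewrite (_ : _ @^-1` _ = N `|` \bigcup_q (if (0 : R) < ratr q < c then A q else set0)).
  apply: measurableU => //; apply: bigcupT_measurable_rat => q.
  by case: ifP => // /andP[q0 _]; exact: mS.
apply/seteqP; split => -[d w] /=; rewrite in_itv/=.
  move=> tc; have [S0|/set0P ne] := eqVneq (S d w) set0.
    left => -[q _]; case: ifP => // q0 /= h.
    by have : S d w (ratr q) by []; rewrite S0.
  right; have [u Su uc] := tau_lt ne tc.
  by have [q qc hq] := ratS _ _ _ Su _ uc; exists q => //; rewrite qc.
move=> [Nw|[q _]]; last first.
  case: ifP => // /andP[q0 qc] /= h.
  by apply: le_lt_trans qc; apply: tau_le.
rewrite tauE (_ : S d w = set0) ?inf0//; apply/seteqP; split => u // Su.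
have u1 : u < u + 1 by rewrite ltrDl.
have [q /andP[q0 _] hq] := ratS _ _ _ Su _ u1.
by apply: Nw; exists q => //; rewrite q0.
Qed.

Section stopped_at.
Variables d r : R.
Hypotheses (d0 : 0 < d) (r0 : 0 < r).

Let h (k : nat) : R := r / k.+1%:R.
Let stay (k j : nat) (y : R) : bool := `|y| <= psi d (j%:R * h k).
Let idx k w := grid_exit W (h k) (stay k) k.+1 w.
Let gt k w := (idx k w)%:R * h k.
Let t w := Num.min (tau d w) r.

Let h0 k : 0 < h k.
Proof. by rewrite divr_gt0. Qed.

Let idx_le k w : (idx k w <= k.+1)%N.
Proof. by rewrite /idx /grid_exit (leq_trans (find_size _ _))// size_iota. Qed.

Let hE k : k.+1%:R * h k = r.
Proof. by rewrite /h mulrC divfK. Qed.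

Let gt_le k w : gt k w <= r.
Proof. by rewrite -(hE k) ler_pM2r// ler_nat. Qed.

Let gt_ge0 k w : 0 <= gt k w.
Proof. by rewrite mulr_ge0// ltW. Qed.

Let idx_out k w : (idx k w < k.+1)%N -> S d w (gt k w).
Proof.
rewrite /gt /idx /grid_exit; set P := (fun j => _); set s := iota 0 k.+1 => fs.
have hP : has P s by rewrite has_find size_iota.
have := nth_find 0 hP; rewrite nth_iota// add0n /P /stay -ltNge => out.
split => //; rewrite mulr_gt0// ltr0n lt0n; apply/eqP => f0.
by move: out; rewrite f0 mul0r psi0 (bm_start hW) normr0 ltxx.
Qed.

Let idx_lt k w j : (j < k.+1)%N -> S d w (j%:R * h k) -> (idx k w <= j)%N.
Proof.
move=> jk [_ Sj]; rewrite leqNgt; apply/negP => ji.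
have := before_find 0 ji; rewrite nth_iota// add0n /stay => /negbFE.
by rewrite leNgt Sj.
Qed.

Let gt_ge k w : t w <= gt k w.
Proof.
have := idx_le k w; rewrite leq_eqVlt => /predU1P[E|/idx_out/tau_le le].
  by rewrite /gt E hE /t ge_min lexx orbT.
by rewrite /t ge_min le.
Qed.

(** A grid exit is a true exit, whence [t <= gt k]. Conversely an exit at [u] close to [tau] comes
    with a whole interval of exits, which contains the last grid point before [u] once the mesh is
    finer than the interval. *)
Let gt_cvg w : S d w !=set0 -> gt k w @[k --> \oo] --> t w.
Proof.
move=> ne; apply/cvgrPdist_le => e e0.
have [rt|tr] := leP r (tau d w).
  near=> k; rewrite distrC ger0_norm ?subr_ge0// /t min_r//.
  by rewrite lerBlDl (le_trans (gt_le _ _))// lerDl ltW.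
have lt1 : tau d w < Num.min r (tau d w + e) by rewrite lt_min tr ltrDl.
have [u Su] := tau_lt ne lt1; rewrite lt_min => /andP[ur ue].
have /nbhs_ballP[b /= b0 bb] := open_near Su.
near=> k.
have hb : h k < b.
  rewrite /h -ltr_pdivlMl//; near: k.
  have q0 : 0 < r^-1 * b by rewrite mulr_gt0// invr_gt0.
  have := near_infty_natSinv_lt (PosNum q0); apply: filterS => k /=.
  exact.
have u0 : 0 <= u by case: Su => /ltW.
have uh0 : 0 <= u / h k by rewrite divr_ge0// ltW.
have /andP[j1 j2] := truncn_itv uh0; set j := Num.truncn _ in j1 j2.
have ju : j%:R * h k <= u by rewrite -ler_pdivlMr.
have uj : u < j.+1%:R * h k by rewrite -ltr_pdivrMr.
have jk : (j < k.+1)%N.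
  by rewrite -(ltr_nat R) -(ltr_pM2r (h0 k)) hE (le_lt_trans ju).
have Sj : S d w (j%:R * h k).
  apply: bb; rewrite /ball/= ger0_norm ?subr_ge0//.
  rewrite ltrBlDr (lt_trans uj)// -natr1 mulrDl mul1r addrC ltrD2r//.
have := idx_lt jk Sj; rewrite -(ler_nat R) -(ler_pM2r (h0 k)) => gj.
rewrite distrC ger0_norm ?subr_ge0// /t min_l ?(ltW tr)//.
by rewrite lerBlDl (le_trans gj)// (le_trans ju)// ltW.
Unshelve. all: by end_near. Qed.

Let mstay k j : measurable [set y : R | stay k j y].
Proof.
rewrite (_ : [set _ | _] = `[- psi d (j%:R * h k), psi d (j%:R * h k)]%classic)//.
by apply/seteqP; split => y; rewrite /= in_itv/= /stay ler_norml.
Qed.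

Let mstopped k (G : R -> R -> R) : (forall u, measurable_fun setT (G u)) ->
  measurable_fun setT (fun w => G (gt k w) (W (gt k w) w)).
Proof.
move=> mG; apply/measurable_EFinP.
apply: (@measurable_grid_stopped _ _ _ PB W hW (h k) (h0 k) (stay k)
  (fun j y => (G (j%:R * h k) y)%:E)) => //.
by move=> j; apply/measurable_EFinP.
Qed.

Let mgt k : measurable_fun setT (gt k).
Proof. by apply: (@mstopped k (fun u _ => u)) => u; exact: measurable_cst. Qed.

(** Either condition keeps v - u of constant sign for u in [0, r], as [heat_normal] requires at each
    grid step. *)
Let grid_heat k v zeta : r < v \/ v < 0 ->
  (\int[PB]_w (heat (v - gt k w) (W (gt k w) w - zeta))%:E = (heat v (- zeta))%:E)%E.
Proof.
move=> hv.
have sub j : (j <= k.+1)%N -> v < 0 \/ 0 < v - j%:R * h k.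
  move=> jk; case: hv => [rv|]; [right|by left].
  by rewrite subr_gt0 (le_lt_trans _ rv)// -(hE k) ler_pM2r// ler_nat.
pose F j y := (heat (v - j%:R * h k) (y - zeta))%:E.
have := @grid_optional_stopping _ _ _ PB W hW (h k) (h0 k) (stay k) F k.+1
  (mstay k) _ _ _ k.+1 (leqnn _).
rewrite /F mul0r subr0 sub0r; apply.
- move=> j; apply/measurable_EFinP; apply: measurableT_comp; first exact: measurable_heat.
  exact: measurable_funB.
- by move=> j y; rewrite lee_fin heat_ge0.
- move=> j y jk; rewrite -(@heat_normal _ (h k))//.
    apply: eq_integral => z _; congr (heat _ _)%:E.
      by rewrite -natr1; ring.
    by ring.
  have -> : v - j%:R * h k - h k = v - j.+1%:R * h k by rewrite -natr1; ring.
  case: (sub _ jk) => [v0|v0].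
    have jh : 0 <= j%:R * h k by rewrite mulr_ge0// ltW.
    have jh1 : 0 <= j.+1%:R * h k by rewrite mulr_ge0// ltW.
    by rewrite nmulr_rgt0 ?subr_lt0 ?(lt_le_trans v0)// .
  rewrite mulr_gt0// (lt_trans v0)// ltrD2l ltrN2 ltr_pM2r// ltr_nat//.
Qed.

(** For [r < v] the kernel is continuous and bounded by (v - r)^(-1/2) up to the horizon, so
    dominated convergence carries the grid identity to [t]. *)
Let os_good v zeta : r < v ->
  measurable_fun (good d) (fun w => heat (v - t w) (W (t w) w - zeta)) /\
  (\int[PB]_(w in good d) (heat (v - t w) (W (t w) w - zeta))%:E =
   (heat v (- zeta))%:E)%E.
Proof.
move=> rv.
pose f k w := heat (v - gt k w) (W (gt k w) w - zeta).
pose g w := heat (v - t w) (W (t w) w - zeta).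
have mf k : measurable_fun setT (f k).
  apply: (@mstopped k (fun u y => heat (v - u) (y - zeta))) => u.
  by apply: measurableT_comp; [exact: measurable_heat|exact: measurable_funB].
have tr w : t w <= r by rewrite /t ge_min lexx orbT.
have t0 w : 0 <= t w by rewrite /t le_min brownian_exit_time_ge0 ltW.
have fg w : good d w -> f k w @[k --> \oo] --> g w.
  move=> gw; have cg := gt_cvg (goodS d0 gw).
  have cW : W (gt k w) w @[k --> \oo] --> W (t w) w.
    have -> : W (t w) w = W (Num.max (t w) 0) w by rewrite max_l.
    have -> : (fun k => W (gt k w) w) = (fun k => W (Num.max (gt k w) 0) w).
      by apply/funext => k; rewrite max_l.
    apply: (@cvg_comp _ _ _ (fun k => gt k w) (fun s : R => W (Num.max s 0) w) _ _ _ cg).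
    exact: Wcont.
  have cv : v - gt k w @[k --> \oo] --> v - t w by apply: cvgB => //; exact: cvg_cst.
  have vt0 : v - t w != 0 by rewrite gt_eqF// subr_gt0 (le_lt_trans (tr w)).
  apply: cvgM.
    apply: cvgV; first by rewrite gt_eqF// sqrtr_gt0 normr_gt0.
    apply: continuous_cvg; first exact: sqrt_continuous.
    by apply: cvg_norm.
  apply: continuous_cvg; first exact: continuous_expR.
  apply: cvgM.
    apply: cvgN; rewrite expr2; under eq_cvg do rewrite expr2.
    by apply: cvgM; apply: cvgB => //; exact: cvg_cst.
  apply: cvgV; first by rewrite mulf_neq0.
  by apply: cvgM => //; exact: cvg_cst.
have bnd k w : 0 <= f k w <= (Num.sqrt (v - r))^-1.
  have vr : 0 < v - r by rewrite subr_gt0.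
  have v1 : 0 < v - gt k w by rewrite subr_gt0 (le_lt_trans (gt_le k w)).
  rewrite heat_ge0/= /f /heat -[leRHS]mulr1.
  apply: ler_pM; rewrite ?invr_ge0 ?sqrtr_ge0 ?expR_ge0//.
    rewrite lef_pV2 ?posrE ?sqrtr_gt0//; last by rewrite normr_gt0 gt_eqF.
    by apply: ler_wsqrtr; rewrite gtr0_norm// lerD2l lerN2.
  rewrite -expR0 ler_expR mulNr oppr_le0 divr_ge0 ?sqr_ge0//.
  by rewrite mulr_ge0// ltW.
have [mg cg] := full_bounded_cvg (@good_measurable d) (@goodC d) mf bnd fg.
split=> //.
have fE k : (\int[PB]_x (f k x)%:E = (heat v (- zeta))%:E)%E.
  by apply: grid_heat; left.
apply/esym; apply: (cvg_unique _ _ cg) => //.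
have -> : (fun k => \int[PB]_x (f k x)%:E)%E = cst (heat v (- zeta))%:E by exact/funext.
exact: cvg_cst.
Qed.

(** The identities for the centres [zeta] and [- zeta] are added. As |W tau| = psi(tau), the
    symmetrised integrand forgets the sign of W at [tau], exactly as the fair coin of the walk
    does. *)
Lemma exit_heat v zeta : r < v ->
  (\int[PB]_w (if tau d w < r
     then heat (v - tau d w) (psi d (tau d w) - zeta)
          + heat (v - tau d w) (- psi d (tau d w) - zeta)
     else heat (v - r) (W r w - zeta) + heat (v - r) (- W r w - zeta))%:E =
   (2 * heat v zeta)%:E)%E.
Proof.
move=> rv.
set F := fun w : OmegaB => _.
have mtau : measurable_fun setT (fun w => tau d w).
  exact: (measurable_fun_pair2 d measurable_brownian_exit_time).
have mpsi : measurable_fun setT (fun w => psi d (tau d w)) by exact: measurable_psi.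
have mW : measurable_fun setT (W r) by apply: (bm_measurable hW); exact: ltW.
have mF : measurable_fun setT F.
  apply/measurable_EFinP; apply: measurable_fun_ifT => //.
  - exact: measurable_fun_ltr.
  - by apply: measurable_funD; apply: measurable_heat2; apply: measurable_funB => //; apply: measurableT_comp.
  - by apply: measurable_funD; apply: measurable_heat2 => //; apply: measurable_funB => //; apply: measurableT_comp.
have F0 w : (0 <= F w)%E.
  by rewrite /F lee_fin; case: ifP => _; rewrite addr_ge0// heat_ge0.
rewrite (ge0_integral_full (good_measurable d) (goodC d) mF F0).
have [m1 E1] := os_good zeta rv; have [m2 E2] := os_good (- zeta) rv.
transitivity (\int[PB]_(w in good d) ((heat (v - t w) (W (t w) w - zeta))%:E +
    (heat (v - t w) (W (t w) w - (- zeta)))%:E))%E.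
  apply: eq_integral => w /set_mem gw; rewrite /F -EFinD; congr (_%:E).
  rewrite [in RHS](_ : W _ w - - zeta = - (- W (t w) w - zeta)); last by ring.
  rewrite heatN /t; case: ltP => tr //.
  have := W_tau (goodS d0 gw).
  have [W0|W0] := leP 0 (W (tau d w) w).
    by rewrite (ger0_norm W0) => <-.
  by rewrite (ltr0_norm W0) => <-; rewrite [RHS]addrC (opprK (W (tau d w) w)).
rewrite ge0_integralD//.
- by rewrite E1 E2 opprK heatN -EFinD mulr_natl mulr2n.
- by move=> w _; rewrite lee_fin heat_ge0.
- exact/measurable_EFinP.
- by move=> w _; rewrite lee_fin heat_ge0.
- exact/measurable_EFinP.
Qed.

Section mean.
Variable L : R.
Hypotheses (L0 : 0 <= L) (rL : r = d ^+ 2 * expR (- L))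
  (LS : Num.sqrt 2 * expR (- L / 6) / (1 - expR (- ln 2 / 6)) <= 2^-1).

(** Dyadic time scales below [r]. [M i] is ln(d^2 / rho_i), and the weight [c i] brings a growing
    kernel up to at least 1 at every exit between [rho_ i.+1] and [rho_ i]. *)
Let rho_ (i : nat) : R := r / 2 ^+ i.
Let M (i : nat) : R := L + i%:R * ln 2.
Let c (i : nat) : R := Num.sqrt (2 * rho_ i) * expR (- M i / 6).

Let rho_0 i : 0 < rho_ i. Proof. by rewrite divr_gt0// exprn_gt0. Qed.

Let ln20 : 0 < ln 2 :> R. Proof. by rewrite ln_gt0// ltr1n. Qed.

Let M0 i : 0 <= M i.
Proof. by rewrite addr_ge0// mulr_ge0// ltW. Qed.

Let ln_rho i : ln (d ^+ 2 / rho_ i) = M i.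
Proof.
rewrite /rho_ rL expRN.
have -> : d ^+ 2 / (d ^+ 2 / expR L / 2 ^+ i) = expR L * 2 ^+ i.
  by field; rewrite !gt_eqF ?expR_gt0// exprn_gt0.
rewrite lnM ?posrE ?expR_gt0 ?exprn_gt0// expRK lnXn// /M.
by rewrite mulr_natl.
Qed.

(** Outside the spheroid y^2 >= u M_i, and u > rho_i / 2 gives u / (2 (rho_i + u)) >= 1/6: hence the
    exponent M_i / 6 in [c i]. Its factor sqrt(2 rho_i) compensates sqrt(rho_i + u). *)
Let term i u y : 0 < u -> rho_ i.+1 < u -> u <= rho_ i -> psi d u < `|y| ->
  1 <= c i * heat (- rho_ i - u) y.
Proof.
move=> u0 ui iu uy.
have ru : 0 < rho_ i + u by rewrite addr_gt0.
have ui2 : rho_ i < 2 * u.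
  move: ui; rewrite /rho_ exprS invfM mulrCA -/(rho_ i) mulrC ltr_pdivrMr//.
  by rewrite mulrC.
have rd : rho_ i <= d ^+ 2.
  have e2 : 1 <= 2 ^+ i :> R by rewrite exprn_ege1// ler1n.
  rewrite /rho_ rL ler_pdivrMr ?exprn_gt0//.
  apply: ler_pM; rewrite ?expR_ge0 ?exprn_ge0 ?(ltW d0)//.
  by apply: le_trans e2; rewrite -expR0 ler_expR oppr_le0.
have ypsi : u * M i <= y ^+ 2.
  rewrite -ln_rho -(real_normK (num_real y)).
  apply: (@le_trans _ _ (psi d u ^+ 2)); last first.
    by rewrite ler_pXn2r ?nnegrE ?psi_ge0// ltW.
  rewrite psi_sqr ?(le_trans iu)// ler_pM2l// ler_ln ?posrE ?divr_gt0 ?exprn_gt0//.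
  by rewrite ler_pM2l ?exprn_gt0// lef_pV2 ?posrE.
rewrite /c /heat.
have -> : `|- rho_ i - u| = rho_ i + u by rewrite -opprD normrN gtr0_norm.
have -> : - y ^+ 2 / (2 * (- rho_ i - u)) = y ^+ 2 / (2 * (rho_ i + u)).
  by field; rewrite gt_eqF//= -opprD oppr_eq0 gt_eqF.
rewrite mulrACA -expRD; apply: (@le_trans _ _ (1 * 1)); first by rewrite mulr1.
apply: ler_pM => //.
  by rewrite ler_pdivlMr ?sqrtr_gt0// mul1r; apply: ler_wsqrtr; lra.
have h6 : M i / 6 <= y ^+ 2 / (2 * (rho_ i + u)).
  rewrite ler_pdivlMr ?mulr_gt0//; apply: le_trans ypsi.
  by have := M0 i; nra.
apply: (@le_trans _ _ (expR 0)); first by rewrite expR0.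
by rewrite ler_expR mulNr; lra.
Qed.

(** Either the grid time runs up to [r], or the exit falls into one dyadic scale, whose term alone
    is at least [r]. *)
Let pointwise k w :
  r <= gt k w + \sum_(i < k.+1) r * c i * heat (- rho_ i - gt k w) (W (gt k w) w).
Proof.
have s0 (i : 'I_k.+1) : 0 <= r * c i * heat (- rho_ i - gt k w) (W (gt k w) w).
  by rewrite !mulr_ge0 ?heat_ge0 ?sqrtr_ge0 ?expR_ge0// ltW.
have [|ik] := leqP k.+1 (idx k w).
  move=> ki; have E : idx k w = k.+1 by apply/eqP; rewrite eqn_leq ki idx_le.
  by rewrite {1}/gt E hE lerDl; apply: sumr_ge0.
have [u0 out] := idx_out ik.
have hu : h k <= gt k w.
  rewrite /gt ler_peMl ?(ltW (h0 k))// ler1n lt0n; apply/eqP => E.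
  by move: u0; rewrite /gt E mul0r ltxx.
(* The mesh r / (k + 1) exceeds r / 2^(k + 1), so the scales 0 to k cover every positive grid
   time. *)
have ex : exists i, rho_ i.+1 < gt k w.
  exists k; apply: lt_le_trans hu; rewrite /rho_ /h ltr_pM2l//.
  by rewrite ltf_pV2 ?posrE ?exprn_gt0// -natrX ltr_nat ltn_expl.
case: (ex_minnP ex) => i Pi mini.
have iu : gt k w <= rho_ i.
  case: i Pi mini => [_ _|i Pi mini]; first by rewrite /rho_ expr0 divr1.
  by rewrite leNgt; apply/negP => /mini; rewrite ltnn.
have ilek : (i < k.+1)%N.
  rewrite ltnS; apply: mini; apply: lt_le_trans hu; rewrite /rho_ /h ltr_pM2l//.
  by rewrite ltf_pV2 ?posrE ?exprn_gt0// -natrX ltr_nat ltn_expl.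
rewrite (bigD1 (Ordinal ilek))//= -[leLHS]add0r lerD ?gt_ge0//.
rewrite -[leLHS]addr0 lerD//; last by apply: sumr_ge0 => j _; exact: s0.
by rewrite -mulrA ler_peMr ?(ltW r0)//; exact: term.
Qed.

(** By optional stopping the [i]-th term has mean r sqrt(2) exp(- M_i / 6), geometric in [i]. [LS]
    bounds the sum by r / 2, which leaves r / 2 for the mean of [gt k]. *)
Let mean_grid k : ((r / 2)%:E <= \int[PB]_w (gt k w)%:E)%E.
Proof.
pose z : R := expR (- ln 2 / 6).
have z1 : z < 1 by rewrite -expR0 ltr_expR mulNr oppr_lt0 divr_gt0.
have cE i : c i * heat (- rho_ i) 0 = Num.sqrt 2 * expR (- L / 6) * z ^+ i.
  rewrite /c /heat expr0n/= oppr0 mul0r expR0 mulr1 normrN gtr0_norm//.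
  rewrite sqrtrM// /M /z -expRM_natl.
  have -> : - (L + i%:R * ln 2) / 6 = - L / 6 + i%:R * (- ln 2 / 6) by field.
  rewrite expRD; field; by rewrite gt_eqF// sqrtr_gt0.
have geo n : \sum_(i < n) z ^+ i <= (1 - z)^-1.
  rewrite -[leRHS]mul1r ler_pdivlMr ?subr_gt0// mulrC.
  have := subrX1 z n; rewrite -opprB -[z - 1]opprB mulNr => /oppr_inj <-.
  by rewrite gerBl exprn_ge0// expR_ge0.
have mheat_ i : measurable_fun setT
    (fun w => (r * c i * heat (- rho_ i - gt k w) (W (gt k w) w))%:E).
  apply/measurable_EFinP; apply: measurable_funM => //.
  apply: (@mstopped k (fun u y => heat (- rho_ i - u) y)) => u.
  exact: measurable_heat.
have rc0 i : 0 <= r * c i by rewrite !mulr_ge0 ?sqrtr_ge0 ?expR_ge0// ltW.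
have : (r%:E <= \int[PB]_w ((gt k w)%:E + \sum_(i < k.+1)
    (r * c i * heat (- rho_ i - gt k w) (W (gt k w) w))%:E))%E.
  have -> : (r%:E = \int[PB]_w (cst r%:E w))%E.
    by rewrite integral_cst//= probability_setT mule1.
  apply: ge0_le_integral => //.
  - by move=> w _; rewrite lee_fin ltW.
  - apply: emeasurable_funD; first exact/measurable_EFinP.
    exact: emeasurable_sum.
  - by move=> w _; rewrite sumEFin -EFinD lee_fin.
rewrite ge0_integralD//; last 4 first.
- by move=> w _; rewrite lee_fin.
- exact/measurable_EFinP.
- by move=> w _; apply: sume_ge0 => i _; rewrite lee_fin mulr_ge0// heat_ge0.
- exact: emeasurable_sum.
rewrite ge0_integral_sum//; last first.
  by move=> i w _; rewrite lee_fin mulr_ge0// heat_ge0.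
have iE (i : 'I_k.+1) : (\int[PB]_w (r * c i * heat (- rho_ i - gt k w) (W (gt k w) w))%:E =
    (r * (Num.sqrt 2 * expR (- L / 6) * z ^+ i))%:E)%E.
  under eq_integral do rewrite EFinM.
  rewrite ge0_integralZl_EFin//; last 2 first.
  - by move=> w _; rewrite lee_fin heat_ge0.
  - apply/measurable_EFinP.
    apply: (@mstopped k (fun u y => heat (- rho_ i - u) y)) => u.
    exact: measurable_heat.
  have hh : r < - rho_ i \/ - rho_ i < 0 by right; rewrite oppr_lt0.
  have := @grid_heat k _ 0 hh; rewrite oppr0 => E.
  rewrite (_ : integral _ _ _ = (heat (- rho_ i) 0)%:E); last first.
    by rewrite -E; apply: eq_integral => w _; rewrite addr0.
  by rewrite -EFinM -[r * c i * _]mulrA cE.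
under eq_bigr do rewrite iE.
rewrite sumEFin -mulr_sumr -mulr_sumr.
set s := (X in (_ <= _ + X%:E)%E) => rs.
have sr : s <= r / 2.
  rewrite /s ler_pM2l//; apply: le_trans LS.
  rewrite ler_wpM2l ?mulr_ge0 ?sqrtr_ge0 ?expR_ge0//.
have : (r%:E <= \int[PB]_w (gt k w)%:E + (r / 2)%:E)%E.
  by apply: le_trans rs _; rewrite leeD2l// lee_fin.
rewrite -leeBlDr// -EFinB; apply: le_trans; rewrite lee_fin; lra.
Qed.

Lemma exit_mean_lower : ((r / 2)%:E <= \int[PB]_w (tau d w)%:E)%E.
Proof.
have mtau : measurable_fun setT (fun w => tau d w).
  exact: (measurable_fun_pair2 d measurable_brownian_exit_time).
have bnd k w : 0 <= gt k w <= r by rewrite gt_ge0 gt_le.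
have [mt ct] := full_bounded_cvg (@good_measurable d) (@goodC d) mgt bnd
  (fun w gw => gt_cvg (goodS d0 gw)).
rewrite (@ge0_integral_full _ _ _ PB (good d) _ (@good_measurable d) (@goodC d)); last 2 first.
- exact/measurable_EFinP.
- by move=> w; rewrite lee_fin brownian_exit_time_ge0.
apply: (@le_trans _ _ (\int[PB]_(w in good d) (t w)%:E)%E).
  exact: (cvge_ge (nearW _ mean_grid) ct).
apply: ge0_le_integral => //.
- by move=> w _; rewrite lee_fin /t le_min brownian_exit_time_ge0 ltW.
- exact/measurable_EFinP.
- by apply/measurable_EFinP; exact: measurable_funTS.
- by move=> w _; rewrite lee_fin /t ge_min lexx.
Qed.

End mean.
End stopped_at.

Lemma exit_good d : 0 < d -> exists G, [/\ measurable G, PB (~` G) = 0 &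
  forall w, G w -> tau d w <= d ^+ 2 /\
    forall r, 0 < r -> r <= tau d w -> `|W r w| <= psi d r].
Proof.
move=> d0; exists (good d); split => // w gw; split; first exact: good_le.
move=> r r0; rewrite le_eqVlt => /predU1P[->|]; last exact: inside.
by rewrite W_tau//; exact: goodS.
Qed.

(** A substitute for Wald's identity, drawn from the bounded kernel with v = 2 d^2 and horizon d^2.
    Normalised, it has mean 1, and at the exit it is at least 1 + tau / (4 d^2) minus a multiple of
    psi^2. This gives E tau <= 2 sqrt(2) E psi^2, and 2 sqrt(2) <= 3. *)
Lemma exit_sq_lower d : 0 < d ->
  (\int[PB]_w (tau d w)%:E <= 3%:E * \int[PB]_w (psi d (tau d w) ^+ 2)%:E)%E.
Proof.
move=> d0.
have d20 : 0 < d ^+ 2 by rewrite exprn_gt0.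
have mtau : measurable_fun setT (fun w => tau d w).
  exact: (measurable_fun_pair2 d measurable_brownian_exit_time).
have mpsi : measurable_fun setT (fun w => psi d (tau d w)) by exact: measurable_psi.
have v2 : d ^+ 2 < 2 * d ^+ 2 by lra.
have mW : measurable_fun setT (W (d ^+ 2)) by apply: (bm_measurable hW); exact: ltW.
have := exit_heat d0 d20 0 v2; set F := (fun w : OmegaB => EFin _) => EF.
have mF : measurable_fun setT F.
  apply/measurable_EFinP; apply: measurable_fun_ifT => //.
  - exact: measurable_fun_ltr.
  - by apply: measurable_funD; apply: measurable_heat2; apply: measurable_funB => //; apply: measurableT_comp.
  - by apply: measurable_funD; apply: measurable_heat2 => //; apply: measurable_funB => //; apply: measurableT_comp.
have F0 w : (0 <= F w)%E.
  by rewrite /F lee_fin; case: ifP => _; rewrite addr_ge0// heat_ge0.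
pose s2 : R := Num.sqrt 2.
have s2E : s2 ^+ 2 = 2 by rewrite sqr_sqrtr.
have s20 : 0 < s2 by rewrite sqrtr_gt0.
have s21 : 1 < s2 by nra.
have s22 : 4 * s2 <= 6 by nra.
have key w : good d w -> ((1 + tau d w / (4 * d ^+ 2))%:E <=
    (s2 * d / 2)%:E * F w + (s2 / (2 * d ^+ 2) * psi d (tau d w) ^+ 2)%:E)%E.
  move=> gw.
  have t0 := brownian_exit_time_ge0 d w; have td := good_le d0 gw.
  set u := tau d w in t0 td *; set y := psi d u.
  have vu : d ^+ 2 <= 2 * d ^+ 2 - u by lra.
  have vu0 : 0 < 2 * d ^+ 2 - u by exact: lt_le_trans vu.
  have -> : F w = (2 * heat (2 * d ^+ 2 - u) y)%:E.
    rewrite /F -/u; case: ltP => ud.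
      by congr (_%:E); rewrite !subr0 heatN -/y; ring.
    have ue : u = d ^+ 2 by apply/eqP; rewrite eq_le td.
    have := W_tau (goodS d0 gw); rewrite -/u ue psi_out// => /eqP.
    rewrite normr_eq0 => /eqP W0; congr (_%:E).
    by rewrite /y ue psi_out// W0 !subr0 oppr0; ring.
  rewrite -EFinM -EFinD lee_fin.
  have -> : s2 * d / 2 * (2 * heat (2 * d ^+ 2 - u) y) = s2 * d * heat (2 * d ^+ 2 - u) y by field.
  set vv := 2 * d ^+ 2 - u in vu vu0 *.
  rewrite /heat gtr0_norm// [s2 * d * (_ * _)]mulrA.
  set q := s2 * d * _; set X := y ^+ 2; set x := - X / _.
  have X0 : 0 <= X by rewrite sqr_ge0.
  have sv0 : 0 < Num.sqrt vv by rewrite sqrtr_gt0.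
  have q0 : 0 < q by rewrite !mulr_gt0// invr_gt0.
  have q2 : q ^+ 2 = 2 * d ^+ 2 / vv.
    by rewrite /q !exprMn s2E exprVn sqr_sqrtr// ltW.
  (* In terms of p, which lies in [0, 1], q is sqrt(2 / (2 - p)), between 1 + p / 4 and sqrt(2). The
     exponential is bounded below by 1 - Y. *)
  pose p := u / d ^+ 2.
  have p0 : 0 <= p by rewrite divr_ge0// ltW.
  have p1 : p <= 1 by rewrite ler_pdivrMr// mul1r.
  have pE : u / (4 * d ^+ 2) = p / 4 by rewrite /p; field; rewrite gt_eqF.
  have vE : vv = d ^+ 2 * (2 - p) by rewrite /vv /p; field; rewrite gt_eqF.
  have q2p : q ^+ 2 * (2 - p) = 2.
    have h2p : 0 < 2 - p by lra.
    by rewrite q2 vE; field; rewrite !gt_eqF.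
  have h2p : 1 <= 2 - p by lra.
  have qlo : 1 + p / 4 <= q.
    rewrite -(@ler_pXn2r _ 2) ?nnegrE//; [|lra|exact: ltW].
    rewrite -(@ler_pM2r _ (2 - p)); last exact: lt_le_trans h2p.
    by rewrite q2p; nra.
  have qhi : q <= s2.
    rewrite -(@ler_pXn2r _ 2) ?nnegrE ?(ltW q0) ?(ltW s20)// s2E -q2p.
    by rewrite ler_peMr// sqr_ge0.
  have xlo : - (X / (2 * d ^+ 2)) <= x.
    rewrite /x mulNr lerN2 ler_wpM2l// lef_pV2 ?posrE ?mulr_gt0//; lra.
  set Y := X / (2 * d ^+ 2) in xlo.
  have Y0 : 0 <= Y by rewrite divr_ge0// mulr_ge0// ltW.
  have -> : s2 / (2 * d ^+ 2) * X = s2 * Y by rewrite /Y; field; rewrite gt_eqF.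
  have e1 : 1 - Y <= expR x by apply: le_trans (expR_ge1Dx x); lra.
  rewrite pE.
  have : q * (1 - Y) <= q * expR x by rewrite ler_pM2l.
  have : q * Y <= s2 * Y by rewrite ler_wpM2r.
  by nra.
have hE : s2 * d / 2 * (2 * heat (2 * d ^+ 2) 0) = 1.
  rewrite /heat expr0n/= oppr0 mul0r expR0 mulr1 gtr0_norm ?mulr_gt0//.
  rewrite sqrtrM// sqrtr_sqr gtr0_norm// -/s2.
  by field; rewrite !gt_eqF.
have tE : (\int[PB]_w (1 + tau d w / (4 * d ^+ 2))%:E =
    1 + ((4 * d ^+ 2)^-1)%:E * \int[PB]_w (tau d w)%:E)%E.
  under eq_integral do rewrite EFinD mulrC.
  rewrite ge0_integralD//; last 2 first.
  - by move=> w _; rewrite lee_fin mulr_ge0 ?brownian_exit_time_ge0// invr_ge0 mulr_ge0// ltW.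
  - by apply/measurable_EFinP; exact: measurable_funM.
  rewrite integral_cst//= probability_setT mule1; congr (_ + _)%E.
  under eq_integral do rewrite EFinM.
  rewrite ge0_integralZl_EFin//.
  - by move=> w _; rewrite lee_fin brownian_exit_time_ge0.
  - exact/measurable_EFinP.
  - by rewrite invr_ge0 mulr_ge0// ltW.
have c20 : 0 <= s2 / (2 * d ^+ 2) by rewrite divr_ge0 ?mulr_ge0// ltW.
have c30 : 0 <= s2 * d / 2 by rewrite divr_ge0 ?mulr_ge0// ltW.
have mpsi2 : measurable_fun setT (fun w => psi d (tau d w) ^+ 2) by exact: measurable_funX.
have fE : (\int[PB]_w ((s2 * d / 2)%:E * F w + (s2 / (2 * d ^+ 2) * psi d (tau d w) ^+ 2)%:E) =
    1 + (s2 / (2 * d ^+ 2))%:E * \int[PB]_w (psi d (tau d w) ^+ 2)%:E)%E.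
  rewrite ge0_integralD//; last 4 first.
  - by move=> w _; rewrite mule_ge0.
  - exact: measurable_funeM.
  - by move=> w _; rewrite lee_fin mulr_ge0// sqr_ge0.
  - by apply/measurable_EFinP; exact: measurable_funM.
  rewrite ge0_integralZl_EFin// EF -EFinM hE; congr (_ + _)%E.
  under eq_integral do rewrite EFinM.
  rewrite ge0_integralZl_EFin//.
  - by move=> w _; rewrite lee_fin sqr_ge0.
  - exact/measurable_EFinP.
have : (1 + ((4 * d ^+ 2)^-1)%:E * \int[PB]_w (tau d w)%:E <=
    1 + (s2 / (2 * d ^+ 2))%:E * \int[PB]_w (psi d (tau d w) ^+ 2)%:E)%E.
  rewrite -tE -fE.
  apply: ae_ge0_le_integral => //.
  - by move=> w _; rewrite lee_fin addr_ge0// divr_ge0 ?brownian_exit_time_ge0// mulr_ge0// ltW.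
  - by apply/measurable_EFinP; apply: measurable_funD => //; exact: measurable_funM.
  - by move=> w _; rewrite adde_ge0// ?mule_ge0// lee_fin mulr_ge0// sqr_ge0.
  - apply: emeasurable_funD; first exact: measurable_funeM.
    by apply/measurable_EFinP; exact: measurable_funM.
  - exists (~` good d); split; [exact/measurableC/good_measurable|exact: goodC|].
    by move=> w /= h gw; apply: h => _; exact: key.
have := integral_ge0 PB (D := setT) (f := fun w => (psi d (tau d w) ^+ 2)%:E)
  (fun w _ => sqr_ge0 (psi d (tau d w))).
have := integral_ge0 PB (D := setT) (f := fun w => (tau d w)%:E)
  (fun w _ => brownian_exit_time_ge0 d w).
case: (\int[PB]_w (tau d w)%:E)%E => [x| |]//; case: (\int[PB]_w (psi d (tau d w) ^+ 2)%:E)%E => [y| |]//.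
- move=> x0 y0; rewrite lee_fin in y0; rewrite -!EFinM -!EFinD !lee_fin lerD2l.
  rewrite -(@ler_pM2l _ (4 * d ^+ 2)) ?mulr_gt0// mulrA divff ?gt_eqF ?mulr_gt0// mul1r.
  move=> h; apply: (le_trans h).
  have -> : 4 * d ^+ 2 * (s2 / (2 * d ^+ 2) * y) = 2 * s2 * y by field; rewrite gt_eqF.
  by rewrite ler_wpM2r//; lra.
- by move=> _ _ _; rewrite mulry gtr0_sg// mul1e leey.
- by move=> _ _; rewrite mulry gtr0_sg ?invr_gt0 ?mulr_gt0// mul1e -EFinM -EFinD addey.
- by move=> _ _ _; rewrite mulry gtr0_sg// mul1e.
Qed.

Lemma exit_moments : exists2 c : R, 0 < c & forall d, 0 < d ->
  ((c * d ^+ 2)%:E <= \int[PB]_w (tau d w)%:E)%E /\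
  ((c * d ^+ 2)%:E <= \int[PB]_w (psi d (tau d w) ^+ 2)%:E)%E.
Proof.
pose z : R := expR (- ln 2 / 6).
have z1 : z < 1 by rewrite -expR0 ltr_expR mulNr oppr_lt0 divr_gt0// ln_gt0// ltr1n.
pose C : R := Num.sqrt (2 : R) / (1 - z).
have C0 : 0 <= C by rewrite divr_ge0 ?sqrtr_ge0// subr_ge0 ltW.
(* As exp(2 C) >= 1 + 2 C, the choice L / 6 = 2 C gives C exp(- L / 6) <= 1/2, the smallness
   required by [exit_mean_lower]. The sixth in the final constant is the half of that lemma times
   the third of [exit_sq_lower]. *)
pose L : R := 6 * (2 * C).
have L0 : 0 <= L by rewrite /L; lra.
exists (expR (- L) / 6); first by rewrite divr_gt0// expR_gt0.
move=> d d0.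
have r0 : 0 < d ^+ 2 * expR (- L) by rewrite mulr_gt0 ?expR_gt0// exprn_gt0.
have LS : Num.sqrt 2 * expR (- L / 6) / (1 - expR (- ln 2 / 6)) <= 2^-1.
  rewrite -/z mulrAC -/C /L (_ : - (6 * (2 * C)) / 6 = - (2 * C)); last by field.
  rewrite expRN ler_pdivrMr ?expR_gt0//.
  by have := @expR_ge1Dx R (2 * C); lra.
have h1 := exit_mean_lower d0 r0 L0 erefl LS.
have h2 := exit_sq_lower d0.
split.
  apply: le_trans h1; rewrite lee_fin; lra.
have : ((d ^+ 2 * expR (- L) / 2)%:E <= 3%:E * \int[PB]_w (psi d (tau d w) ^+ 2)%:E)%E.
  exact: le_trans h1 h2.
case: (\int[PB]_w _)%E => [x| |].
- rewrite -EFinM !lee_fin; lra.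
- by rewrite leey.
- by rewrite mulrNy gtr0_sg// mul1e leeNy_eq.
Qed.

End exit_time.

(** * One step of the walk *)

Section continuous_integral.
Context {R : realType}.
Local Notation mu := (@lebesgue_measure R).
Implicit Types (f g : R -> R) (u v t : R).

Let within_sub f u v : 0 <= u -> {within `[0, +oo[, continuous f} ->
  {within `[u, v], continuous f}.
Proof.
move=> u0; apply: continuous_subspaceW => t /=; rewrite !in_itv/= andbT.
by move=> /andP[/(le_trans u0)].
Qed.

Lemma continuous_integrable_itv f u v : 0 <= u -> {within `[0, +oo[, continuous f} ->
  mu.-integrable `[u, v] (EFin \o f).
Proof.
move=> u0 cf; apply: continuous_compact_integrable; first exact: segment_compact.
exact: within_sub.
Qed.

Lemma Rintegral_chasles f u v : 0 <= u -> u <= v ->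
  {within `[0, +oo[, continuous f} ->
  \int[mu]_(s in `[0, v]) f s - \int[mu]_(s in `[0, u]) f s =
  \int[mu]_(s in `[u, v]) f s.
Proof.
move=> u0 uv cf; rewrite Rintegral_itvB//; first last.
- exact: continuous_integrable_itv.
- rewrite Rintegral_itv_obnd_cbnd//.
  apply: integrableS (continuous_integrable_itv v u0 cf) => //.
  by apply: subset_itv => //; rewrite bnd_simp.
Qed.

Lemma Rintegral_le_itv f g u v : 0 <= u ->
  {within `[0, +oo[, continuous f} -> {within `[0, +oo[, continuous g} ->
  (forall s, u <= s <= v -> f s <= g s) ->
  \int[mu]_(s in `[u, v]) f s <= \int[mu]_(s in `[u, v]) g s.
Proof.
move=> u0 cf cg fg; apply: le_Rintegral => //; try exact: continuous_integrable_itv.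
Qed.

Lemma Rintegral_cst_itv (k : R) u v : u <= v -> \int[mu]_(s in `[u, v]) k = k * (v - u).
Proof.
move=> uv; rewrite Rintegral_cst//= lebesgue_measure_itv/= lte_fin.
case: ltP => // vu; rewrite (_ : v = u) ?subrr//.
by apply/eqP; rewrite eq_le uv vu.
Qed.

Lemma Rintegral_le_cst f (k : R) u v : 0 <= u -> u <= v ->
  {within `[0, +oo[, continuous f} ->
  (forall s, u <= s <= v -> f s <= k) ->
  \int[mu]_(s in `[u, v]) f s <= k * (v - u).
Proof.
move=> u0 uv cf fk; rewrite -Rintegral_cst_itv//; apply: Rintegral_le_itv => //.
by apply: continuous_subspaceT => s; exact: cvg_cst.
Qed.

Lemma Rintegral_ge_cst f (k : R) u v : 0 <= u -> u <= v ->
  {within `[0, +oo[, continuous f} ->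
  (forall s, u <= s <= v -> k <= f s) ->
  k * (v - u) <= \int[mu]_(s in `[u, v]) f s.
Proof.
move=> u0 uv cf fk; rewrite -Rintegral_cst_itv//; apply: Rintegral_le_itv => //.
by apply: continuous_subspaceT => s; exact: cvg_cst.
Qed.

Lemma derivable_Rintegral f t : 0 < t -> {within `[0, +oo[, continuous f} ->
  let F := fun x => \int[mu]_(s in `[0, x]) f s in
  derivable F t 1 /\ derive1 F t = f t.
Proof.
move=> t0 cf F.
apply: (@continuous_FTC1_closed _ f 0 t (t + 1)) => //.
- by rewrite ltrDl.
- exact: continuous_integrable_itv.
- have /continuous_within_itvcyP[H _] := cf.
  by apply: H; rewrite in_itv/= t0.
Qed.

Lemma continuous_Rintegral f : {within `[0, +oo[, continuous f} ->
  continuous (fun t => \int[mu]_(s in `[0, t]) f s).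
Proof.
move=> cf.
pose fc t := f (Num.max t 0).
have cfc : continuous fc := continuous_maxr0 cf.
(* With the constant extension to the left and base point -1, the point 0 becomes interior and the
   fundamental theorem gives continuity there too. *)
pose F x := \int[mu]_(s in `[-1, x]) fc s.
have ifc u v : mu.-integrable `[u, v] (EFin \o fc).
  apply: continuous_compact_integrable; first exact: segment_compact.
  exact: continuous_subspaceT.
have cF x : 0 <= x -> {for x, continuous F}.
  move=> x0; apply: differentiable_continuous; rewrite -derivable1_diffP.
  have [] // := @continuous_FTC1_closed _ fc (-1) x (x + 1) _ _ _ (cfc x).
  - by rewrite ltrDl.
  - by rewrite (lt_le_trans _ x0)// oppr_lt0.
have FE t : \int[mu]_(s in `[0, t]) f s = F (Num.max t 0) - F 0.
  have [t0|t0] := ltP t 0.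
    by rewrite subrr set_itv_ge ?Rintegral_set0// bnd_simp -ltNge.

  rewrite Rintegral_itvB//; last by rewrite bnd_simp.
  rewrite Rintegral_itv_obnd_cbnd; last first.
    apply: integrableS (ifc (-1) t) => //.
    by apply: subset_itv => //; rewrite bnd_simp.
  apply: eq_Rintegral => s; rewrite inE/= in_itv/= => /andP[s0 _].
  by rewrite /fc max_l.
rewrite (_ : (fun t => _) = (fun t => F (Num.max t 0) - F 0)); last exact/funext.
move=> t; apply: cvgB; last exact: cvg_cst.
apply: (@cvg_comp _ _ _ (fun s : R => Num.max s 0) F); last first.
  by apply: cF; rewrite le_max lexx orbT.
have : {for t, continuous ((id : R -> R^o) \max cst 0)}.
  by apply: continuous_max; [exact: cvg_id|exact: cvg_cst].
exact.
Qed.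

Lemma Rintegral_D_itv f g u v : 0 <= u ->
  {within `[0, +oo[, continuous f} -> {within `[0, +oo[, continuous g} ->
  \int[mu]_(s in `[u, v]) (f s + g s) =
  \int[mu]_(s in `[u, v]) f s + \int[mu]_(s in `[u, v]) g s.
Proof.
by move=> u0 cf cg; rewrite RintegralD//; exact: continuous_integrable_itv.
Qed.

Lemma Rintegral_Zl_itv (k : R) f u v : 0 <= u -> {within `[0, +oo[, continuous f} ->
  \int[mu]_(s in `[u, v]) (k * f s) = k * \int[mu]_(s in `[u, v]) f s.
Proof.
by move=> u0 cf; rewrite RintegralZl//; exact: continuous_integrable_itv.
Qed.

Lemma Rintegral_norm_itv f u v : 0 <= u -> {within `[0, +oo[, continuous f} ->
  `|\int[mu]_(s in `[u, v]) f s| <= \int[mu]_(s in `[u, v]) `|f s|.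
Proof.
by move=> u0 cf; apply: le_normr_Rintegral => //; exact: continuous_integrable_itv.
Qed.

Lemma Rintegral_FTC2 (F f : R -> R) u v : 0 <= u -> u <= v ->
  {within `[0, +oo[, continuous f} -> continuous F ->
  (forall t, 0 < t -> derivable F t 1 /\ derive1 F t = f t) ->
  \int[mu]_(s in `[u, v]) f s = F v - F u.
Proof.
move=> u0; rewrite le_eqVlt => /predU1P[<-|uv] cf cF dF.
  by rewrite set_itv1 Rintegral_set1 subrr.
rewrite /Rintegral (continuous_FTC2 uv (F := F))//.
- exact: within_sub.
- split.
  + by move=> t; rewrite in_itv/= => /andP[/(le_lt_trans u0)/dF[]].
  + by apply: cvg_at_right_filter; exact: cF.
  + by apply: cvg_at_left_filter; exact: cF.
- by move=> t; rewrite in_itv/= => /andP[/(le_lt_trans u0)/dF[]].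
Qed.

(* Weighted AM-GM under the integral, optimised over the weight. *)
Lemma Rintegral_cauchy_schwarz f g u v : 0 <= u -> u <= v ->
  {within `[0, +oo[, continuous f} -> {within `[0, +oo[, continuous g} ->
  (\int[mu]_(s in `[u, v]) `|f s * g s|) ^+ 2 <=
  \int[mu]_(s in `[u, v]) (f s ^+ 2) * \int[mu]_(s in `[u, v]) (g s ^+ 2).
Proof.
move=> u0 uv cf cg.
set J := \int[mu]_(s in `[u, v]) (f s ^+ 2); set T := \int[mu]_(s in _) (g s ^+ 2).
set I := \int[mu]_(s in _) _.
have cf2 : {within `[0, +oo[, continuous (fun s => f s ^+ 2)}.
  by move=> s; apply: cvgM; exact: cf.
have cg2 : {within `[0, +oo[, continuous (fun s => g s ^+ 2)}.
  by move=> s; apply: cvgM; exact: cg.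
have cfg : {within `[0, +oo[, continuous (fun s => `|f s * g s|)}.
  by move=> s; apply: cvg_norm; apply: cvgM; [exact: cf|exact: cg].
have J0 : 0 <= J by apply: Rintegral_ge0 => s _; exact: sqr_ge0.
have T0 : 0 <= T by apply: Rintegral_ge0 => s _; exact: sqr_ge0.
have I0 : 0 <= I by apply: Rintegral_ge0 => s _; exact: normr_ge0.
have key (k : R) : 2 * k * I <= k ^+ 2 * J + T.
  rewrite /J /T /I -!Rintegral_Zl_itv// -Rintegral_D_itv//; last first.
    by move=> s; apply: cvgM; [exact: cvg_cst|exact: cf2].
  apply: Rintegral_le_itv => //.
  - by move=> s; apply: cvgM; [exact: cvg_cst|exact: cfg].
  - by move=> s; apply: cvgD; [apply: cvgM; [exact: cvg_cst|exact: cf2]|exact: cg2].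
  move=> s _; rewrite normrM -(real_normK (num_real (f s))) -(real_normK (num_real (g s))).
  by have := sqr_ge0 (k * `|f s| - `|g s|); nra.
have [J1|J1] := eqVneq J 0.
  (* Degenerate case: if [I] were nonzero, [key] at this weight would read 2 (T + 1) <= T. *)
  have := key ((T + 1) / I); rewrite J1 mulr0 add0r mul0r.
  have [->|I1] := eqVneq I 0; first by rewrite expr0n.
  have -> : 2 * ((T + 1) / I) * I = 2 * (T + 1) by field.
  by lra.
have J2 : 0 < J by rewrite lt_def J1.
have := key (I / J).
have -> : 2 * (I / J) * I = 2 * (I ^+ 2 / J) by field.
have -> : (I / J) ^+ 2 * J = I ^+ 2 / J by field.
move=> h; have {h} : I ^+ 2 / J <= T by lra.
by rewrite ler_pdivrMr// mulrC.
Qed.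

End continuous_integral.

(** Bounds the ratio of the values of e^theta within [u, v], in either direction. *)
Definition growth (R : realType) (alpha : R -> R) (u v : R) : R :=
  expR (\int[@lebesgue_measure R]_(s in `[u, v]) `|alpha s|).

(** In the coordinate z = e^theta (x - c) a fixed point x moves as time passes; this is minus its
    displacement from [u] to [v]. *)
Definition drift_term (R : realType) (alpha beta : R -> R) (x u v : R) : R :=
  \int[@lebesgue_measure R]_(s in `[u, v]) ((beta s + x * alpha s) * expR (theta alpha s)).

Definition drift_energy (R : realType) (alpha beta sigma : R -> R) (x u v : R) : R :=
  \int[@lebesgue_measure R]_(s in `[u, v]) (`|beta s + x * alpha s| ^+ 2 / sigma s ^+ 2).

Section dynamics.
Context {R : realType}.
Variables alpha beta sigma : R -> R.
Hypotheses (calpha : {within `[0, +oo[, continuous alpha})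
  (cbeta : {within `[0, +oo[, continuous beta})
  (csigma : {within `[0, +oo[, continuous sigma}).
Local Notation mu := (@lebesgue_measure R).
Local Notation th := (theta alpha).
Local Notation rh := (rho alpha sigma).
Local Notation cd := (cdrift alpha beta).
Implicit Types s t u v x y : R.

Lemma continuous_theta : continuous th.
Proof. by move=> t; apply: cvgN; exact: continuous_Rintegral. Qed.

Let cexpth : continuous (fun s => expR (th s)).
Proof. by move=> t; apply: continuous_cvg; [exact: continuous_expR|exact: continuous_theta]. Qed.

Let wM (f g : R -> R) : {within `[0, +oo[, continuous f} ->
  {within `[0, +oo[, continuous g} -> {within `[0, +oo[, continuous (fun s => f s * g s)}.
Proof. by move=> cf cg s; apply: cvgM; [exact: cf|exact: cg]. Qed.

Let wD (f g : R -> R) : {within `[0, +oo[, continuous f} ->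
  {within `[0, +oo[, continuous g} -> {within `[0, +oo[, continuous (fun s => f s + g s)}.
Proof. by move=> cf cg s; apply: cvgD; [exact: cf|exact: cg]. Qed.

Let wC (k : R) : {within `[0, +oo[, continuous (fun _ : R => k)}.
Proof. by apply: continuous_subspaceT => s; exact: cvg_cst. Qed.

Let wexp : {within `[0, +oo[, continuous (fun s => expR (th s))}.
Proof. exact: continuous_subspaceT. Qed.

Let wnorm (f : R -> R) : {within `[0, +oo[, continuous f} ->
  {within `[0, +oo[, continuous (fun s => `|f s|)}.
Proof. by move=> cf s; apply: cvg_norm; exact: cf. Qed.

Let speed s := sigma s ^+ 2 * expR (2 * th s).

Let speedE s : speed s = (sigma s * expR (th s)) ^+ 2.
Proof. by rewrite /speed exprMn -expRM_natl. Qed.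

Let wspeed : {within `[0, +oo[, continuous speed}.
Proof.
rewrite (_ : speed = fun s => (sigma s * expR (th s)) * (sigma s * expR (th s))).
  by apply: wM; exact: wM.
by apply/funext => s; rewrite speedE expr2.
Qed.

Lemma continuous_rho : continuous rh.
Proof. exact: continuous_Rintegral. Qed.

Lemma rho_diff u v : 0 <= u -> u <= v -> rh v - rh u = \int[mu]_(s in `[u, v]) speed s.
Proof. by move=> u0 uv; exact: Rintegral_chasles. Qed.

Lemma theta_diff u v : 0 <= u -> u <= v -> th u - th v = \int[mu]_(s in `[u, v]) alpha s.
Proof.
by move=> u0 uv; rewrite -Rintegral_chasles// /theta opprK addrC.
Qed.

Let Al u v := \int[mu]_(s in `[u, v]) `|alpha s|.
Local Notation Ex := (growth alpha).

Let Al_ge0 u v : 0 <= Al u v.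
Proof. exact: Rintegral_ge0. Qed.

Lemma growth_gt0 u v : 0 < Ex u v.
Proof. exact: expR_gt0. Qed.

Let Al_mono u s v : 0 <= u -> u <= s -> s <= v -> Al u s <= Al u v.
Proof.
move=> u0 us sv; have s0 := le_trans u0 us; have uv := le_trans us sv.
have a1 := Rintegral_chasles u0 us (wnorm calpha).
have a2 := Rintegral_chasles u0 uv (wnorm calpha).
have a3 := Rintegral_chasles s0 sv (wnorm calpha).
by have := Al_ge0 s v; rewrite /Al -a1 -a2 -a3 subr_ge0 => h; rewrite lerD2r.
Qed.

Lemma growth_mono u s v : 0 <= u -> u <= s -> s <= v -> Ex u s <= Ex u v.
Proof. by move=> u0 us sv; rewrite ler_expR; exact: Al_mono. Qed.

Lemma theta_osc u s v : 0 <= u -> u <= s -> s <= v -> `|th s - th u| <= Al u v.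
Proof.
move=> u0 us sv; rewrite distrC theta_diff//.
apply: le_trans (Al_mono u0 us sv); exact: Rintegral_norm_itv.
Qed.

Let exp_le u s v : 0 <= u -> u <= s -> s <= v -> expR (th s) <= Ex u v * expR (th u).
Proof.
move=> u0 us sv; rewrite -[growth _ _ _]/(expR (Al u v)) -expRD ler_expR.
by have := theta_osc u0 us sv; rewrite ler_norml => /andP[]; lra.
Qed.

Let exp_ge u s v : 0 <= u -> u <= s -> s <= v -> expR (th u) <= Ex u v * expR (th s).
Proof.
move=> u0 us sv; rewrite -[growth _ _ _]/(expR (Al u v)) -expRD ler_expR.
by have := theta_osc u0 us sv; rewrite ler_norml => /andP[]; lra.
Qed.

Let expN_le u s v : 0 <= u -> u <= s -> s <= v -> expR (- th s) <= Ex u v * expR (- th u).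
Proof.
move=> u0 us sv; rewrite -[growth _ _ _]/(expR (Al u v)) -expRD ler_expR.
by have := theta_osc u0 us sv; rewrite ler_norml => /andP[]; lra.
Qed.

Variable s0 : R.
Hypotheses (s00 : 0 < s0) (hs : forall t, 0 <= t -> s0 <= sigma t).

Lemma rho_lower u v : 0 <= u -> u <= v ->
  s0 ^+ 2 / Ex u v ^+ 2 * expR (th u) ^+ 2 * (v - u) <= rh v - rh u.
Proof.
move=> u0 uv; rewrite rho_diff//; apply: Rintegral_ge_cst => // s /andP[us sv].
rewrite speedE mulrAC -exprMn -expr_div_n.
have := hs (le_trans u0 us) => h.
have sg0 := lt_le_trans s00 h.
apply: lerXn2r; rewrite ?nnegrE.
- by rewrite divr_ge0 ?mulr_ge0 ?expR_ge0 ?(ltW s00) ?(ltW (growth_gt0 _ _)).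
- by rewrite mulr_ge0 ?expR_ge0 ?(ltW sg0).
rewrite ler_pdivrMr ?growth_gt0//; have := exp_ge u0 us sv => h2.
rewrite -mulrA; apply: ler_pM => //; rewrite ?expR_ge0//; first exact: ltW.
by rewrite mulrC.
Qed.

Lemma rho_upper (M : R) u v : 0 <= u -> u <= v ->
  (forall s, u <= s <= v -> sigma s <= M) ->
  rh v - rh u <= M ^+ 2 * Ex u v ^+ 2 * expR (th u) ^+ 2 * (v - u).
Proof.
move=> u0 uv hM; rewrite rho_diff//; apply: Rintegral_le_cst => // s /andP[us sv].
rewrite speedE -!exprMn.
have h := hs (le_trans u0 us); have sg0 := lt_le_trans s00 h.
have sM : sigma s <= M by apply: hM; rewrite us.
have M0 := lt_le_trans sg0 sM.
apply: lerXn2r; rewrite ?nnegrE.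
- by rewrite mulr_ge0 ?expR_ge0 ?(ltW sg0).
- by rewrite !mulr_ge0 ?expR_ge0 ?(ltW M0) ?(ltW (growth_gt0 _ _)).
rewrite -mulrA; apply: ler_pM; rewrite ?expR_ge0 ?(ltW sg0)//.
exact: exp_le.
Qed.

Lemma rho_lt u v : 0 <= u -> u < v -> rh u < rh v.
Proof.
move=> u0 uv; rewrite -subr_gt0; apply: lt_le_trans (rho_lower u0 (ltW uv)).
by rewrite !mulr_gt0 ?invr_gt0 ?exprn_gt0 ?expR_gt0 ?growth_gt0// subr_gt0.
Qed.

Lemma rho_le u v : 0 <= u -> u <= v -> rh u <= rh v.
Proof. by move=> u0; rewrite le_eqVlt => /predU1P[->//|/(rho_lt u0)/ltW]. Qed.

Lemma rho_lt_inv u v : 0 <= v -> rh u < rh v -> u < v.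
Proof. by move=> v0 h; rewrite ltNge; apply/negP => /(rho_le v0); rewrite leNgt h. Qed.

Let rho_inj : {in `[0, +oo[%classic &, injective rh}.
Proof.
move=> u v; rewrite !inE/= !in_itv/= !andbT => u0 v0 e.
by case: (ltgtP u v) => // [/(rho_lt u0)|/(rho_lt v0)]; rewrite e ltxx.
Qed.

(** The partial inverse returns a point of [0, +oo[ or, off the range of [rho], the default value
    0. *)
Lemma rho_inv_ge0 y : 0 <= rho_inv alpha sigma y.
Proof.
rewrite /rho_inv /pinv_ splitV oinv_surj; case: pselect => //= h.
by case: cid2 => z /=; rewrite in_itv/= andbT.
Qed.

Lemma rho_invP u v y : 0 <= u -> u <= v -> rh u <= y <= rh v ->
  exists s, [/\ u <= s, s <= v, rh s = y & rho_inv alpha sigma y = s].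
Proof.
move=> u0 uv yuv.
have [s] : exists2 s, s \in `[u, v] & rh s = y.
  apply: IVT => //; first exact/continuous_subspaceT/continuous_rho.
  by rewrite min_l ?max_r// rho_le.
rewrite in_itv/= => /andP[us sv] rs; exists s; split => //.
by rewrite -rs /rho_inv pinvKV// inE/= in_itv/= (le_trans u0).
Qed.

Local Notation Gd := (drift_term alpha beta).

Let wbx x : {within `[0, +oo[, continuous (fun s => beta s + x * alpha s)}.
Proof. by apply: wD => //; apply: wM => //; exact: wC. Qed.

(** The derivatives of e^theta and e^theta c are - alpha e^theta and beta e^theta. The displacement
    thus splits into the Brownian part [y] and the drift of the moving frame. *)
Lemma flowE x u v y : 0 <= u -> u <= v ->
  expR (- th v) * (y + expR (th u) * (x - cd u)) + cd v - x =
  expR (- th v) * (y + Gd x u v).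
Proof.
move=> u0 uv.
have e1 : expR (th v) - expR (th u) = \int[mu]_(s in `[u, v]) (- alpha s * expR (th s)).
  apply/esym; apply: (Rintegral_FTC2 u0 uv (F := fun s => expR (th s))) => //.
    by apply: wM => //; move=> s; apply: cvgN; exact: calpha.
  move=> t t0; have [dA A'] := derivable_Rintegral t0 calpha.
  have H : is_derive t 1 th (- alpha t).
    apply: is_deriveN; rewrite -A' derive1E; exact: derivableP.
  have H2 : is_derive t 1 (fun s => expR (th s)) (- alpha t * expR (th t)).
    have := @is_derive1_comp _ expR th t _ _ (is_derive_expR (th t)) H.
    by rewrite mulrC.
  by split; [exact: ex_derive|rewrite derive1E; exact: derive_val].
have e2 : expR (th v) * cd v - expR (th u) * cd u =
    \int[mu]_(s in `[u, v]) (beta s * expR (th s)).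
  have cdE t : expR (th t) * cd t = \int[mu]_(s in `[0, t]) (beta s * expR (th s)).
    by rewrite /cdrift mulrA -expRD subrr expR0 mul1r.
  apply: (etrans (f_equal2 (fun p r => p - r) (cdE v) (cdE u))).
  exact: (@Rintegral_chasles _ (fun s => beta s * expR (th s)) u v u0 uv (wM cbeta wexp)).
have GE : Gd x u v = \int[mu]_(s in `[u, v]) (beta s * expR (th s)) -
    x * \int[mu]_(s in `[u, v]) (- alpha s * expR (th s)).
  rewrite /Gd -mulNr -Rintegral_Zl_itv//; last first.
    by apply: wM => //; move=> s; apply: cvgN; exact: calpha.
  rewrite -Rintegral_D_itv//; last 2 first.
  - exact: wM.
  - by apply: wM; [exact: wC|apply: wM => //; move=> s; apply: cvgN; exact: calpha].
  by apply: eq_Rintegral => s _; ring.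
rewrite GE -e1 -e2.
have E : expR (- th v) * expR (th v) = 1 by rewrite -expRD addNr expR0.
set A := expR (- th v) in E *; set B := expR (th v) in E *; set C := expR (th u).
rewrite -[in LHS](mul1r (cd v)) -[X in _ - X](mul1r x) -E; ring.
Qed.

Local Notation Jd := (drift_energy alpha beta sigma).

Lemma drift_energy_ge0 x u v : 0 <= Jd x u v.
Proof.
rewrite /drift_energy; apply: Rintegral_ge0 => r _.
by apply: divr_ge0; exact: sqr_ge0.
Qed.

Let wV : {within `[0, +oo[, continuous (fun s => (sigma s)^-1)}.
Proof.
apply/subspace_continuousP => t t0; apply: cvgV.
  by rewrite gt_eqF// (lt_le_trans s00)// hs//; move: t0; rewrite /= in_itv/= andbT.
by move/subspace_continuousP : csigma; exact.
Qed.

Lemma drift_energy_cont x :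
  {within `[0, +oo[, continuous (fun s => `|beta s + x * alpha s| ^+ 2 / sigma s ^+ 2)}.
Proof.
rewrite (_ : (fun s => _) = (fun s => (`|beta s + x * alpha s| * `|beta s + x * alpha s|) *
  ((sigma s)^-1 * (sigma s)^-1))).
  by apply: wM; apply: wM => //; exact: wnorm.
by apply/funext => s; rewrite -invfM -!expr2.
Qed.

(** The integrand is the product of (beta + x alpha) / sigma and sigma e^theta, and the square of
    the second factor is the density of [rho]. This explains the energy term in [Delta]. *)
Lemma drift_cauchy_schwarz x u s v : 0 <= u -> u <= s -> s <= v ->
  `|Gd x u s| <= Num.sqrt (Jd x u v) * Num.sqrt (rh s - rh u).
Proof.
move=> u0 us sv; have uv := le_trans us sv; have s00' := le_trans u0 us.
pose f r := (beta r + x * alpha r) / sigma r; pose g r := sigma r * expR (th r).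
have cf : {within `[0, +oo[, continuous f} by exact: wM.
have cg : {within `[0, +oo[, continuous g} by exact: wM.
have := Rintegral_cauchy_schwarz u0 us cf cg.
have -> : \int[mu]_(r in `[u, s]) g r ^+ 2 = rh s - rh u.
  by rewrite rho_diff//; apply: eq_Rintegral => r _; rewrite speedE.
have Js : \int[mu]_(r in `[u, s]) f r ^+ 2 <= Jd x u v.
  have -> : \int[mu]_(r in `[u, s]) f r ^+ 2 = Jd x u s.
    by rewrite /drift_energy; apply: eq_Rintegral => r _; rewrite /f expr_div_n real_normK// num_real.
  have a1 := Rintegral_chasles u0 us (@drift_energy_cont x).
  have a2 := Rintegral_chasles u0 uv (@drift_energy_cont x).
  have a3 := Rintegral_chasles s00' sv (@drift_energy_cont x).
  have := drift_energy_ge0 x s v.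
  rewrite /drift_energy -a1 -a2 -a3.
  by rewrite subr_ge0 => h; rewrite lerD2r.
have Gfg : `|Gd x u s| <= \int[mu]_(r in `[u, s]) `|f r * g r|.
  apply: (le_trans (Rintegral_norm_itv s u0 _)); first exact: wM.
  rewrite le_eqVlt; apply/orP; left; apply/eqP; apply: eq_Rintegral => r.
  rewrite inE/= in_itv/= => /andP[ur _]; rewrite /f /g; congr `|_|.
  by field; rewrite gt_eqF// (lt_le_trans s00)// hs// (le_trans u0).
have r0 : 0 <= rh s - rh u by rewrite subr_ge0 rho_le.
have J0 := drift_energy_ge0 x u v.
move=> h; rewrite -sqrtrM// -(@ler_pXn2r _ 2) ?nnegrE ?sqrtr_ge0//.
rewrite sqr_sqrtr ?mulr_ge0//; apply: le_trans (_ : _ <= Jd x u v * (rh s - rh u)) => //.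
apply: (@le_trans _ _ ((\int[mu]_(r in `[u, s]) `|f r * g r|) ^+ 2)).
  by rewrite ler_pXn2r ?nnegrE// (le_trans _ Gfg).
by apply: (le_trans h); rewrite ler_wpM2r.
Qed.

(** Linear in the intrinsic time, where Cauchy-Schwarz gives a square root: the Lyapunov estimate
    needs the drift of a step to be of the order of [tau]. The integrand is compared pointwise with
    the density of [rho]. *)
Lemma drift_linear x (M : R) u s v : 0 <= u -> u <= s -> s <= v ->
  (forall r, u <= r <= v -> `|beta r + x * alpha r| <= M) ->
  `|Gd x u s| <= M * Ex u v / s0 ^+ 2 * expR (- th u) * (rh s - rh u).
Proof.
move=> u0 us sv hM; rewrite rho_diff//.
apply: (le_trans (Rintegral_norm_itv s u0 _)); first exact: wM.
rewrite -Rintegral_Zl_itv//; apply: Rintegral_le_itv => //.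
- by apply: wnorm; exact: wM.
- by apply: wM => //; exact: wC.
move=> r /andP[ur rs]; rewrite normrM (gtr0_norm (expR_gt0 _)) speedE.
have rv := le_trans rs sv.
have M1 : `|beta r + x * alpha r| <= M by apply: hM; rewrite ur rv.
have M0 : 0 <= M := le_trans (normr_ge0 _) M1.
have sr : s0 <= sigma r by apply: hs; exact: le_trans ur.
have := expN_le u0 ur rv; set A := expR (- th u) => h.
have E : expR (- th r) * expR (th r) = 1 by rewrite -expRD addNr expR0.
apply: (@le_trans _ _ (M * expR (th r))); first by rewrite ler_wpM2r// expR_ge0.
have -> : M * Ex u v / s0 ^+ 2 * A * (sigma r * expR (th r)) ^+ 2 =
  M * expR (th r) * ((Ex u v * A) * expR (th r) * (sigma r / s0) ^+ 2).
  by field; rewrite gt_eqF.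
rewrite ler_peMr ?mulr_ge0 ?expR_ge0// -[leLHS]mulr1; apply: ler_pM => //.
  by rewrite -E ler_wpM2r// expR_ge0.
by rewrite exprn_ege1// ler_pdivlMr// mul1r.
Qed.

End dynamics.

(** * Global bounds on the coefficients from their asymptotics *)

Section coefficient_growth.
Context {R : realType}.
Implicit Types (f : R -> R) (t : R).

Lemma near_pinfty_bound f (P : R -> Prop) : {within `[0, +oo[, continuous f} ->
  (\forall t \near +oo_R, P t) ->
  exists M K : R, [/\ 1 <= M, 0 <= K, forall t, M < t -> P t &
    forall t, 0 <= t <= M -> `|f t| <= K].
Proof.
move=> cf [M0 [_ HM]]; pose M := Num.max M0 1.
have M_ge1 : 1 <= M by rewrite /M le_max lexx orbT.
have M_ge0 : 0 <= M by exact: le_trans M_ge1.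
have [c _ Hc] : exists2 c, c \in `[0, M]%R & forall t, t \in `[0, M]%R -> `|f t| <= `|f c|.
  apply: (@EVT_max _ (fun t => `|f t|)) => // s.
  apply: cvg_norm; apply: (continuous_subspaceW _ cf) => r /=.
  by rewrite !in_itv/= andbT => /andP[].
exists M, `|f c|; split => // t; first by move=> Mt; apply: HM; rewrite (le_lt_trans _ Mt)// /M le_max lexx.
Qed.

Lemma sublinear_growth f (C q : R) : {within `[0, +oo[, continuous f} ->
  0 <= q <= 1 -> 0 < C -> (\forall t \near +oo_R, `|f t| <= C * t `^ (q / 4)) ->
  exists2 K : R, 0 < K & forall t, 0 <= t -> `|f t| <= K * (1 + t).
Proof.
move=> cf /andP[q0 q1] C0 /(near_pinfty_bound cf)[M [K [M0 K0 H1 H2]]].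
exists (C + K); first by rewrite ltr_pwDl.
move=> t t0; have [tM|Mt] := leP t M.
  apply: (le_trans (H2 _ _)); first by rewrite t0.
  have := mulr_ge0 K0 t0; have := mulr_ge0 (ltW C0) t0; lra.
apply: (le_trans (H1 _ Mt)).
have h : t `^ (q / 4) <= 1 + t.
  have t1 : 1 <= 1 + t by rewrite lerDl.
  apply: (@le_trans _ _ ((1 + t) `^ (q / 4))).
    apply: ge0_ler_powR; rewrite ?nnegrE//; lra.
  rewrite -[leRHS]powRr1; last lra.
  by apply: ler_powR => //; lra.
have : C * t `^ (q / 4) <= C * (1 + t) by rewrite ler_wpM2l// ltW.
have := mulr_ge0 K0 t0; lra.
Qed.

(** [Y] solves |K| y^q = eta y: up to [Y] the left side is at most its value at [Y], beyond it the
    linear term dominates. *)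
Lemma powR_absorb (K q eta : R) : 0 <= q < 1 -> 0 < eta ->
  exists2 C : R, 0 <= C & forall y, 0 <= y -> K * y `^ q <= C + eta * y.
Proof.
move=> /andP[q0 q1] eta0; pose Y := (`|K| / eta) `^ (1 - q)^-1.
exists (`|K| * Y `^ q); first by rewrite mulr_ge0// powR_ge0.
move=> y y0.
have KK : K * y `^ q <= `|K| * y `^ q by rewrite ler_wpM2r ?powR_ge0 ?ler_norm.
apply: (le_trans KK); have [yY|Yy] := leP y Y.
  rewrite -[leLHS]addr0; apply: lerD; last by rewrite mulr_ge0// ltW.
  by rewrite ler_wpM2l//; apply: ge0_ler_powR; rewrite ?nnegrE// powR_ge0.
have Y0 : 0 <= Y by exact: powR_ge0.
have yp : 0 < y := le_lt_trans Y0 Yy.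
rewrite -[leLHS]add0r; apply: lerD; first by rewrite mulr_ge0// powR_ge0.
have E : y = y `^ q * y `^ (1 - q).
  rewrite -powRD ?gt_eqF ?implybT// (_ : q + (1 - q) = 1) ?powRr1 ?(ltW yp)//; lra.
rewrite [leRHS](_ : _ = eta * y `^ (1 - q) * y `^ q); last by rewrite {1}E; ring.
rewrite ler_wpM2r ?powR_ge0//.
have h : `|K| / eta <= y `^ (1 - q).
  have -> : `|K| / eta = Y `^ (1 - q).
    rewrite /Y -powRrM mulVf ?powRr1 ?divr_ge0 ?(ltW eta0)//.
    by rewrite gt_eqF// subr_gt0.
  by apply: ge0_ler_powR; rewrite ?nnegrE ?(ltW Yy)//; lra.
by rewrite mulrC -ler_pdivrMr.
Qed.

(** An exponent below 1 makes the multiple of the logarithm as small as desired. Three values of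
    [eta] are used: 1 for linear growth, 1 / m for the growth factor over a window, and one tuned to
    the survival probability of a block. *)
Lemma sublog_growth f (q : R) : {within `[0, +oo[, continuous f} ->
  0 <= q < 1 -> (exists K, \forall t \near +oo_R, `|f t| <= K * ln t `^ q) ->
  forall eta, 0 < eta ->
  exists2 K : R, 0 < K & forall t, 0 <= t -> `|f t| <= K + eta * ln (1 + t).
Proof.
move=> cf hq [K0 /(near_pinfty_bound cf)[M [K [M0 Kge0 H1 H2]]]] eta eta0.
have [C C0 HC] := powR_absorb K0 hq eta0.
exists (C + K + 1); first lra.
move=> t t0.
have l0 : 0 <= ln (1 + t) by rewrite ln_ge0// lerDl.
have el0 : 0 <= eta * ln (1 + t) by rewrite mulr_ge0// ltW.
have [tM|Mt] := leP t M.
  by apply: (le_trans (H2 _ _)); [rewrite t0|lra].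
apply: (le_trans (H1 _ Mt)).
have tp : 0 < t by lra.
have lt : ln t <= ln (1 + t) by rewrite ler_ln ?posrE; lra.
have lt0 : 0 <= ln t by rewrite ln_ge0// (le_trans M0)// ltW.
have := HC _ lt0; have : eta * ln t <= eta * ln (1 + t) by rewrite ler_wpM2l// ltW.
lra.
Qed.

Lemma lower_bound f (c : R) : {within `[0, +oo[, continuous f} ->
  (forall t, 0 <= t -> 0 < f t) -> 0 < c -> (\forall t \near +oo_R, c <= f t) ->
  exists2 s0 : R, 0 < s0 & forall t, 0 <= t -> s0 <= f t.
Proof.
move=> cf f0 c0 H.
have cV : {within `[0, +oo[, continuous (fun t => (f t)^-1)}.
  apply/subspace_continuousP => t; rewrite /= in_itv/= andbT => t0; apply: cvgV.
    by rewrite gt_eqF// f0.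
  by move/subspace_continuousP : cf; apply; rewrite /= in_itv/= andbT.
have [M [K [M0 K0 H1 H2]]] := near_pinfty_bound cV H.
exists (Num.min c (K + 1)^-1).
  by rewrite lt_min c0 invr_gt0; lra.
move=> t t0; rewrite ge_min; have [tM|Mt] := leP t M; last by rewrite H1.
apply/orP; right; have ft := f0 _ t0.
have h : (f t)^-1 <= K.
  by have := H2 t; rewrite t0 tM ger0_norm ?invr_ge0 ?(ltW ft)//; exact.
rewrite -[leRHS]invrK lef_pV2 ?posrE ?invr_gt0//; lra.
Qed.

End coefficient_growth.

(** * Size of the spheroid and confinement of a step *)

Section spheroid_step.
Context {R : realType}.
Variables alpha beta sigma : R -> R.
Hypotheses (calpha : {within `[0, +oo[, continuous alpha})
  (cbeta : {within `[0, +oo[, continuous beta})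
  (csigma : {within `[0, +oo[, continuous sigma}).
Variables (a b m gamma s0 : R).
Hypotheses (hm : 0 < m) (hgamma : 0 < gamma < 1).
Hypotheses (s00 : 0 < s0) (hs : forall t, 0 <= t -> s0 <= sigma t).
Local Notation th := (theta alpha).
Local Notation rh := (rho alpha sigma).
Local Notation cd := (cdrift alpha beta).
Local Notation size := (spheroid_size alpha beta sigma a b m gamma).
Local Notation Dl := (Delta alpha beta sigma m).
Local Notation Jd := (drift_energy alpha beta sigma).
Implicit Types s t u v x y : R.

Definition wall_dist x := Num.min (b - x) (x - a).

Lemma wall_dist_gt0 x : a < x < b -> 0 < wall_dist x.
Proof. by move=> /andP[ax xb]; rewrite lt_min !subr_gt0 ax xb. Qed.

Let e1_gt0 : 0 < (Num.sqrt (expR 1))^-1 :> R.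
Proof. by rewrite invr_gt0 sqrtr_gt0 expR_gt0. Qed.

Lemma DeltaE t x : Dl t x = expR (- th t) * growth alpha t (t + m) *
  ((Num.sqrt (expR 1))^-1 + Num.sqrt (Jd x t (t + m))).
Proof. by []. Qed.

Lemma Delta_gt0 t x : 0 < Dl t x.
Proof.
by rewrite DeltaE !mulr_gt0 ?expR_gt0 ?growth_gt0// ltr_pwDl// sqrtr_ge0.
Qed.

(** The [kappa] factors and the two cases unwind to a minimum with two roles: the first term keeps
    the step within the fraction 1 - gamma of the distance to the boundary, the second keeps its
    duration below [m]. *)
Lemma spheroid_sizeE t x : a < x < b ->
  size t x = Num.min ((1 - gamma) * wall_dist x / Dl t x) (Num.sqrt (rh (t + m) - rh t)).
Proof.
move=> /andP[ax xb]; have D0 := Delta_gt0 t x.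
move: hgamma => /andP[g0 g1].
have key y : 0 < y -> Num.min 1 (Dl t x * Num.sqrt (rh (t + m) - rh t) / ((1 - gamma) * y)) / Dl t x * ((1 - gamma) * y)
   = Num.min ((1 - gamma) * y / Dl t x) (Num.sqrt (rh (t + m) - rh t)).
  move=> y0; have y1 : 0 < (1 - gamma) * y by rewrite mulr_gt0// subr_gt0.
  rewrite -mulrA minr_pMl ?mulr_ge0 ?invr_ge0 ?subr_ge0 ?(ltW D0) ?(ltW y0) ?(ltW g1)//.
  congr Num.min; first by rewrite mul1r mulrC.
  by field; rewrite !gt_eqF//= subr_gt0.
rewrite /spheroid_size /kappa_plus /kappa_minus /wall_dist.
have -> : b_gamma b gamma x - x = (1 - gamma) * (b - x) by rewrite /b_gamma; ring.
have -> : x - a_gamma a gamma x = (1 - gamma) * (x - a) by rewrite /a_gamma; ring.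
case: (leP (b - x) (x - a)) => h; rewrite key ?subr_gt0//.
Qed.

Lemma spheroid_size_gt0 t x : 0 <= t -> a < x < b -> 0 < size t x.
Proof.
move=> t0 axb; rewrite spheroid_sizeE// lt_min; move: hgamma => /andP[g0 g1].
rewrite divr_gt0 ?Delta_gt0 ?mulr_gt0 ?wall_dist_gt0 ?subr_gt0//= sqrtr_gt0 subr_gt0.
by apply: (rho_lt calpha csigma s00 hs) => //; rewrite ltrDl.
Qed.

Lemma spheroid_size_sq t x : 0 <= t -> a < x < b -> size t x ^+ 2 <= rh (t + m) - rh t.
Proof.
move=> t0 axb; have s_gt0 := spheroid_size_gt0 t0 axb.
have h : 0 <= rh (t + m) - rh t.
  by rewrite subr_ge0; apply: (rho_le calpha csigma s00 hs) => //; rewrite lerDl ltW.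
rewrite -[leRHS]sqr_sqrtr//; apply: lerXn2r; rewrite ?nnegrE ?sqrtr_ge0 ?(ltW s_gt0)//.
by rewrite spheroid_sizeE// ge_min lexx orbT.
Qed.

Lemma Delta_spheroid_size t x : a < x < b -> Dl t x * size t x <= (1 - gamma) * wall_dist x.
Proof.
move=> axb; rewrite mulrC -ler_pdivlMr ?Delta_gt0//.
by rewrite spheroid_sizeE// ge_min lexx.
Qed.

(** Position at time [s] of the path issued from [x] at time [t] with Brownian displacement [y]: a
    translation by [y] in the coordinate z. *)
Definition flow t x s y := expR (- th s) * (y + expR (th t) * (x - cd t)) + cd s.

Definition next_time t u := rho_inv alpha sigma (u + rh t).

Definition next_pos (sgn t x u : R) :=
  psiL alpha beta sigma sgn (size t x) t x (next_time t u - t).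

Lemma next_step t x u : 0 <= t -> a < x < b -> 0 <= u -> u <= size t x ^+ 2 ->
  exists s, [/\ t <= s, s <= t + m, rh s = u + rh t, next_time t u = s &
    forall sgn, next_pos sgn t x u = flow t x s (sgn * psi (size t x) u)].
Proof.
move=> t0 axb u0 us; have sq := spheroid_size_sq t0 axb.
have tm : t <= t + m by rewrite lerDl ltW.
have [|s [ts sm rs es]] := @rho_invP _ _ _ calpha csigma _ s00 hs t (t + m) (u + rh t) t0 tm.
  by rewrite lerDr u0/= -lerBrDr (le_trans us).
exists s; split => // sgn.
rewrite /next_pos /next_time es /psiL subrK rs addrK -theta_diff//.
rewrite /flow expRD; ring.
Qed.

(** The purpose of [Delta]: the displacement is e^(-theta(s)) times y plus the drift, with y at most
    size / sqrt(e) and the drift at most sqrt(energy) size by Cauchy-Schwarz. General [s] and [y]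
    are allowed, beyond exit points, because the barrier looks at the path in the middle of a
    step. *)
Lemma flow_confined t x s y : 0 <= t -> a < x < b -> t <= s ->
  rh s <= size t x ^+ 2 + rh t -> `|y| <= size t x / Num.sqrt (expR 1) ->
  `|flow t x s y - x| <= (1 - gamma) * wall_dist x.
Proof.
move=> t0 axb ts rs hy; have d0 := spheroid_size_gt0 t0 axb.
have sm : s <= t + m.
  rewrite leNgt; apply/negP => h.
  have := @rho_lt _ _ _ calpha csigma _ s00 hs (t + m) s (addr_ge0 t0 (ltW hm)) h.
  have := spheroid_size_sq t0 axb; lra.
apply: le_trans (Delta_spheroid_size t axb).
rewrite flowE// normrM gtr0_norm ?expR_gt0//.
have h1 : expR (- th s) <= growth alpha t (t + m) * expR (- th t).
  rewrite -expRD ler_expR; have := theta_osc calpha t0 ts sm.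
  by rewrite ler_norml => /andP[]; lra.
have h2 : `|y + drift_term alpha beta x t s| <=
    size t x * ((Num.sqrt (expR 1))^-1 + Num.sqrt (Jd x t (t + m))).
  apply: (le_trans (ler_normD _ _)); rewrite mulrDr; apply: lerD => //.
  apply: (le_trans (drift_cauchy_schwarz calpha cbeta csigma s00 hs x t0 ts sm)).
  rewrite mulrC ler_wpM2r ?sqrtr_ge0//.
  rewrite -[leRHS](ger0_norm (ltW d0)) -sqrtr_sqr ler_wsqrtr//.
  by rewrite lerBlDr.
rewrite DeltaE [leRHS](_ : _ = growth alpha t (t + m) * expR (- th t) *
   (size t x * ((Num.sqrt (expR 1))^-1 + Num.sqrt (Jd x t (t + m))))); last by ring.
by apply: ler_pM => //; exact: expR_ge0.
Qed.

Lemma next_pos_confined t x u (sgn : R) : 0 <= t -> a < x < b -> 0 <= u -> u <= size t x ^+ 2 ->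
  `|sgn| <= 1 -> `|next_pos sgn t x u - x| <= (1 - gamma) * wall_dist x.
Proof.
move=> t0 axb u0 us hsgn; have [s [ts sm rs es ->]] := next_step t0 axb u0 us.
apply: flow_confined => //; first by rewrite rs lerD2r.
rewrite normrM (ger0_norm (psi_ge0 _ _)); apply: le_trans (psi_bound u (spheroid_size_gt0 t0 axb)).
by rewrite ler_piMl// psi_ge0.
Qed.

Lemma confined_in x y : a < x < b -> `|y - x| <= (1 - gamma) * wall_dist x ->
  a < y < b /\ gamma * wall_dist x <= wall_dist y.
Proof.
move=> axb; have d0 := wall_dist_gt0 axb; move: hgamma => /andP[g0 g1].
have gd : 0 < gamma * wall_dist x by rewrite mulr_gt0.
have d1 : wall_dist x <= b - x by rewrite /wall_dist ge_min lexx.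
have d2 : wall_dist x <= x - a by rewrite /wall_dist ge_min lexx orbT.
rewrite ler_norml => /andP[h1 h2]; split; first by apply/andP; split; lra.
by rewrite [X in _ <= X]/wall_dist le_min; apply/andP; split; lra.
Qed.

End spheroid_step.

(** * Measurability of one step in the state *)

Section step_measurability.
Context {R : realType}.
Variables alpha beta sigma : R -> R.
Hypotheses (calpha : {within `[0, +oo[, continuous alpha})
  (cbeta : {within `[0, +oo[, continuous beta})
  (csigma : {within `[0, +oo[, continuous sigma}).
Variables (a b m gamma s0 : R).
Hypotheses (hm : 0 < m).
Hypotheses (s00 : 0 < s0) (hs : forall t, 0 <= t -> s0 <= sigma t).
Local Notation mu := (@lebesgue_measure R).
Local Notation th := (theta alpha).
Local Notation rh := (rho alpha sigma).
Local Notation cd := (cdrift alpha beta).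

Lemma continuous_cdrift : continuous cd.
Proof.
move=> t; apply: cvgM.
  apply: continuous_cvg; first exact: continuous_expR.
  by apply: cvgN; exact: continuous_theta.
apply: continuous_Rintegral => s; apply: cvgM; first exact: cbeta.
by apply: continuous_subspaceT => {}s; apply: continuous_cvg; [exact: continuous_expR|exact: continuous_theta].
Qed.

Lemma rho_inv_spec y : rho_inv alpha sigma y = 0 \/ rh (rho_inv alpha sigma y) = y.
Proof.
rewrite /rho_inv /pinv_ splitV oinv_surj; case: pselect => /= h; last by left.
by right; case: cid2 => z /=.
Qed.

(** The value off the range of [rho] is 0. For c >= 0 the preimage of ]c, +oo[ therefore lies in the
    range, where the inverse is increasing, and it is an interval. *)
Lemma measurable_rho_inv : measurable_fun setT (rho_inv alpha sigma).
Proof.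
apply: (measurability _ (RGenOInfty.measurableE R)) => // _ [_ [c ->] <-]; rewrite setTI.
have [c0|c0] := ltP c 0.
  rewrite (_ : _ @^-1` _ = setT)//; apply/seteqP; split => // y _ /=.
  by rewrite in_itv/= andbT (lt_le_trans c0)// rho_inv_ge0.
apply: is_interval_measurable => y1 y2 /=; rewrite !in_itv/= !andbT => h1 h2 y /andP[y1y yy2].
have [e|e1] := rho_inv_spec y1; first by move: h1; rewrite e ltNge c0.
have [e|e2] := rho_inv_spec y2; first by move: h2; rewrite e ltNge c0.
have i1 : 0 <= rho_inv alpha sigma y1 by exact: rho_inv_ge0.
have i2 : 0 <= rho_inv alpha sigma y2 by exact: rho_inv_ge0.
have i12 : rho_inv alpha sigma y1 <= rho_inv alpha sigma y2.
  rewrite leNgt; apply/negP => /(rho_lt calpha csigma s00 hs i2).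
  by rewrite e1 e2 ltNge (le_trans y1y yy2).
have [|s [s1 _ _ ->]] := @rho_invP _ _ _ calpha csigma _ s00 hs _ _ y i1 i12.
  by rewrite e1 e2 y1y.
by rewrite in_itv/= andbT (lt_le_trans h1).
Qed.

Section composite.
Context d (T : measurableType d).
Variables t x : T -> R.
Hypotheses (mt : measurable_fun setT t) (mx : measurable_fun setT x)
  (t0 : forall w, 0 <= t w).

Let mth : measurable_fun setT (fun w => th (t w)).
Proof. by apply: measurableT_comp mt; exact: continuous_measurable_fun (continuous_theta calpha). Qed.

Let mrh : measurable_fun setT (fun w => rh (t w)).
Proof. by apply: measurableT_comp mt; exact: continuous_measurable_fun (continuous_rho calpha csigma). Qed.

Let mcd : measurable_fun setT (fun w => cd (t w)).
Proof. by apply: measurableT_comp mt; exact: continuous_measurable_fun continuous_cdrift. Qed.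

Lemma measurable_next_time (u : T -> R) : measurable_fun setT u ->
  measurable_fun setT (fun w => next_time alpha sigma (t w) (u w)).
Proof. by move=> mu'; apply: (measurableT_comp measurable_rho_inv); exact: measurable_funD. Qed.

Lemma measurable_window_integral (f : R -> R) : {within `[0, +oo[, continuous f} ->
  measurable_fun setT (fun w => \int[mu]_(s in `[t w, t w + m]) f s).
Proof.
move=> cf.
rewrite (_ : (fun w => _) = fun w => \int[mu]_(s in `[0, t w + m]) f s - \int[mu]_(s in `[0, t w]) f s); last first.
  by apply/funext => w; rewrite Rintegral_chasles// lerDl ltW.
have mI : measurable_fun setT (fun v : R => \int[mu]_(s in `[0, v]) f s).
  exact: continuous_measurable_fun (continuous_Rintegral cf).
apply: measurable_funB; last exact: (measurableT_comp mI mt).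
by apply: (measurableT_comp mI); exact: measurable_funD.
Qed.

Lemma measurable_Delta : measurable_fun setT (fun w => Delta alpha beta sigma m (t w) (x w)).
Proof.
apply: measurable_funM.
  apply: measurable_funM; first by apply: measurableT_comp => //; exact: measurableT_comp.
  apply: measurableT_comp => //; apply: measurable_window_integral.
  by move=> s; apply: cvg_norm; exact: calpha.
apply: measurable_funD => //.
apply: (measurableT_comp (continuous_measurable_fun (@sqrt_continuous R))).
rewrite /drift_energy.
have cV : {within `[0, +oo[, continuous (fun s => (sigma s)^-1)}.
  apply/subspace_continuousP => r r0; apply: cvgV.
    by rewrite gt_eqF// (lt_le_trans s00)// hs//; move: r0; rewrite /= in_itv/= andbT.
  by move/subspace_continuousP : csigma; exact.
have wM (f g : R -> R) : {within `[0, +oo[, continuous f} ->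
  {within `[0, +oo[, continuous g} -> {within `[0, +oo[, continuous (fun s => f s * g s)}.
  by move=> cf cg s; apply: cvgM; [exact: cf|exact: cg].
pose p s := (beta s / sigma s); pose q s := (alpha s / sigma s).
have cp : {within `[0, +oo[, continuous p} by exact: wM.
have cq : {within `[0, +oo[, continuous q} by exact: wM.
have wC (k : R) : {within `[0, +oo[, continuous (fun _ : R => k)}.
  by apply: continuous_subspaceT => s; exact: cvg_cst.
(* The integrand is quadratic in [x w]; expanding it leaves window integrals that depend on [w]
   through [t w] only. *)
have -> : (fun w => \int[mu]_(s in `[t w, t w + m]) (`|beta s + x w * alpha s| ^+ 2 / sigma s ^+ 2)) =
    fun w => \int[mu]_(s in `[t w, t w + m]) (p s * p s) +
  (x w * 2 * \int[mu]_(s in `[t w, t w + m]) (p s * q s) +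
   x w ^+ 2 * \int[mu]_(s in `[t w, t w + m]) (q s * q s)).
  apply/funext => w; have tw := t0 w; have twm : 0 <= t w + m by rewrite addr_ge0// ltW.
  rewrite -!Rintegral_Zl_itv//; try exact: wM.
  have c2 : {within `[0, +oo[, continuous (fun s => x w * 2 * (p s * q s))} by apply: (wM); [exact: wC|exact: wM].
  have c3 : {within `[0, +oo[, continuous (fun s => x w ^+ 2 * (q s * q s))} by apply: (wM); [exact: wC|exact: wM].
  rewrite -Rintegral_D_itv// -Rintegral_D_itv//; last 2 first.
  - exact: wM.
  - by move=> s; apply: cvgD; [exact: c2|exact: c3].
  apply: eq_Rintegral => s; rewrite inE/= in_itv/= => /andP[ts _].
  rewrite real_normK ?num_real// /p /q.
  by field; rewrite gt_eqF// (lt_le_trans s00)// hs// (le_trans tw).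
apply: measurable_funD; first by apply: measurable_window_integral; exact: wM.
apply: measurable_funD; apply: measurable_funM.
- exact: measurable_funM.
- by apply: measurable_window_integral; exact: wM.
- exact: measurable_funX.
- by apply: measurable_window_integral; exact: wM.
Qed.

Lemma measurable_spheroid_size :
  measurable_fun setT (fun w => spheroid_size alpha beta sigma a b m gamma (t w) (x w)).
Proof.
have mD := measurable_Delta.
have mDV : measurable_fun setT (fun w => (Delta alpha beta sigma m (t w) (x w))^-1).
  exact: (measurableT_comp (@measurable_invr R)).
have mrr : measurable_fun setT (fun w => Num.sqrt (rh (t w + m) - rh (t w))).
  apply: (measurableT_comp (continuous_measurable_fun (@sqrt_continuous R))).
  apply: measurable_funB => //; apply: measurableT_comp; last exact: measurable_funD.
  exact: continuous_measurable_fun (continuous_rho calpha csigma).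
have mb : measurable_fun setT (fun w => b_gamma b gamma (x w) - x w).
  by apply: measurable_funB => //; apply: measurable_funB => //; apply: measurable_funM => //; exact: measurable_funB.
have ma : measurable_fun setT (fun w => x w - a_gamma a gamma (x w)).
  by apply: measurable_funB => //; apply: measurable_funD => //; apply: measurable_funM => //; exact: measurable_funB.
rewrite /spheroid_size; apply: measurable_fun_ifT.
- by apply: measurable_fun_ler; exact: measurable_funB.
- apply: measurable_funM => //; apply: measurable_funM => //; apply: measurable_minr => //.
  rewrite /kappa_plus; apply: measurable_funM; first exact: measurable_funM.
  exact: (measurableT_comp (@measurable_invr R)).
- apply: measurable_funM => //; apply: measurable_funM => //; apply: measurable_minr => //.
  rewrite /kappa_minus; apply: measurable_funM; first exact: measurable_funM.
  exact: (measurableT_comp (@measurable_invr R)).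
Qed.

End composite.

Lemma measurable_next_pos d (T : measurableType d) (sgn t x u : T -> R) :
  measurable_fun setT sgn -> measurable_fun setT t -> measurable_fun setT x ->
  measurable_fun setT u -> (forall w, 0 <= t w) ->
  measurable_fun setT (fun w => next_pos alpha beta sigma a b m gamma (sgn w) (t w) (x w) (u w)).
Proof.
move=> msgn mt mx mu' t0.
pose s w := next_time alpha sigma (t w) (u w).
have ms : measurable_fun setT s by exact: measurable_next_time.
have mth : measurable_fun setT th by exact: continuous_measurable_fun (continuous_theta calpha).
have mrh : measurable_fun setT rh by exact: continuous_measurable_fun (continuous_rho calpha csigma).
have mcd : measurable_fun setT cd by exact: continuous_measurable_fun continuous_cdrift.
have ma : measurable_fun setT (fun w => \int[mu]_(r in `[t w, s w]) alpha r).
  (* [s w] may be smaller than [t w], for instance at the default value 0 of [rho_inv]; the interval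
     of integration is then empty. *)
  rewrite (_ : (fun w => _) = fun w => if t w <= s w then th (t w) - th (s w) else 0).
    apply: measurable_fun_ifT => //; first exact: measurable_fun_ler.
    by apply: measurable_funB; exact: measurableT_comp.
  apply/funext => w; case: leP => h; first by rewrite -theta_diff.
  by rewrite set_itv_ge ?Rintegral_set0// bnd_simp -ltNge.
rewrite (_ : (fun w => _) = fun w => expR (- th (s w)) *
    (sgn w * psi (spheroid_size alpha beta sigma a b m gamma (t w) (x w)) (rh (s w) - rh (t w))) + cd (s w) +
    (x w - cd (t w)) * expR (\int[mu]_(r in `[t w, s w]) alpha r)); last first.
  by apply/funext => w; rewrite /next_pos /psiL subrK.
apply: measurable_funD; [apply: measurable_funD|apply: measurable_funM].
- apply: measurable_funM.
    by apply: measurableT_comp => //; apply: measurableT_comp => //; exact: measurableT_comp.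
  apply: measurable_funM => //; apply: measurable_psi.
    exact: (measurable_spheroid_size mt mx t0).
  by apply: measurable_funB; exact: measurableT_comp.
- exact: measurableT_comp.
- by apply: measurable_funB => //; exact: measurableT_comp.
- exact: measurableT_comp.
Qed.

End step_measurability.

(** * Lyapunov function *)

Section wall_potential.
Context {R : realType}.
Variables a b : R.
Implicit Types x y D S : R.

Definition wall_potential x := 2 * ln (b - a) - ln (b - x) - ln (x - a).

Lemma ln1D_le (z : R) : 0 < 1 + z -> ln (1 + z) <= z.
Proof. by move=> z0; rewrite -ler_expR lnK ?posrE// expR_ge1Dx. Qed.

(** The product of the two arguments is p^2 (1 + z) with z = - 2 D / p + D^2 / p^2 - S^2 / p^2. Then
    ln(1 + z) <= z, and D^2 / p^2 <= |D| / p. The term in S^2 is the concavity of the logarithm. *)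
Lemma ln_pair p D S : 0 < p -> `|D| <= p -> `|S| < p - D ->
  (ln (p - D - S) + ln (p - D + S)) / 2 <= ln p + 3 / 2 * (`|D| / p) - S ^+ 2 / (2 * p ^+ 2).
Proof.
move=> p0 Dp; rewrite ltr_norml => /andP[h1 h2].
have a1 : 0 < p - D - S by lra.
have a2 : 0 < p - D + S by lra.
rewrite -lnM ?posrE//.
have -> : (p - D - S) * (p - D + S) = p * p * (1 + (- 2 * (D / p) + (D / p) ^+ 2 - S ^+ 2 / p ^+ 2)).
  by field; rewrite gt_eqF.
set z := (X in 1 + X).
have z0 : 0 < 1 + z.
  have : 0 < p * p * (1 + z).
    by rewrite (_ : _ * _ = (p - D - S) * (p - D + S)) ?mulr_gt0// /z; field; rewrite gt_eqF.
  by rewrite pmulr_rgt0// mulr_gt0.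
rewrite lnM ?posrE ?mulr_gt0// lnM ?posrE//.
have := ln1D_le z0.
have Q1 : `|D| / p <= 1 by rewrite ler_pdivrMr// mul1r.
have Q0 : 0 <= `|D| / p by rewrite divr_ge0// ltW.
have QE : (D / p) ^+ 2 = (`|D| / p) ^+ 2 by rewrite !expr_div_n real_normK// num_real.
have Q2 : (D / p) ^+ 2 <= `|D| / p by rewrite QE expr2 ler_piMr.
have Q3 : - (D / p) <= `|D| / p.
  by rewrite -mulNr ler_wpM2r ?invr_ge0 ?(ltW p0)// -normrN ler_norm.
have -> : S ^+ 2 / (2 * p ^+ 2) = S ^+ 2 / p ^+ 2 / 2 by field; rewrite gt_eqF.
rewrite /z; lra.
Qed.

(** [ln_pair] at each wall. Both drift costs are bounded through the nearer wall, hence the factor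
    3, and only the nearer wall's gain in S^2 is kept. *)
Lemma wall_potential_step x D S : a < x < b ->
  a < x + D - S -> a < x + D + S -> x + D - S < b -> x + D + S < b ->
  `|D| <= wall_dist a b x ->
  wall_potential x - 3 * (`|D| / wall_dist a b x) + S ^+ 2 / (2 * wall_dist a b x ^+ 2) <=
  (wall_potential (x + D + S) + wall_potential (x + D - S)) / 2.
Proof.
move=> /andP[ax xb] h1 h2 h3 h4 hD.
have d0 : 0 < wall_dist a b x by rewrite wall_dist_gt0// ax.
have d1 : wall_dist a b x <= b - x by rewrite /wall_dist ge_min lexx.
have d2 : wall_dist a b x <= x - a by rewrite /wall_dist ge_min lexx orbT.
have p1 : 0 < b - x by rewrite subr_gt0.
have p2 : 0 < x - a by rewrite subr_gt0.
have k1 : `|S| < b - x - D by rewrite ltr_norml; apply/andP; split; lra.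
have k2 : `|S| < x - a - - D by rewrite ltr_norml; apply/andP; split; lra.
have K1 := ln_pair p1 (le_trans hD d1) k1.
have K2 : _ := @ln_pair (x - a) (- D) S p2 _ k2; rewrite normrN in K2.
have {}K2 := K2 (le_trans hD d2).
have D1 : `|D| / (b - x) <= `|D| / wall_dist a b x by rewrite ler_wpM2l// lef_pV2.
have D2 : `|D| / (x - a) <= `|D| / wall_dist a b x by rewrite ler_wpM2l// lef_pV2.
have SS : S ^+ 2 / (2 * wall_dist a b x ^+ 2) <= S ^+ 2 / (2 * (b - x) ^+ 2) + S ^+ 2 / (2 * (x - a) ^+ 2).
  have n1 : 0 <= S ^+ 2 / (2 * (b - x) ^+ 2) by rewrite divr_ge0 ?sqr_ge0// mulr_ge0 ?sqr_ge0.
  have n2 : 0 <= S ^+ 2 / (2 * (x - a) ^+ 2) by rewrite divr_ge0 ?sqr_ge0// mulr_ge0 ?sqr_ge0.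
  rewrite (_ : wall_dist a b x = if b - x < x - a then b - x else x - a)//; case: ifP => _; lra.
rewrite /wall_potential.
have -> : b - (x + D + S) = b - x - D - S by ring.
have -> : b - (x + D - S) = b - x - D + S by ring.
have -> : x + D + S - a = x - a - - D + S by ring.
have -> : x + D - S - a = x - a - - D - S by ring.
lra.
Qed.

Lemma wall_potential_ge0 x : a < x < b -> 0 <= wall_potential x.
Proof.
move=> /andP[ax xb].
have h1 : ln (b - x) <= ln (b - a) by rewrite ler_ln ?posrE; lra.
have h2 : ln (x - a) <= ln (b - a) by rewrite ler_ln ?posrE; lra.
rewrite /wall_potential; lra.
Qed.

Lemma wall_potential_le x e : 0 < e -> e <= b - x -> e <= x - a ->
  wall_potential x <= 2 * (ln (b - a) - ln e).
Proof.
move=> e0 h1 h2.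
have k1 : ln e <= ln (b - x) by rewrite ler_ln ?posrE; lra.
have k2 : ln e <= ln (x - a) by rewrite ler_ln ?posrE; lra.
rewrite /wall_potential; lra.
Qed.

End wall_potential.

Lemma linear_drift_bound (R : realType) (alpha beta : R -> R) (a b m C : R) :
  0 < m -> 0 < C -> (forall t, 0 <= t -> `|alpha t| <= C * (1 + t)) ->
  (forall t, 0 <= t -> `|beta t| <= C * (1 + t)) ->
  exists2 B : R, 0 < B & forall t x r, 0 <= t -> a < x < b -> t <= r <= t + m ->
    `|beta r + x * alpha r| <= B * (1 + t).
Proof.
move=> m0 C0 hal hbe.
have n1 : 0 < 1 + `|a| + `|b| by rewrite ltr_wpDr// ltr_wpDr.
exists (C * (1 + `|a| + `|b|) * (1 + m)); first by rewrite !mulr_gt0// ltr_wpDr// ltW.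
move=> t x r t0 /andP[ax xb] /andP[tr rm]; have r0 := le_trans t0 tr.
apply: (le_trans (ler_normD _ _)); rewrite normrM.
have hx : `|x| <= `|a| + `|b|.
  have := ler_norm b; have := normr_ge0 b; have := normr_ge0 a.
  have : - `|a| <= a by rewrite lerNl -normrN ler_norm.
  by rewrite ler_norml => *; apply/andP; split; lra.
have h1 := hbe _ r0; have h2 := hal _ r0.
have h3 : `|x| * `|alpha r| <= (`|a| + `|b|) * (C * (1 + r)) by exact: ler_pM.
have h4 : 1 + r <= (1 + m) * (1 + t) by have := mulr_ge0 (ltW m0) t0; lra.
apply: (@le_trans _ _ (C * (1 + `|a| + `|b|) * (1 + r))).
  by rewrite (_ : _ * _ * _ = C * (1 + r) + (`|a| + `|b|) * (C * (1 + r))); [exact: lerD|ring].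
by rewrite -[leRHS]mulrA ler_wpM2l// mulr_ge0// ltW.
Qed.

Section lyapunov.
Context {R : realType}.
Variables alpha beta sigma : R -> R.
Hypotheses (calpha : {within `[0, +oo[, continuous alpha})
  (cbeta : {within `[0, +oo[, continuous beta})
  (csigma : {within `[0, +oo[, continuous sigma}).
Variables (a b m gamma s0 Cg : R).
Hypotheses (hab : a < b) (hm : 0 < m) (hgamma : 0 < gamma < 1).
Hypotheses (s00 : 0 < s0) (hs : forall t, 0 <= t -> s0 <= sigma t).
Hypotheses (Cg0 : 0 < Cg) (hsg : forall t, 0 <= t -> sigma t <= Cg * (1 + t))
  (hgr : forall t, 0 <= t -> growth alpha t (t + m) <= Cg * (1 + t)).
Local Notation th := (theta alpha).
Local Notation rh := (rho alpha sigma).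
Local Notation size := (spheroid_size alpha beta sigma a b m gamma).
Local Notation Jd := (drift_energy alpha beta sigma).
Implicit Types s t u v x y : R.

Variable B : R.
Hypotheses (B0 : 0 < B) (drift_bound : forall t x r, 0 <= t -> a < x < b -> t <= r <= t + m ->
  `|beta r + x * alpha r| <= B * (1 + t)).

Let energy_bound t x : 0 <= t -> a < x < b ->
  Num.sqrt (Jd x t (t + m)) <= Num.sqrt m * B / s0 * (1 + t).
Proof.
move=> t0 axb; have l0 : 0 < 1 + t by lra.
have -> : Num.sqrt m * B / s0 * (1 + t) = Num.sqrt (m * (B * (1 + t) / s0) ^+ 2).
  rewrite sqrtrM ?(ltW hm)// sqrtr_sqr ger0_norm; first by ring.
  by rewrite divr_ge0 ?mulr_ge0 ?(ltW l0) ?(ltW B0) ?(ltW s00).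
apply: ler_wsqrtr; rewrite mulrC.
have tm : t <= t + m by rewrite lerDl ltW.
have := @Rintegral_le_cst _ _ ((B * (1 + t) / s0) ^+ 2) _ _ t0 tm (@drift_energy_cont _ _ _ _ calpha cbeta csigma _ s00 hs x).
rewrite [t + m - t]addrAC subrr add0r; apply => r trm.
rewrite -expr_div_n; have r0 : 0 <= r by case/andP: trm => tr _; exact: le_trans tr.
have sr := hs r0; have sr0 := lt_le_trans s00 sr.
apply: lerXn2r; rewrite ?nnegrE ?divr_ge0 ?mulr_ge0 ?(ltW sr0) ?(ltW s00) ?(ltW l0) ?(ltW B0)//.
apply: ler_pM; rewrite ?invr_ge0 ?(ltW sr0)//; first exact: drift_bound.
by rewrite lef_pV2 ?posrE.
Qed.

Let kap := (Num.sqrt (expR 1))^-1 : R.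
Let kap0 : 0 < kap.
Proof. by rewrite invr_gt0 sqrtr_gt0 expR_gt0. Qed.

(** In the first term of the minimum, the growth factor and the root of the energy are each O(1 +
    t). In the second, [rho_lower] gives a multiple of 1 / (1 + t), and the distance to the boundary
    is at most b - a. *)
Lemma spheroid_size_lower : exists2 c : R, 0 < c & forall t x, 0 <= t -> a < x < b ->
  c * wall_dist a b x / (1 + t) ^+ 2 <= expR (- th t) * size t x.
Proof.
move: (hgamma) => /andP[g0 g1].
pose c1 : R := (1 - gamma) / (Cg * (kap + Num.sqrt m * B / s0)).
pose c2 : R := s0 * Num.sqrt m / Cg / (b - a).
have q0 : 0 <= Num.sqrt m * B / s0 by rewrite divr_ge0 ?mulr_ge0 ?sqrtr_ge0 ?(ltW B0) ?(ltW s00).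
have c10 : 0 < c1 by rewrite divr_gt0 ?subr_gt0// mulr_gt0// ltr_wpDr.
have c20 : 0 < c2 by rewrite !divr_gt0 ?mulr_gt0 ?subr_gt0 ?sqrtr_gt0.
exists (Num.min c1 c2); first by rewrite lt_min c10.
move=> t x t0 axb; have l1 : 1 <= 1 + t by lra.
have l0 : 0 < 1 + t by lra.
have d0 := wall_dist_gt0 axb.
have E1 : expR (- th t) * expR (th t) = 1 by rewrite -expRD addNr expR0.
have D0 := Delta_gt0 alpha beta sigma m t x.
have Eg : growth alpha t (t + m) <= Cg * (1 + t) := hgr t0.
have E0 := growth_gt0 alpha t (t + m).
rewrite spheroid_sizeE// [leRHS]mulrC [leRHS]minr_pMl ?expR_ge0// le_min; apply/andP; split.
  apply: (@le_trans _ _ (c1 * wall_dist a b x / (1 + t) ^+ 2)).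
    by rewrite ler_wpM2r ?invr_ge0 ?sqr_ge0// ler_wpM2r ?(ltW d0)// ge_min lexx.
  rewrite DeltaE; set F := (_ + Num.sqrt _); have F0 : 0 < F by rewrite ltr_wpDr ?sqrtr_ge0.
  have Fl : F <= (kap + Num.sqrt m * B / s0) * (1 + t).
    rewrite mulrDl; apply: lerD; last exact: energy_bound.
    by rewrite ler_peMr// ltW.
  have -> : (1 - gamma) * wall_dist a b x / (expR (- th t) * growth alpha t (t + m) * F) * expR (- th t) =
     (1 - gamma) * wall_dist a b x * (growth alpha t (t + m) * F)^-1.
    by field; rewrite !gt_eqF// expR_gt0.
  have -> : c1 * wall_dist a b x / (1 + t) ^+ 2 = (1 - gamma) * wall_dist a b x *
      ((Cg * (1 + t)) * ((kap + Num.sqrt m * B / s0) * (1 + t)))^-1.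
    by rewrite /c1; field; rewrite !gt_eqF//= ltr_wpDr ?mulr_gt0 ?mulr_ge0 ?sqrtr_ge0 ?(ltW B0)// ltW.
  rewrite ler_wpM2l ?mulr_ge0 ?subr_ge0 ?(ltW d0) ?(ltW g1)//.
  rewrite lef_pV2 ?posrE ?mulr_gt0//; last by rewrite ltr_wpDr.
  by apply: ler_pM; rewrite ?(ltW E0) ?(ltW F0).
apply: (@le_trans _ _ (s0 * Num.sqrt m / (Cg * (1 + t)))).
  apply: (@le_trans _ _ (c2 * (b - a) / (1 + t))).
    have W : Num.min c1 c2 * wall_dist a b x <= c2 * (b - a).
      apply: ler_pM; rewrite ?(ltW d0) ?le_min ?(ltW c10) ?(ltW c20) ?ge_min ?lexx ?orbT//.
      apply/orP; left; case/andP: axb; lra.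
    apply: ler_pM => //; rewrite ?invr_ge0 ?sqr_ge0//.
      by rewrite mulr_ge0 ?(ltW d0)// le_min (ltW c10) (ltW c20).
    by rewrite lef_pV2 ?posrE ?exprn_gt0// expr2 ler_peMr// ltW.
  rewrite le_eqVlt; apply/orP; left; apply/eqP; rewrite /c2; field.
  by rewrite !gt_eqF ?subr_gt0.
have tm : t <= t + m by rewrite lerDl ltW.
have := rho_lower calpha csigma s00 hs t0 tm; rewrite [t + m - t]addrAC subrr add0r => rl.
apply: (@le_trans _ _ (Num.sqrt (s0 ^+ 2 / growth alpha t (t + m) ^+ 2 * expR (th t) ^+ 2 * m) * expR (- th t))); last first.
  by rewrite ler_wpM2r ?expR_ge0// ler_wsqrtr.
rewrite -expr_div_n -exprMn sqrtrM ?sqr_ge0// sqrtr_sqr ger0_norm; last first.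
  by rewrite mulr_ge0 ?expR_ge0// divr_ge0// ltW.
rewrite (_ : _ * expR (- th t) = s0 * Num.sqrt m / growth alpha t (t + m) * (expR (- th t) * expR (th t))); last by ring.
rewrite E1 mulr1 ler_wpM2l ?mulr_ge0 ?sqrtr_ge0 ?(ltW s00)//.
by rewrite lef_pV2 ?posrE// mulr_gt0.
Qed.

(* The drift costs at most O((1 + t)^8) per unit of [expR (- 2 * theta t) * tau],
   which is itself O((1 + t)^4) times the elapsed time: hence the power 13. *)
Definition lyapunov (K t x : R) := wall_potential a b x + K * (1 + t) ^+ 13.

(** sigma^2 and the squared growth factor contribute (1 + t)^2 each. *)
Lemma time_gap (t s : R) : 0 <= t -> t <= s -> s <= t + m ->
  expR (- th t) ^+ 2 * (rh s - rh t) <= Cg ^+ 4 * (1 + m) ^+ 2 * (1 + t) ^+ 4 * (s - t).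
Proof.
move=> t0 ts sm; have l0 : 0 < 1 + t by lra.
have E1 : expR (- th t) * expR (th t) = 1 by rewrite -expRD addNr expR0.
have gs : growth alpha t s <= Cg * (1 + t).
  by apply: le_trans (hgr t0); exact: growth_mono.
have hM r : t <= r <= s -> sigma r <= Cg * (1 + m) * (1 + t).
  move=> /andP[tr rs]; apply: (le_trans (hsg (le_trans t0 tr))).
  rewrite -[leRHS]mulrA ler_wpM2l ?(ltW Cg0)//.
  have := mulr_ge0 (ltW hm) t0; lra.
have := rho_upper calpha csigma s00 hs t0 ts hM; set G := growth alpha t s => h.
apply: (@le_trans _ _ (expR (- th t) ^+ 2 * ((Cg * (1 + m) * (1 + t)) ^+ 2 * G ^+ 2 * expR (th t) ^+ 2 * (s - t)))).
  by rewrite ler_wpM2l// exprn_ge0// expR_ge0.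
have -> : expR (- th t) ^+ 2 * ((Cg * (1 + m) * (1 + t)) ^+ 2 * G ^+ 2 * expR (th t) ^+ 2 * (s - t)) =
  (expR (- th t) * expR (th t)) ^+ 2 * ((Cg * (1 + m) * (1 + t)) ^+ 2 * (s - t)) * G ^+ 2 by ring.
rewrite E1 expr1n mul1r.
rewrite [leRHS](_ : _ = (Cg * (1 + m) * (1 + t)) ^+ 2 * (s - t) * (Cg * (1 + t)) ^+ 2); last by ring.
apply: ler_wpM2l; first by apply: mulr_ge0; rewrite ?sqr_ge0 ?subr_ge0.
apply: lerXn2r => //; rewrite nnegrE ?(ltW (growth_gt0 _ _ _))//.
by rewrite mulr_ge0 ?(ltW Cg0) ?(ltW l0).
Qed.

(** One factor 1 + t comes from the drift bound, two from the growth factor: in [drift_linear], and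
    in replacing e^(-theta(s)) by e^(-theta(t)). *)
Lemma drift_shift (t x s : R) : 0 <= t -> a < x < b -> t <= s -> s <= t + m ->
  `|expR (- th s) * drift_term alpha beta x t s| <=
  B * Cg ^+ 2 / s0 ^+ 2 * (1 + t) ^+ 3 * (expR (- th t) ^+ 2 * (rh s - rh t)).
Proof.
move=> t0 axb ts sm; have l0 : 0 < 1 + t by lra.
have hM r : t <= r <= t + m -> `|beta r + x * alpha r| <= B * (1 + t) by exact: drift_bound.
have h := drift_linear calpha cbeta csigma s00 hs t0 ts sm hM.
have r0 : 0 <= rh s - rh t by rewrite subr_ge0 (rho_le calpha csigma s00 hs).
rewrite normrM (gtr0_norm (expR_gt0 _)).
have g1 := hgr t0; have g0 := growth_gt0 alpha t (t + m).
have e1 : expR (- th s) <= Cg * (1 + t) * expR (- th t).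
  apply: (@le_trans _ _ (growth alpha t (t + m) * expR (- th t))); last first.
    by rewrite ler_wpM2r ?expR_ge0.
  rewrite -expRD ler_expR; have := theta_osc calpha t0 ts sm.
  by rewrite ler_norml => /andP[]; lra.
have h2 : `|drift_term alpha beta x t s| <=
    B * (1 + t) * (Cg * (1 + t)) / s0 ^+ 2 * expR (- th t) * (rh s - rh t).
  apply: (le_trans h); rewrite ler_wpM2r// ler_wpM2r ?expR_ge0//.
  rewrite ler_wpM2r ?invr_ge0 ?sqr_ge0// ler_wpM2l// mulr_ge0 ?(ltW B0) ?(ltW l0)//.
have := ler_pM (expR_ge0 _) (normr_ge0 _) e1 h2.
move=> hh; apply: (le_trans hh); rewrite le_eqVlt; apply/orP; left; apply/eqP.
by field; rewrite gt_eqF.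
Qed.

(** [k] stands for the constant of [exit_moments]: in mean, the psi^2 term is at least twice the
    size^2 term on the right, so half of the gain survives. The drift cost is split by AM-GM. The
    part in 1 / dist^2 goes into that size^2 term; the rest, O((1 + t)^8) times the intrinsic
    duration, is paid by the growth of K (1 + t)^13. *)
Lemma lyapunov_step (k : R) : 0 < k -> exists K c : R, [/\ 0 < K, 0 < c &
  forall t x u, 0 <= t -> a < x < b -> 0 <= u -> u <= size t x ^+ 2 ->
  lyapunov K t x + c * (expR (- th t) / ((1 + t) * wall_dist a b x)) ^+ 2 * psi (size t x) u ^+ 2 <=
  (lyapunov K (next_time alpha sigma t u) (next_pos alpha beta sigma a b m gamma 1 t x u) +
   lyapunov K (next_time alpha sigma t u) (next_pos alpha beta sigma a b m gamma (- 1) t x u)) / 2 +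
  c * (k / 2) * (expR (- th t) / ((1 + t) * wall_dist a b x)) ^+ 2 * size t x ^+ 2].
Proof.
move=> k0; move: (hgamma) => /andP[g0 g1].
(* In [c], the half comes from [wall_potential_step] and [Cg ^+ 2] from e^(-theta(t)) <= Cg (1 + t)
   e^(-theta(s)). *)
pose c : R := (2 * Cg ^+ 2)^-1; pose C1 : R := B * Cg ^+ 2 / s0 ^+ 2.
pose C2 : R := Cg ^+ 4 * (1 + m) ^+ 2; pose e : R := c * (k / 2).
have c0 : 0 < c by rewrite invr_gt0 mulr_gt0// exprn_gt0.
have e0 : 0 < e by rewrite mulr_gt0// divr_gt0.
have C10 : 0 < C1 by rewrite !mulr_gt0 ?invr_gt0 ?exprn_gt0.
have C20 : 0 < C2 by rewrite mulr_gt0 ?exprn_gt0// ltr_wpDr// ltW.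
(* Makes e y^2 - 3 C1 (1 + t)^4 y + K0 (1 + t)^8 a perfect square. *)
pose K0 : R := 9 * C1 ^+ 2 / (4 * e).
have K00 : 0 < K0 by apply: divr_gt0; apply: mulr_gt0 => //; exact: exprn_gt0.
exists (K0 * C2), c; split => //; first exact: mulr_gt0.
move=> t x u t0 axb u0 us.
have [s [ts sm rs es hx]] := next_step calpha csigma hm hgamma s00 hs t0 axb u0 us.
rewrite es !hx mul1r mulN1r.
set d := size t x in us *; set p := psi d u; pose D := expR (- th s) * drift_term alpha beta x t s.
have d0 : 0 < d := spheroid_size_gt0 beta calpha csigma hm hgamma s00 hs t0 axb.
have p0 : 0 <= p := psi_ge0 _ _.
pose S := expR (- th s) * p; set dl := wall_dist a b x.
have dl0 : 0 < dl := wall_dist_gt0 axb.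
have fE y : flow alpha beta t x s y = x + D + expR (- th s) * y.
  by have := flowE calpha cbeta x y t0 ts; rewrite /flow /D => h; rewrite -[LHS](subrK x) h; ring.
have rs' : rh s <= size t x ^+ 2 + rh t by rewrite rs lerD2r.
have hp : `|p| <= d / Num.sqrt (expR 1) by rewrite ger0_norm// psi_bound.
have cf y := @flow_confined _ _ _ _ calpha cbeta csigma a b m gamma s0 hm hgamma s00 hs t x s y t0 axb ts rs'.
have conf := confined_in hgamma axb.
have [/andP[x1a x1b] _] := conf _ (cf p hp).
have [/andP[x2a x2b] _] := conf _ (cf (- p) (eq_ind_r (fun z => z <= _) hp (normrN p))).
have D1 : `|D| <= dl.
  have := cf 0; rewrite normr0 fE mulr0 addr0 [x + D]addrC addrK => h.
  have {}h := h (divr_ge0 (ltW d0) (sqrtr_ge0 _)).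
  by apply: (le_trans h); rewrite ler_piMl ?(ltW dl0)//; lra.
have fp : flow alpha beta t x s p = x + D + S := fE p.
have fm : flow alpha beta t x s (- p) = x + D - S by rewrite fE mulrN.
rewrite fp in x1a x1b *; rewrite fm in x2a x2b *.
have W := wall_potential_step axb x2a x1a x2b x1b D1.
have l0 : 0 < 1 + t by rewrite ltr_pwDl.
pose U := expR (- th t) ^+ 2 * u.
have rsE : rh s - rh t = u by rewrite rs addrK.
have U0 : 0 <= U by rewrite mulr_ge0 ?sqr_ge0.
have DU : `|D| <= C1 * (1 + t) ^+ 3 * U by have := drift_shift t0 axb ts sm; rewrite rsE.
have TU : U <= C2 * (1 + t) ^+ 4 * (s - t) by have := time_gap t0 ts sm; rewrite rsE.
have Ud : U <= expR (- th t) ^+ 2 * d ^+ 2 by rewrite ler_wpM2l ?sqr_ge0.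
set y := ((1 + t) * dl)^-1.
have y0 : 0 < y by rewrite invr_gt0 mulr_gt0.
have SS : c * (expR (- th t) * y) ^+ 2 * p ^+ 2 <= S ^+ 2 / (2 * dl ^+ 2).
  have h : expR (- th t) <= Cg * (1 + t) * expR (- th s).
    apply: (@le_trans _ _ (growth alpha t (t + m) * expR (- th s))); last first.
      by rewrite ler_wpM2r ?expR_ge0 ?hgr.
    rewrite -expRD ler_expR; have := theta_osc calpha t0 ts sm.
    by rewrite ler_norml => /andP[]; lra.
  have h2 : expR (- th t) ^+ 2 <= (Cg * (1 + t) * expR (- th s)) ^+ 2.
    by apply: lerXn2r => //; rewrite nnegrE ?mulr_ge0 ?expR_ge0 ?(ltW Cg0) ?(ltW l0).
  rewrite [leLHS](_ : _ = c * y ^+ 2 * p ^+ 2 * expR (- th t) ^+ 2); last by ring.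
  rewrite [leRHS](_ : _ = c * y ^+ 2 * p ^+ 2 * (Cg * (1 + t) * expR (- th s)) ^+ 2); last first.
    by rewrite /c /y /S; field; rewrite !gt_eqF.
  apply: ler_wpM2l => //; apply: mulr_ge0; last exact: sqr_ge0.
  by apply: mulr_ge0; [exact: ltW|exact: sqr_ge0].
have DD : 3 * (`|D| / dl) <= e * (expR (- th t) * y) ^+ 2 * d ^+ 2 + K0 * (1 + t) ^+ 8 * U.
  apply: (@le_trans _ _ (3 * C1 * (1 + t) ^+ 4 * y * U)).
    rewrite [leRHS](_ : _ = 3 * (C1 * (1 + t) ^+ 3 * U / dl)); last first.
      by rewrite /y; field; rewrite !gt_eqF.
    by rewrite ler_wpM2l// ler_wpM2r// invr_ge0 ltW.
  apply: (@le_trans _ _ ((e * y ^+ 2 + K0 * (1 + t) ^+ 8) * U)).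
    rewrite ler_wpM2r// -subr_ge0.
    rewrite (_ : _ - _ = e * (y - 3 * C1 * (1 + t) ^+ 4 / (2 * e)) ^+ 2).
      by rewrite mulr_ge0 ?sqr_ge0// ltW.
    by rewrite /K0; field; rewrite gt_eqF.
  rewrite mulrDl lerD2r [leRHS](_ : _ = e * y ^+ 2 * (expR (- th t) ^+ 2 * d ^+ 2)); last by ring.
  by apply: ler_wpM2l => //; apply: mulr_ge0; [exact: ltW|exact: sqr_ge0].
have TT : K0 * (1 + t) ^+ 8 * U <= K0 * C2 * ((1 + s) ^+ 13 - (1 + t) ^+ 13).
  apply: (@le_trans _ _ (K0 * C2 * ((1 + t) ^+ 12 * (s - t)))).
    rewrite [leRHS](_ : _ = K0 * (1 + t) ^+ 8 * (C2 * (1 + t) ^+ 4 * (s - t))); last by ring.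
    by rewrite ler_wpM2l// mulr_ge0 ?exprn_ge0 ?(ltW K00) ?(ltW l0).
  apply: ler_wpM2l; first by apply: mulr_ge0; exact: ltW.
  rewrite [leLHS](_ : _ = (1 + t) ^+ 12 * (1 + s) - (1 + t) ^+ 13); last by ring.
  rewrite lerD2r [leRHS]exprSr ler_wpM2r//.
    by rewrite addr_ge0// (le_trans t0).
  by apply: lerXn2r; rewrite ?nnegrE ?(ltW l0) ?lerD2l// addr_ge0// (le_trans t0).
move: W SS DD TT; rewrite /lyapunov -/dl -/y -/e; clear; lra.
Qed.

End lyapunov.

(** * Barrier for a time block *)

(** The sign of [k] is free: [k * H] is put on the side where its coefficient is nonnegative, so
    that only integrals of nonnegative functions occur. [H] will be a sum of heat kernels, whose
    mean is known exactly. *)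
Lemma integral_le_affine d (T : measurableType d) (R : realType)
    (P : probability T R) (D : set T) (f H : T -> R) (k c h : R) :
  measurable D -> P (~` D) = 0 -> measurable_fun setT f -> measurable_fun setT H ->
  (forall w, 0 <= f w) -> (forall w, 0 <= H w) ->
  (forall w, D w -> f w + k * H w <= c) ->
  (\int[P]_w (H w)%:E = h%:E)%E -> 0 <= c ->
  (\int[P]_w (f w)%:E <= (c - k * h)%:E)%E.
Proof.
move=> mD PD mf mH f0 H0 fH Hh c0.
have mfD : measurable_fun D f by exact: measurable_funTS.
have mHD : measurable_fun D H by exact: measurable_funTS.
have Ec (e : R) : 0 <= e -> (\int[P]_(x in D) e%:E = e%:E)%E.
  move=> e0; rewrite -(@ge0_integral_full _ _ _ P D (fun=> e%:E))//.
  by rewrite integral_cst//= probability_setT mule1.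
have HD : (\int[P]_(x in D) (H x)%:E = h%:E)%E.
  rewrite -Hh -(@ge0_integral_full _ _ _ P D (fun x => (H x)%:E))//.
  exact/measurable_EFinP.
rewrite (@ge0_integral_full _ _ _ P D (fun x => (f x)%:E))//; last exact/measurable_EFinP.
have h0 : 0 <= h by rewrite -lee_fin -HD; apply: integral_ge0 => x _; rewrite lee_fin.
have lin (g : T -> R) e : measurable_fun D g -> (forall x, 0 <= g x) -> 0 <= e ->
    (\int[P]_(x in D) (g x + e * H x)%:E = \int[P]_(x in D) (g x)%:E + (e * h)%:E)%E.
  move=> mg g0 e0; rewrite EFinM -HD -ge0_integralZl//; last 2 first.
  - exact/measurable_EFinP.
  - by move=> x _; rewrite lee_fin.
  rewrite -ge0_integralD//.
  - by move=> x _; rewrite lee_fin.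
  - exact/measurable_EFinP.
  - by move=> x _; rewrite mule_ge0// lee_fin.
  - by under eq_fun do rewrite -EFinM; apply/measurable_EFinP; exact: measurable_funM.
have [k0|k0] := leP 0 k.
  rewrite EFinB leeBrDr// -lin// -[leRHS](Ec c)//; apply: ge0_le_integral => //.
  - by move=> x _; rewrite lee_fin addr_ge0// mulr_ge0.
  - by apply/measurable_EFinP; apply: measurable_funD => //; exact: measurable_funM.
have k1 : 0 <= - k by rewrite oppr_ge0 ltW.
rewrite -mulNr EFinD -[X in (_ <= X + _)%E](Ec c)// -(lin (cst c))//.
apply: ge0_le_integral => //.
- by move=> x _; rewrite lee_fin.
- exact/measurable_EFinP.
- by apply/measurable_EFinP; apply: measurable_funD => //; exact: measurable_funM.
- by move=> x Dx; rewrite lee_fin; have := fH x Dx; rewrite /= mulNr; lra.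
Qed.

(** The transition operator of the walk, with the coin averaged out. *)
Definition step_mean (R : realType) (alpha beta sigma : R -> R) (a b m gamma : R)
    (dB : measure_display) (OmegaB : measurableType dB) (PB : probability OmegaB R)
    (W : R -> OmegaB -> R) (F : R -> R -> R) (t x : R) : \bar R :=
  let u := brownian_exit_time W (spheroid_size alpha beta sigma a b m gamma t x) in
  let s w := next_time alpha sigma t (u w) in
  let y sgn w := next_pos alpha beta sigma a b m gamma sgn t x (u w) in
  (\int[PB]_w ((F (s w) (y 1 w) + F (s w) (y (- 1) w)) / 2)%:E)%E.

(** Heat kernel at intrinsic time [r] before the end of a block, scaled to take the terminal value
    exp(- y^2 / (2 V)) at [r = 0]. *)
Definition bump (R : realType) (V r y : R) : R := Num.sqrt V * heat (V + r) y.

Section bump_theory.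
Context {R : realType}.
Implicit Types V r y : R.

Lemma bump_ge0 V r y : 0 <= bump V r y.
Proof. by rewrite mulr_ge0 ?sqrtr_ge0 ?heat_ge0. Qed.

Lemma bumpE V r y : 0 < V -> 0 <= r ->
  bump V r y = (Num.sqrt (1 + r / V))^-1 * expR (- (y ^+ 2 / (2 * (V + r)))).
Proof.
move=> V0 r0; rewrite /bump /heat mulrA; congr (_ * _); last by rewrite mulNr.
rewrite gtr0_norm; last lra.
have -> : V + r = V * (1 + r / V) by field; rewrite gt_eqF.
rewrite sqrtrM ?(ltW V0)// invfM mulrA mulfV ?mul1r// gt_eqF// sqrtr_gt0//.
Qed.

Lemma bump_le1 V r y : 0 < V -> 0 <= r -> bump V r y <= 1.
Proof.
move=> V0 r0; rewrite bumpE// -[leRHS]mul1r; apply: ler_pM; rewrite ?invr_ge0 ?sqrtr_ge0 ?expR_ge0//.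
  by rewrite invf_le1 ?sqrtr_gt0; [rewrite -[leLHS]sqrtr1 ler_wsqrtr|]; rewrite ?lerDl ?ltr_pwDl ?divr_ge0 ?(ltW V0).
by rewrite -[leRHS]expR0 ler_expR oppr_le0 divr_ge0 ?sqr_ge0// mulr_ge0 ?addr_ge0 ?(ltW V0).
Qed.

Lemma bump0E V y : 0 < V -> bump V 0 y = expR (- (y ^+ 2 / (2 * V))).
Proof. by move=> V0; rewrite bumpE// mul0r addr0 sqrtr1 invr1 mul1r addr0. Qed.

Lemma sqr_far_centre (w z : R) : 0 < w -> `|z| <= w / 2 -> (2 * w) ^+ 2 <= (z - 5 / 2 * w) ^+ 2.
Proof.
move=> w0; rewrite ler_norml => /andP[h1 h2]; rewrite -[leRHS]sqrrN.
by apply: lerXn2r; rewrite ?nnegrE; lra.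
Qed.

(* Either the near bump is small, and then so is the minimum, or the point is
   close enough to the near centre for the far bump to be of order [expR (- A)]. *)
Lemma bump_dichotomy (A w r y : R) : 1 <= A -> 0 < w -> 15 * (w ^+ 2 / A) <= r ->
  Num.min (expR (A / 8) * bump (w ^+ 2 / A) r y)
    (1 + expR (- (2 * A)) - bump (w ^+ 2 / A) r (y - 5 / 2 * w)) <= 1 - expR (- A) / 2.
Proof.
move=> A1 w0; set V := w ^+ 2 / A => rV.
have A0 : 0 < A by lra.
have V0 : 0 < V by rewrite divr_gt0// exprn_gt0.
have r0 : 0 <= r by lra.
have eA : expR (- A) <= 1 by rewrite -[leRHS]expR0 ler_expR; lra.
set f1 := expR (A / 8) * bump V r y.
have [f1s|f1b] := leP f1 (1 / 2); first by rewrite ge_min; apply/orP; left; lra.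
rewrite ge_min; apply/orP; right.
have e2 : expR (- (2 * A)) <= expR (- A) / 2.
  have -> : - (2 * A) = - A + - A by ring.
  rewrite expRD ler_wpM2l ?expR_ge0// expRN lef_pV2 ?posrE ?expR_gt0//.
  have := expR_ge1Dx A; lra.
suff : expR (- A) <= bump V r (y - 5 / 2 * w) by lra.
(* The bound 15 V <= r makes S at least 4, which offsets the factor 1/4 below, and limits the cost
   of the shifted centre to 2 A / 5 in the exponent. The exponents A / 4 and 2 A / 5 add up to less
   than A. *)
pose S := Num.sqrt (1 + r / V).
have rV' : 15 <= r / V by rewrite ler_pdivlMr.
have S4 : 4 <= S.
  have -> : (4 : R) = Num.sqrt (4 ^+ 2) by rewrite sqrtr_sqr ger0_norm.
  by rewrite ler_wsqrtr//; lra.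
have S0 : 0 < S by lra.
have V1 : 0 < 2 * (V + r) by lra.
pose Q := y ^+ 2 / (2 * (V + r)).
have hQ : S / 2 * expR Q < expR (A / 8).
  move: f1b; rewrite /f1 bumpE// -/S -/Q expRN => h.
  have e0 := expR_gt0 Q.
  have : 1 / 2 * (S * expR Q) < expR (A / 8) * (S^-1 / expR Q) * (S * expR Q).
    by rewrite ltr_pM2r ?mulr_gt0.
  rewrite (_ : expR (A / 8) * (S^-1 / expR Q) * (S * expR Q) = expR (A / 8)); last by field; rewrite !gt_eqF.
  lra.
rewrite bumpE// -/S.
set Q' := (_ ^+ 2 / _).
have hQ' : Q' <= 2 * Q + 2 / 5 * A.
  have k1 : (y - 5 / 2 * w) ^+ 2 <= 2 * y ^+ 2 + 25 / 2 * w ^+ 2.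
    have := sqr_ge0 (y + 5 / 2 * w); nra.
  have -> : 2 * Q = 2 * y ^+ 2 / (2 * (V + r)) by rewrite /Q mulrA.
  apply: (@le_trans _ _ ((2 * y ^+ 2 + 25 / 2 * w ^+ 2) / (2 * (V + r)))).
    by rewrite ler_wpM2r// invr_ge0 ltW.
  rewrite mulrDl lerD2l ler_pdivrMr//.
  have -> : w ^+ 2 = A * V by rewrite /V; field; rewrite gt_eqF.
  have : A * (15 * V) <= A * r by rewrite ler_wpM2l// ltW.
  have := mulr_ge0 (ltW A0) (ltW V0); lra.
have h1 : expR (- (2 * Q)) * expR (- (2 / 5 * A)) <= expR (- Q').
  by rewrite -expRD ler_expR; lra.
have h2 : S ^+ 2 / 4 * expR (- (A / 4)) <= expR (- (2 * Q)).
  have : (S / 2 * expR Q) ^+ 2 <= expR (A / 8) ^+ 2.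
    by apply: lerXn2r; rewrite ?nnegrE ?expR_ge0 ?mulr_ge0 ?expR_ge0 ?(ltW hQ)//; lra.
  rewrite exprMn -!expRM_natl => h.
  have e1 : expR (2 * Q) * expR (- (2 * Q)) = 1 by rewrite -expRD subrr expR0.
  have e3 : expR (2 * (A / 8)) * expR (- (A / 4)) = 1.
    by rewrite -expRD (_ : _ + _ = 0) ?expR0//; lra.
  have : (S / 2) ^+ 2 * expR (2 * Q) * (expR (- (2 * Q)) * expR (- (A / 4))) <=
      expR (2 * (A / 8)) * (expR (- (2 * Q)) * expR (- (A / 4))).
    by rewrite ler_wpM2r// mulr_ge0 ?expR_ge0.
  rewrite (_ : (S / 2) ^+ 2 * expR (2 * Q) * (expR (- (2 * Q)) * expR (- (A / 4))) =
    S ^+ 2 / 4 * expR (- (A / 4)) * (expR (2 * Q) * expR (- (2 * Q)))); last by field.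
  rewrite (_ : expR (2 * (A / 8)) * (expR (- (2 * Q)) * expR (- (A / 4))) =
    expR (- (2 * Q)) * (expR (2 * (A / 8)) * expR (- (A / 4)))); last by ring.
  by rewrite e1 e3 !mulr1.
apply: (@le_trans _ _ (S^-1 * (S ^+ 2 / 4 * expR (- (A / 4)) * expR (- (2 / 5 * A))))); last first.
  rewrite ler_wpM2l ?invr_ge0 ?(ltW S0)//; apply: le_trans h1.
  by rewrite ler_wpM2r ?expR_ge0.
rewrite -[X in S^-1 * X]mulrA -expRD.
have -> : S^-1 * (S ^+ 2 / 4 * expR (- (A / 4) + - (2 / 5 * A))) =
   S / 4 * expR (- (A / 4) + - (2 / 5 * A)) by field; rewrite gt_eqF.
rewrite -[leLHS]mul1r; apply: ler_pM; rewrite ?expR_ge0//; first lra.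
by rewrite ler_expR; lra.
Qed.

End bump_theory.

Section barrier.
Context {R : realType}.
Variables alpha beta sigma : R -> R.
Hypotheses (calpha : {within `[0, +oo[, continuous alpha})
  (cbeta : {within `[0, +oo[, continuous beta})
  (csigma : {within `[0, +oo[, continuous sigma}).
Variables (a b m gamma s0 : R).
Hypotheses (hab : a < b) (hm : 0 < m) (hgamma : 0 < gamma < 1).
Hypotheses (s00 : 0 < s0) (hs : forall t, 0 <= t -> s0 <= sigma t).
Context (dB : measure_display) (OmegaB : measurableType dB)
  (PB : probability OmegaB R) (W : R -> OmegaB -> R).
Hypothesis hW : brownian_motion PB W.
Local Notation th := (theta alpha).
Local Notation rh := (rho alpha sigma).
Local Notation cd := (cdrift alpha beta).
Local Notation size := (spheroid_size alpha beta sigma a b m gamma).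
Local Notation smean := (step_mean alpha beta sigma a b m gamma PB W).
Implicit Types s t u v x y : R.

Section one_block.
Variables te A : R.
Hypotheses (te0 : 0 <= te) (A1 : 1 <= A).

Definition block_width := expR (th te) * (b - a).
Definition block_var := block_width ^+ 2 / A.
(* Displacement from the centre of the image of [(a, b)] at time [te]. *)
Definition block_pos t x := expR (th t) * (x - cd t) - expR (th te) * ((a + b) / 2 - cd te).

(* A supersolution for the walk before [te].  The first term is at least 1 on the
   image of [(a, b)] at time [te]; the second one, with centre outside of it, is
   also at least 1 there, and small where the first one is large. *)
Definition barrier t x : R :=
  if t < te then
    Num.min (expR (A / 8) * bump block_var (rh te - rh t) (block_pos t x))
      (1 + expR (- (2 * A)) - bump block_var (rh te - rh t) (block_pos t x - 5 / 2 * block_width))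
  else 1.

Lemma block_width_gt0 : 0 < block_width.
Proof. by rewrite mulr_gt0 ?expR_gt0 ?subr_gt0. Qed.

Let A0 : 0 < A := lt_le_trans ltr01 A1.

Lemma block_var_gt0 : 0 < block_var.
Proof. by rewrite divr_gt0 ?exprn_gt0 ?block_width_gt0. Qed.

Let V0 := block_var_gt0.
Let w0 := block_width_gt0.

Let gap_ge0 t : 0 <= t -> t <= te -> 0 <= rh te - rh t.
Proof. by move=> t0 tt; rewrite subr_ge0; exact: (rho_le calpha csigma s00 hs). Qed.

Lemma barrier_ge0 t x : 0 <= t -> 0 <= barrier t x.
Proof.
move=> t0; rewrite /barrier; case: ifPn => // tte; have g0 := gap_ge0 t0 (ltW tte).
rewrite le_min mulr_ge0 ?expR_ge0 ?bump_ge0//=.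
have := bump_le1 (block_pos t x - 5 / 2 * block_width) V0 g0.
have := expR_ge0 (- (2 * A)); lra.
Qed.

Lemma barrier_start t x : 0 <= t -> t < te -> 15 * block_var <= rh te - rh t ->
  barrier t x <= 1 - expR (- A) / 2.
Proof. by move=> t0 tte h; rewrite /barrier tte; exact: bump_dichotomy. Qed.

Lemma measurable_barrier d (T : measurableType d) (t x : T -> R) :
  measurable_fun setT t -> measurable_fun setT x ->
  measurable_fun setT (fun w => barrier (t w) (x w)).
Proof.
move=> mt mx.
have mth : measurable_fun setT th by exact: continuous_measurable_fun (continuous_theta calpha).
have mrh : measurable_fun setT rh by exact: continuous_measurable_fun (continuous_rho calpha csigma).
have mcd : measurable_fun setT cd by exact: continuous_measurable_fun (continuous_cdrift calpha cbeta).
have mp : measurable_fun setT (fun w => block_pos (t w) (x w)).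
  apply: measurable_funB => //; apply: measurable_funM.
    by apply: measurableT_comp => //; exact: measurableT_comp.
  by apply: measurable_funB => //; exact: measurableT_comp.
have mr : measurable_fun setT (fun w => block_var + (rh te - rh (t w))).
  by apply: measurable_funD => //; apply: measurable_funB => //; exact: measurableT_comp.
apply: measurable_fun_ifT => //; first exact: measurable_fun_ltr.
apply: measurable_minr.
  by apply: measurable_funM => //; apply: measurable_funM => //; exact: measurable_heat2.
apply: measurable_funB => //; apply: measurable_funM => //; apply: measurable_heat2 => //.
exact: measurable_funB.
Qed.

Let posE t x s y : block_pos s (flow alpha beta t x s y) = y + block_pos t x.
Proof.
have E : expR (th s) * expR (- th s) = 1 by rewrite -expRD subrr expR0.
have F : flow alpha beta t x s y - cd s = expR (- th s) * (y + expR (th t) * (x - cd t)).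
  exact: addrK.
have alg (p q c r z k : R) : p * q = 1 -> z - k = q * (y + r) -> p * (z - k) - c = y + (r - c).
  by move=> pq ->; rewrite mulrA pq mul1r addrA.
exact: (alg _ _ _ _ _ _ E F).
Qed.

Let pos_te x : a < x < b -> `|block_pos te x| <= block_width / 2.
Proof.
move=> /andP[ax xb].
have -> : block_pos te x = expR (th te) * (x - (a + b) / 2) by rewrite /block_pos; ring.
rewrite normrM (gtr0_norm (expR_gt0 _)) /block_width -mulrA ler_wpM2l ?expR_ge0//.
by rewrite ler_norml; apply/andP; split; lra.
Qed.

(** Each of the two terms of the minimum is treated alone. [exit_heat] with horizon rho(te) - rho(t)
    evaluates a bump exactly: an exit before the horizon lands before [te], and at the horizon the
    bump has its terminal value, to be compared with the constant 1 that the barrier equals from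
    [te] on. *)
Lemma step_mean_barrier t x : 0 <= t -> t < te -> a < x < b ->
  (smean barrier t x <= (barrier t x)%:E)%E.
Proof.
move=> t0 tte axb; rewrite /step_mean.
set d := size t x.
have d0 : 0 < d := spheroid_size_gt0 beta calpha csigma hm hgamma s00 hs t0 axb.
pose r := rh te - rh t; pose v := block_var + r.
have r0 : 0 < r by rewrite subr_gt0; exact: (rho_lt calpha csigma s00 hs).
have rv : r < v by rewrite ltrDr.
set tau := brownian_exit_time W d.
have mtau : measurable_fun setT tau.
  have mp : measurable_fun setT (fun w : OmegaB => (d, w)) by exact: measurable_fun_pair.
  exact: (measurableT_comp (measurable_brownian_exit_time hW) mp).
pose s w := next_time alpha sigma t (tau w).
pose y sgn w := next_pos alpha beta sigma a b m gamma sgn t x (tau w).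
have ms : measurable_fun setT s by exact: (measurable_next_time calpha csigma s00 hs).
have my sgn : measurable_fun setT (y sgn).
  exact: (measurable_next_pos calpha cbeta csigma a b gamma hm s00 hs (sgn := cst sgn) (t := cst t) (x := cst x)).
pose H z w := if tau w < r then heat (v - tau w) (psi d (tau w) - z)
    + heat (v - tau w) (- psi d (tau w) - z)
  else heat (v - r) (W r w - z) + heat (v - r) (- W r w - z).
have mH z : measurable_fun setT (H z).
  have mps : measurable_fun setT (fun w => psi d (tau w)) by exact: (measurable_psi (D := cst d)).
  have mWr : measurable_fun setT (W r) by apply: (bm_measurable hW); exact: ltW.
  have mvt : measurable_fun setT (fun w => v - tau w) by exact: measurable_funB.
  apply: measurable_fun_ifT; first exact: measurable_fun_ltr.
    by apply: measurable_funD; apply: measurable_heat2 => //; apply: measurable_funB => //; exact: measurableT_comp.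
  by apply: measurable_funD; apply: measurable_heat2 => //; apply: measurable_funB => //; exact: measurableT_comp.
have H0 z w : 0 <= H z w by rewrite /H; case: ifP => _; rewrite addr_ge0 ?heat_ge0.
have EH z : (\int[PB]_w (H z w)%:E = (2 * heat v z)%:E)%E by exact: exit_heat.
pose f w := (barrier (s w) (y 1 w) + barrier (s w) (y (- 1) w)) / 2.
have s_ge0 w : 0 <= s w by exact: rho_inv_ge0.
have f0 w : 0 <= f w by rewrite divr_ge0// addr_ge0// barrier_ge0.
have mf : measurable_fun setT f.
  by apply: measurable_funM => //; apply: measurable_funD; exact: measurable_barrier.
have [G [mG PG hG]] := exit_good hW d0.
have sV0 : 0 <= Num.sqrt block_var by exact: sqrtr_ge0.
pose p := block_pos t x; pose p' := p - 5 / 2 * block_width.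
have key w : G w ->
   f w + - (expR (A / 8) * Num.sqrt block_var / 2) * H (- p) w <= 0 /\
   f w + Num.sqrt block_var / 2 * H (- p') w <= 1 + expR (- (2 * A)).
  move=> Gw; have [td Wd] := hG w Gw.
  have tau0 : 0 <= tau w by exact: brownian_exit_time_ge0.
  have [s1 [ts sm rs es hx]] := next_step calpha csigma hm hgamma s00 hs t0 axb tau0 td.
  have sE : s w = s1 by exact: es.
  have yE sgn : y sgn w = flow alpha beta t x s1 (sgn * psi d (tau w)) := hx sgn.
  rewrite /f sE !yE mul1r mulN1r /barrier !posE -/p /H.
  have s1_ge0 : 0 <= s1 by exact: le_trans ts.
  have [tr|rt] := ltP (tau w) r.
    have ste : s1 < te.
      apply: (@rho_lt_inv _ _ _ calpha csigma _ s00 hs) => //.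
      by rewrite rs -ltrBrDr.
    rewrite ste rs.
    have -> : rh te - (tau w + rh t) = r - tau w by rewrite /r; ring.
    have -> : v - tau w = block_var + (r - tau w) by rewrite /v; ring.
    rewrite /bump !(opprK p) !(opprK p').
    have -> : psi d (tau w) + p - 5 / 2 * block_width = psi d (tau w) + p' by exact/esym/addrA.
    have -> : - psi d (tau w) + p - 5 / 2 * block_width = - psi d (tau w) + p' by exact/esym/addrA.
    set h1 := heat _ (psi d (tau w) + p); set h2 := heat _ (- psi d (tau w) + p).
    set h3 := heat _ (psi d (tau w) + p'); set h4 := heat _ (- psi d (tau w) + p').
    set e1 := expR (A / 8); set e2 := expR (- (2 * A)).
    set SV := Num.sqrt block_var.
    set m1 := Num.min _ _; set m2 := Num.min _ _.
    have a1 : m1 <= e1 * (SV * h1) by rewrite ge_min lexx.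
    have a2 : m1 <= 1 + e2 - SV * h3 by rewrite ge_min lexx orbT.
    have a3 : m2 <= e1 * (SV * h2) by rewrite ge_min lexx.
    have a4 : m2 <= 1 + e2 - SV * h4 by rewrite ge_min lexx orbT.
    by move: a1 a2 a3 a4; clear; split; lra.
  have ste : te <= s1.
    rewrite leNgt; apply/negP => /(rho_lt calpha csigma s00 hs s1_ge0).
    rewrite rs; move: rt; rewrite /r; lra.
  rewrite ltNge ste /= [v - r](_ : _ = block_var); last by rewrite /v; ring.
  (* A path still in the spheroid at the horizon corresponds, by confinement, to a point of (a, b)
     at time [te]; this covers both [W r] and its opposite. *)
  have hc z : `|z| <= psi d r -> `|z + p| <= block_width / 2.
    move=> hz; rewrite -(posE t x te z); apply: pos_te.
    apply: (proj1 (confined_in hgamma axb _)).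
    apply: (flow_confined calpha cbeta csigma hm hgamma s00 hs) => //; first exact: ltW.
      by rewrite -lerBlDr; exact: le_trans td.
    by apply: (le_trans hz); exact: psi_bound.
  have hW1 := Wd r r0 rt.
  have b1 := hc _ hW1; have b2 : `|- W r w + p| <= block_width / 2 by apply: hc; rewrite normrN.
  rewrite !(opprK p) !(opprK p').
  have hb z : Num.sqrt block_var * heat block_var z = expR (- (z ^+ 2 / (2 * block_var))).
    by rewrite -bump0E// /bump addr0.
  have V2 : 0 < 2 * block_var by apply: mulr_gt0 => //; exact: V0.
  (* The constants of the barrier match here: the Gaussian exponent is A / 8 at distance w / 2 and 2
     A at distance 2 w, for w the block width. *)
  have n1 z : `|z| <= block_width / 2 -> 1 <= expR (A / 8) * (Num.sqrt block_var * heat block_var z).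
    move=> hz; rewrite hb -expRD -[leLHS]expR0 ler_expR subr_ge0.
    rewrite ler_pdivrMr//.
    have -> : A / 8 * (2 * block_var) = (block_width / 2) ^+ 2.
      by rewrite /block_var; field; rewrite gt_eqF.
    by rewrite -[leLHS]real_normK ?num_real//; apply: lerXn2r; rewrite ?nnegrE// (le_trans _ hz).
  have n2 z : `|z| <= block_width / 2 ->
      Num.sqrt block_var * heat block_var (z - 5 / 2 * block_width) <= expR (- (2 * A)).
    move=> hz; rewrite hb ler_expR lerN2 ler_pdivlMr//.
    have -> : 2 * A * (2 * block_var) = (2 * block_width) ^+ 2.
      by rewrite /block_var; field; rewrite gt_eqF.
    exact: sqr_far_centre.
  have {}n1a := n1 _ b1; have {}n1b := n1 _ b2.
  have n2a := n2 _ b1; have n2b := n2 _ b2.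
  have pE z : z + p' = z + p - 5 / 2 * block_width by exact: addrA.
  rewrite !pE; split; lra.
rewrite [X in (X <= _)%E](_ : _ = \int[PB]_w (f w)%:E)%E//.
rewrite /barrier tte -/r -/p -/p' EFin_min le_min; apply/andP; split.
  have := integral_le_affine mG PG mf (mH (- p)) f0 (H0 (- p)) (fun w Gw => (key w Gw).1) (EH (- p)) (lexx 0).
  move=> /le_trans; apply; rewrite lee_fin heatN /bump -/v; lra.
have c0 : 0 <= 1 + expR (- (2 * A)) by rewrite addr_ge0 ?expR_ge0.
have := integral_le_affine mG PG mf (mH (- p')) f0 (H0 (- p')) (fun w Gw => (key w Gw).2) (EH (- p')) c0.
move=> /le_trans; apply; rewrite lee_fin heatN /bump -/v; lra.
Qed.

End one_block.
End barrier.

(** * Intrinsic length of a block and mean increase of the Lyapunov function *)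

Lemma integral_ge_affine d (T : measurableType d) (R : realType)
    (P : probability T R) (D : set T) (f H : T -> R) (k L M h : R) :
  measurable D -> P (~` D) = 0 -> measurable_fun setT f -> measurable_fun setT H ->
  (forall w, 0 <= f w) -> (forall w, 0 <= H w) -> 0 <= k -> 0 <= L -> 0 <= M ->
  (forall w, D w -> L + k * H w <= f w + M) ->
  (h%:E <= \int[P]_w (H w)%:E)%E ->
  ((L - M + k * h)%:E <= \int[P]_w (f w)%:E)%E.
Proof.
move=> mD PD mf mH f0 H0 k0 L0 M0 fH Hh.
have mfD : measurable_fun D f by exact: measurable_funTS.
have mHD : measurable_fun D H by exact: measurable_funTS.
have Ec (e : R) : 0 <= e -> (\int[P]_(x in D) e%:E = e%:E)%E.
  move=> e0; rewrite -(@ge0_integral_full _ _ _ P D (fun=> e%:E))//.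
  by rewrite integral_cst//= probability_setT mule1.
have mfull (g : T -> R) : measurable_fun setT g -> (forall w, 0 <= g w) ->
    (\int[P]_w (g w)%:E = \int[P]_(w in D) (g w)%:E)%E.
  move=> mg g0; rewrite (@ge0_integral_full _ _ _ P D (fun x => (g x)%:E))//.
  exact/measurable_EFinP.
rewrite mfull// in Hh; rewrite mfull//.
have key : (\int[P]_(x in D) (L + k * H x)%:E <= \int[P]_(x in D) (f x + M)%:E)%E.
  apply: ge0_le_integral => //.
  - by move=> x _; rewrite lee_fin addr_ge0// mulr_ge0.
  - by apply/measurable_EFinP; apply: measurable_funD => //; exact: measurable_funM.
  - by apply/measurable_EFinP; apply: measurable_funD => //.
have e1 : (\int[P]_(x in D) (f x + M)%:E = \int[P]_(x in D) (f x)%:E + M%:E)%E.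
  rewrite -{1}(Ec M)// -ge0_integralD//; first by move=> x _; rewrite lee_fin.
  exact/measurable_EFinP.
have e2 : (\int[P]_(x in D) (L + k * H x)%:E = L%:E + k%:E * \int[P]_(x in D) (H x)%:E)%E.
  rewrite -ge0_integralZl//; last 2 first.
  - exact/measurable_EFinP.
  - by move=> x _; rewrite lee_fin.
  rewrite -{1}(Ec L)// -ge0_integralD//; first by move=> x _; rewrite mule_ge0// lee_fin.
  by under eq_fun do rewrite -EFinM; apply/measurable_EFinP; exact: measurable_funM.
move: key; rewrite e1 e2 => key.
have -> : L - M + k * h = L + k * h - M by ring.
rewrite EFinB leeBlDr// EFinD EFinM; apply: le_trans key.
by apply: leeD => //; apply: lee_wpmul2l => //; rewrite lee_fin.
Qed.

Section lyapunov_drift.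
Context {R : realType}.
Variables alpha beta sigma : R -> R.
Hypotheses (calpha : {within `[0, +oo[, continuous alpha})
  (cbeta : {within `[0, +oo[, continuous beta})
  (csigma : {within `[0, +oo[, continuous sigma}).
Variables (a b m gamma s0 : R).
Hypotheses (hab : a < b) (hm : 0 < m) (hgamma : 0 < gamma < 1).
Hypotheses (s00 : 0 < s0) (hs : forall t, 0 <= t -> s0 <= sigma t).
Context (dB : measure_display) (OmegaB : measurableType dB)
  (PB : probability OmegaB R) (W : R -> OmegaB -> R).
Hypothesis hW : brownian_motion PB W.
Local Notation th := (theta alpha).
Local Notation rh := (rho alpha sigma).
Local Notation size := (spheroid_size alpha beta sigma a b m gamma).
Local Notation smean := (step_mean alpha beta sigma a b m gamma PB W).

(** Over the last 1 / (1 + K) time units the integral of |alpha| is at most 1, so [rho] gains at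
    least s0^2 e^(-4) e^(2 theta(te)) / (1 + K). The factor e^(2 theta(te)) also appears in
    [block_var] and cancels, so an [A] of the order of 1 + K suffices. *)
Lemma block_gap (te K A t : R) : 0 <= K -> (1 + K)^-1 <= te ->
  (forall s, 0 <= s -> te - (1 + K)^-1 <= s <= te -> `|alpha s| <= K) ->
  0 < A -> 15 * (b - a) ^+ 2 * expR 1 ^+ 4 * (1 + K) / s0 ^+ 2 <= A ->
  0 <= t -> t <= te - (1 + K)^-1 ->
  15 * block_var alpha a b te A <= rh te - rh t.
Proof.
move=> K0; set h := (1 + K)^-1; have K1 : 0 < 1 + K by lra.
have h0 : 0 < h by rewrite invr_gt0.
move=> hte hK A0 hA t0 tt; set u := te - h.
have u0 : 0 <= u by rewrite subr_ge0.
have ute : u <= te by rewrite gerBl ltW.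
have te0 : 0 <= te by exact: le_trans ute.
have rtu : rh t <= rh u by exact: (rho_le calpha csigma s00 hs).
suff : 15 * block_var alpha a b te A <= rh te - rh u by lra.
have := rho_lower calpha csigma s00 hs u0 ute.
rewrite (_ : te - u = h); last by rewrite /u; ring.
set g := growth alpha u te => /(le_trans _); apply.
have g0 : 0 < g := growth_gt0 _ _ _.
have ca : {within `[0, +oo[, continuous (fun s => `|alpha s|)}.
  by move=> s; apply: cvg_norm; exact: calpha.
have gint : \int[lebesgue_measure]_(s in `[u, te]) `|alpha s| <= 1.
  apply: (@le_trans _ _ (K * (te - u))).
    apply: Rintegral_le_cst => // s /andP[us st]; apply: hK; first exact: le_trans us.
    by rewrite us st.
  rewrite (_ : te - u = h); last by rewrite /u; ring.
  by rewrite ler_pdivrMr// mul1r; lra.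
have ge : g <= expR 1 by rewrite ler_expR.
have osc : expR (th te) <= g * expR (th u).
  rewrite -expRD ler_expR; have := theta_osc calpha u0 ute (lexx te).
  by rewrite ler_norml => /andP[]; lra.
have e0 := expR_gt0 (1 : R); have eu := expR_gt0 (th u); have et := expR_gt0 (th te).
set S := s0 ^+ 2 in hA *; have S0 : 0 < S by rewrite exprn_gt0.
have Sh0 : 0 <= S / expR 1 ^+ 4 * h.
  apply: mulr_ge0; last exact: ltW.
  by apply: divr_ge0; [exact: ltW|rewrite exprn_ge0// ltW].
apply: (@le_trans _ _ (S / expR 1 ^+ 4 * h * expR (th te) ^+ 2)).
  rewrite /block_var /block_width.
  have -> : 15 * ((expR (th te) * (b - a)) ^+ 2 / A) =
     15 * (b - a) ^+ 2 / A * expR (th te) ^+ 2 by rewrite exprMn; ring.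
  rewrite ler_wpM2r ?sqr_ge0// ler_pdivrMr//.
  have : 15 * (b - a) ^+ 2 * expR 1 ^+ 4 * (1 + K) / S * (S / expR 1 ^+ 4 * h) <= A * (S / expR 1 ^+ 4 * h).
    by rewrite ler_wpM2r.
  rewrite (_ : 15 * (b - a) ^+ 2 * expR 1 ^+ 4 * (1 + K) / S * (S / expR 1 ^+ 4 * h) = 15 * (b - a) ^+ 2).
    by rewrite [A * _]mulrC.
  by rewrite /h; field; rewrite !gt_eqF.
apply: (@le_trans _ _ (S / expR 1 ^+ 4 * h * (g * expR (th u)) ^+ 2)).
  by rewrite ler_wpM2l//; apply: lerXn2r; rewrite ?nnegrE ?mulr_ge0 ?expR_ge0 ?(ltW g0).
have -> : S / expR 1 ^+ 4 * h * (g * expR (th u)) ^+ 2 =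
  S * h * expR (th u) ^+ 2 * (g ^+ 2 / expR 1 ^+ 4) by ring.
have -> : S / g ^+ 2 * expR (th u) ^+ 2 * h = S * h * expR (th u) ^+ 2 * (g ^+ 2)^-1 by ring.
apply: ler_wpM2l; first by apply: mulr_ge0; [apply: mulr_ge0; exact: ltW|exact: sqr_ge0].
rewrite ler_pdivrMr ?exprn_gt0//.
have -> : (g ^+ 2)^-1 * expR 1 ^+ 4 = expR 1 ^+ 4 / g ^+ 4 * g ^+ 2 by field; rewrite gt_eqF.
rewrite ler_peMl ?sqr_ge0// ler_pdivlMr ?exprn_gt0// mul1r.
by apply: lerXn2r; rewrite ?nnegrE ?expR_ge0 ?(ltW g0).
Qed.

Variables (Cg B : R).
Hypotheses (Cg0 : 0 < Cg) (hsg : forall t, 0 <= t -> sigma t <= Cg * (1 + t))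
  (hgr : forall t, 0 <= t -> growth alpha t (t + m) <= Cg * (1 + t))
  (B0 : 0 < B) (hB : forall t x r, 0 <= t -> a < x < b -> t <= r <= t + m ->
    `|beta r + x * alpha r| <= B * (1 + t)).

(** Truncated because [walk_mean] takes functions nonnegative on the whole plane; for [0 <= K],
    [0 <= t] and x in (a, b) the truncation changes nothing. *)
Definition lyapunov0 (K t x : R) := Num.max (lyapunov a b K t x) 0.

Lemma measurable_lyapunov0 (K : R) d (T : measurableType d) (t x : T -> R) :
  measurable_fun setT t -> measurable_fun setT x ->
  measurable_fun setT (fun w => lyapunov0 K (t w) (x w)).
Proof.
move=> mt mx; apply: measurable_maxr => //.
apply: measurable_funD.
  apply: measurable_funB.
    apply: measurable_funB => //; apply: (measurableT_comp (@measurable_ln R)).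
    exact: measurable_funB.
  by apply: (measurableT_comp (@measurable_ln R)); exact: measurable_funB.
by apply: measurable_funM => //; apply: measurable_funX; exact: measurable_funD.
Qed.

(** [lyapunov_step] averaged over the exit law. By [spheroid_size_lower], e^(-theta(t)) size / ((1 +
    t) dist) is at least c1 / (1 + t)^3 however close the boundary is; its square gives the power
    6. *)
Lemma step_mean_lyapunov : exists K c : R, [/\ 0 < K, 0 < c &
  forall t x, 0 <= t -> a < x < b ->
    ((lyapunov a b K t x + c / (1 + t) ^+ 6)%:E <= smean (lyapunov0 K) t x)%E].
Proof.
have [k k0 hk] := exit_moments hW.
have [K [c [K0 c0 step]]] := lyapunov_step calpha cbeta csigma hm hgamma s00 hs Cg0 hsg hgr B0 hB k0.
have [c1 c10 sz] := spheroid_size_lower calpha cbeta csigma hab hm hgamma s00 hs Cg0 hgr B0 hB.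
exists K, (c * (k / 2) * c1 ^+ 2); split => //; first by rewrite !mulr_gt0// exprn_gt0.
move=> t x t0 axb; rewrite /step_mean.
have dpos := spheroid_size_gt0 beta calpha csigma hm hgamma s00 hs t0 axb.
have szl := sz t x t0 axb; have stepl := step t x _ t0 axb.
set d := size t x in dpos szl stepl *.
set tau := brownian_exit_time W d.
have mtau : measurable_fun setT tau.
  have mp : measurable_fun setT (fun w : OmegaB => (d, w)) by exact: measurable_fun_pair.
  exact: (measurableT_comp (measurable_brownian_exit_time hW) mp).
pose s w := next_time alpha sigma t (tau w).
pose y sgn w := next_pos alpha beta sigma a b m gamma sgn t x (tau w).
have ms : measurable_fun setT s by exact: (measurable_next_time calpha csigma s00 hs).
have my sgn : measurable_fun setT (y sgn).
  exact: (measurable_next_pos calpha cbeta csigma a b gamma hm s00 hs (sgn := cst sgn) (t := cst t) (x := cst x)).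
pose f w := (lyapunov0 K (s w) (y 1 w) + lyapunov0 K (s w) (y (- 1) w)) / 2.
have f0 w : 0 <= f w by rewrite divr_ge0// addr_ge0// le_max lexx orbT.
have mf : measurable_fun setT f.
  by apply: measurable_funM => //; apply: measurable_funD; exact: measurable_lyapunov0.
have mp : measurable_fun setT (fun w => psi d (tau w)) by exact: (measurable_psi (D := cst d)).
have mH : measurable_fun setT (fun w => psi d (tau w) ^+ 2) by exact: measurable_funX.
have [G [mG PG hG]] := exit_good hW dpos.
have l0 : 0 < 1 + t by lra.
have dl0 := wall_dist_gt0 axb.
set z := expR (- th t) / ((1 + t) * wall_dist a b x) in stepl.
have L0 : 0 <= lyapunov a b K t x.
  rewrite addr_ge0 ?wall_potential_ge0// mulr_ge0 ?exprn_ge0 ?(ltW K0) ?(ltW l0)//.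
have k1 : 0 <= c * z ^+ 2 by apply: mulr_ge0; [exact: ltW|exact: sqr_ge0].
have M0 : 0 <= c * (k / 2) * z ^+ 2 * d ^+ 2.
  apply: mulr_ge0; last exact: sqr_ge0.
  apply: mulr_ge0; last exact: sqr_ge0.
  by apply: mulr_ge0; [exact: ltW|rewrite divr_ge0// ltW].
have key w : G w -> lyapunov a b K t x + c * z ^+ 2 * psi d (tau w) ^+ 2 <=
    f w + c * (k / 2) * z ^+ 2 * d ^+ 2.
  move=> Gw; have [td _] := hG w Gw.
  apply: (le_trans (stepl _ (brownian_exit_time_ge0 _ _ _) td)).
  rewrite lerD2r ler_wpM2r//; apply: lerD; by rewrite le_max lexx.
have := integral_ge_affine mG PG mf mH f0 (fun w => sqr_ge0 _) k1 L0 M0 key (hk d dpos).2.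
apply: le_trans; rewrite lee_fin.
have hz : c1 ^+ 2 / (1 + t) ^+ 6 <= (z * d) ^+ 2.
  have -> : c1 ^+ 2 / (1 + t) ^+ 6 = (c1 * wall_dist a b x / (1 + t) ^+ 2 / ((1 + t) * wall_dist a b x)) ^+ 2.
    by field; rewrite !gt_eqF.
  have n0 : 0 <= c1 * wall_dist a b x / (1 + t) ^+ 2 by rewrite divr_ge0 ?sqr_ge0// mulr_ge0// ltW.
  have n1 : 0 < (1 + t) * wall_dist a b x by rewrite mulr_gt0.
  have -> : z * d = expR (- th t) * d / ((1 + t) * wall_dist a b x) by rewrite /z mulrAC.
  apply: lerXn2r; rewrite ?nnegrE.
  - by apply: divr_ge0 => //; exact: ltW.
  - by apply: divr_ge0; [rewrite mulr_ge0 ?expR_ge0// ltW|exact: ltW].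
  by rewrite ler_wpM2r// invr_ge0 ltW.
have : c * (k / 2) * (c1 ^+ 2 / (1 + t) ^+ 6) <= c * (k / 2) * (z * d) ^+ 2.
  by apply: ler_wpM2l => //; apply: mulr_ge0; [exact: ltW|rewrite divr_ge0// ltW].
rewrite exprMn; lra.
Qed.

End lyapunov_drift.

(** * The walk *)

Section walk.
Context {R : realType}.
Variables alpha beta sigma : R -> R.
Hypotheses (calpha : {within `[0, +oo[, continuous alpha})
  (cbeta : {within `[0, +oo[, continuous beta})
  (csigma : {within `[0, +oo[, continuous sigma}).
Variables (a b x0 m gamma s0 : R).
Hypotheses (hab : a < b) (hx0 : a < x0 < b) (hm : 0 < m) (hgamma : 0 < gamma < 1).
Hypotheses (s00 : 0 < s0) (hs : forall t, 0 <= t -> s0 <= sigma t).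
Context (dB : measure_display) (OmegaB : measurableType dB)
  (PB : probability OmegaB R) (W : R -> OmegaB -> R).
Hypothesis hW : brownian_motion PB W.
Context (d : measure_display) (Omega : measurableType d) (P : probability Omega R)
  (tau : nat -> Omega -> R) (coin : nat -> Omega -> bool) (T X : nat -> Omega -> R).
Hypothesis hwalk : walk_on_spheroids alpha beta sigma a b x0 m gamma PB W P tau coin T X.
Local Notation size := (spheroid_size alpha beta sigma a b m gamma).
Local Notation smean := (step_mean alpha beta sigma a b m gamma PB W).
Local Notation nt := (next_time alpha sigma).
Local Notation np := (next_pos alpha beta sigma a b m gamma).

Lemma walk_timeE n w : T n.+1 w = nt (T n w) (tau n.+1 w).
Proof. by rewrite (ws_T hwalk) /= addrC subrK. Qed.

Lemma walk_posE n w :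
  X n.+1 w = np (if coin n.+1 w then 1 else -1) (T n w) (X n w) (tau n.+1 w).
Proof. by rewrite (ws_X hwalk). Qed.

Lemma walk_time_ge0 n w : 0 <= T n w.
Proof. by case: n => [|n]; [rewrite (ws_T0 hwalk)|rewrite walk_timeE rho_inv_ge0]. Qed.

Let HT n := [set A | exists (k : nat) (B : set R), [/\ (k <= n)%N, measurable B &
                 A = T k @^-1` B \/ A = X k @^-1` B]].

Lemma history_measurable n A : history T X n A -> measurable A.
Proof.
move: A; apply: smallest_sub; first exact: sigma_algebra_measurable.
move=> A [k [B [_ mB [->|->]]]]; rewrite -[X in measurable X]setTI.
- exact: (ws_T_measurable hwalk).
- exact: (ws_X_measurable hwalk).
Qed.

Lemma history_mono n A : history T X n A -> history T X n.+1 A.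
Proof.
apply: sub_sigma_algebra2 => B [k [C [kn mC h]]]; exists k, C; split => //.
exact: leqW.
Qed.

Lemma history_setT n : history T X n setT.
Proof. exact: (@measurableT _ (g_sigma_algebraType (HT n))). Qed.

Lemma history_setI n A B : history T X n A -> history T X n B -> history T X n (A `&` B).
Proof. exact: (@measurableI _ (g_sigma_algebraType (HT n))). Qed.

Lemma history_setC n A : history T X n A -> history T X n (~` A).
Proof. exact: (@measurableC _ (g_sigma_algebraType (HT n))). Qed.

Lemma history_state n (C : set (R * R)) : measurable C ->
  history T X n [set w | C (T n w, X n w)].
Proof.
move=> mC.
have mY : @measurable_fun _ _ (g_sigma_algebraType (HT n)) (R * R)%type setT (fun w => (T n w, X n w)).
  apply: measurable_fun_pair => _ B mB; rewrite setTI; apply: sub_sigma_algebra; exists n, B; split => //.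
  - by left.
  - by right.
by have := mY measurableT C mC; rewrite setTI.
Qed.

Let Y n w := (T n w, X n w).

Let mY n : measurable_fun setT (Y n).
Proof. by apply: measurable_fun_pair; [exact: (ws_T_measurable hwalk)|exact: (ws_X_measurable hwalk)]. Qed.

(** The time is clipped at 0 to get a measurable map on the whole plane; the times of the walk are
    nonnegative, so the clipping has no effect on it. *)
Let exitlaw (y : R * R) (w : OmegaB) := brownian_exit_time W (size (Num.max y.1 0) y.2) w.

Let msize : measurable_fun setT (fun y : R * R => size (Num.max y.1 0) y.2).
Proof.
apply: (measurable_spheroid_size calpha cbeta csigma a b gamma hm s00 hs) => //.
  exact: measurable_maxr.
by move=> w; rewrite le_max lexx orbT.
Qed.

Let mexit : measurable_fun setT (fun z : (R * R) * OmegaB => exitlaw z.1 z.2).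
Proof.
have m1 : measurable_fun setT (fun z : (R * R) * OmegaB => (size (Num.max z.1.1 0) z.1.2, z.2)).
  apply: measurable_fun_pair => //.
  exact: (measurableT_comp msize).
exact: (measurableT_comp (measurable_brownian_exit_time hW) m1).
Qed.

Let exitlawE n w v : exitlaw (Y n w) v = brownian_exit_time W (size (T n w) (X n w)) v.
Proof. by rewrite /exitlaw /= max_l// walk_time_ge0. Qed.

Let mcoin n c : measurable [set w | coin n w = c].
Proof.
have := ws_coin_measurable hwalk n => /(_ measurableT [set c]).
by rewrite setTI; apply.
Qed.

Let half_ge0 : 0 <= 2^-1 :> R. Proof. by rewrite invr_ge0. Qed.

(** [ws_law] with [B = setT]: the coin is independent of the past. *)
Lemma coin_half n (A : set Omega) c (g : R * R -> \bar R) : history T X n A ->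
  measurable_fun setT g -> (forall y, 0 <= g y)%E ->
  (\int[P]_(w in A `&` [set w | coin n.+1 w = c]) g (T n w, X n w) =
   2^-1%:E * \int[P]_(w in A) g (T n w, X n w))%E.
Proof.
move=> hA mg g0; have mA := history_measurable hA.
have mE : measurable (A `&` [set w | coin n.+1 w = c]) by exact: measurableI.
have mgY : measurable_fun setT (g \o Y n) by exact: (measurableT_comp mg).
transitivity (\int[mrestr P mE]_w (g \o Y n) w)%E.
  by rewrite integral_mrestr// => w; exact: g0.
rewrite -[LHS](_ : \int[pushforward (mrestr P mE) (Y n)]_y g y = _)%E; last first.
  by rewrite ge0_integral_pushforward// preimage_setT.
transitivity (\int[pushforward (mscale (NngNum half_ge0) (mrestr P mA)) (Y n)]_y g y)%E.
  apply: eq_measure_integral => C mC _.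
  have hC := @history_state n C mC.
  have := ws_law hwalk (A := A `&` [set w | C (T n w, X n w)]) (B := setT) c
    (history_setI hA hC) measurableT.
  rewrite preimage_setT setIT /brownian_exit_law.
  under eq_integral do rewrite preimage_setT probability_setT.
  rewrite integral_cst ?mul1e; last exact: history_measurable (history_setI hA hC).
  move=> h; transitivity (P (A `&` [set w | C (T n w, X n w)] `&` [set w | coin n.+1 w = c])).
    by rewrite /pushforward /= /mrestr; congr (P _); apply/seteqP; split => w /=; tauto.
  by rewrite h /mscale /= /pushforward /mrestr /=; congr (_ * P _)%E; rewrite setIC.
rewrite ge0_integral_pushforward// preimage_setT ge0_integral_mscale//; last first.
  by move=> w _; exact: g0.
congr (_ * _)%E; rewrite integral_mrestr//.
by move=> w; exact: g0.
Qed.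

Let exit_mean (f : (R * R) * R -> \bar R) (y : R * R) := (\int[PB]_v f (y, exitlaw y v))%E.

Let mexit_mean f : measurable_fun setT f -> (forall z, 0 <= f z)%E ->
  measurable_fun setT (exit_mean f).
Proof.
move=> mf f0.
have mz : measurable_fun setT (fun z : (R * R) * OmegaB => f (z.1, exitlaw z.1 z.2)).
  by apply: (measurableT_comp mf); exact: measurable_fun_pair.
exact: (measurable_fun_fubini_tonelli_F (m2 := PB) _ mz (fun=> f0 _)).
Qed.

Let exit_mean_ge0 f : (forall z, 0 <= f z)%E -> forall y, (0 <= exit_mean f y)%E.
Proof. by move=> f0 y; apply: integral_ge0 => v _. Qed.

Let exit_meanE f n w : exit_mean f (Y n w) = (\int[PB]_v
     f ((T n w, X n w), brownian_exit_time W (size (T n w) (X n w)) v))%E.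
Proof. by apply: eq_integral => v _; rewrite exitlawE. Qed.

(** [joint_law] on the event [A] with the coin fixed. The source of randomness becomes the auxiliary
    space of [W], so the identities at the Brownian exit time transfer to the walk. *)
Lemma walk_law n (A : set Omega) c (f : (R * R) * R -> \bar R) : history T X n A ->
  measurable_fun setT f -> (forall z, 0 <= f z)%E ->
  (\int[P]_(w in A `&` [set w | coin n.+1 w = c]) f ((T n w, X n w), tau n.+1 w) =
   2^-1%:E * \int[P]_(w in A) \int[PB]_v
     f ((T n w, X n w), brownian_exit_time W (size (T n w) (X n w)) v))%E.
Proof.
move=> hA mf f0; have mA := history_measurable hA.
have mE : measurable (A `&` [set w | coin n.+1 w = c]) by exact: measurableI.
rewrite (joint_law (Y := Y n) (V := tau n.+1) (Z := fun z => exitlaw z.1 z.2) (PB := PB) mE _ _ _ _ mf f0)//.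
- transitivity (\int[P]_(w in A `&` [set w | coin n.+1 w = c]) exit_mean f (T n w, X n w))%E.
    by [].
  rewrite (@coin_half n A c (exit_mean f) hA (mexit_mean mf f0) (exit_mean_ge0 f0)).
  apply: (f_equal (fun z => 2^-1%:E * z)%E); apply: eq_integral => w _.
  by rewrite -[(T n w, X n w)]/(Y n w) exit_meanE.
- exact: (ws_tau_measurable hwalk).
move=> C B mC mB.
have hC := history_setI hA (@history_state n C mC).
have -> : A `&` [set w | coin n.+1 w = c] `&` Y n @^-1` C =
   A `&` [set w | C (T n w, X n w)] `&` [set w | coin n.+1 w = c].
  by rewrite -!setIA; congr (_ `&` _); rewrite setIC.
rewrite (@coin_half _ _ _ (fun y => PB [set v | B (exitlaw y v)]))//; last first.
  have mD : measurable [set z : (R * R) * OmegaB | B (exitlaw z.1 z.2)].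
    by have := mexit measurableT mB; rewrite setTI.
  have := measurable_fun_xsection PB mD.
  congr measurable_fun; apply/funext => y /=; congr (PB _).
  by apply/seteqP; split => v /=; rewrite /xsection/= inE.
have := ws_law hwalk c hC mB; rewrite setIAC => ->.
apply: (f_equal (fun z => 2^-1%:E * z)%E); apply: eq_integral => w _.
have E : brownian_exit_time W (size (T n w) (X n w)) = exitlaw (T n w, X n w).
  by apply/funext => v; rewrite -[(T n w, X n w)]/(Y n w) exitlawE.
by rewrite /brownian_exit_law E.
Qed.

Let measurable_step (F : R -> R -> R) c : measurable_fun setT (fun p : R * R => F p.1 p.2) ->
  measurable_fun setT (fun z : (R * R) * R =>
    F (nt (Num.max z.1.1 0) z.2) (np (if c then 1 else -1) (Num.max z.1.1 0) z.1.2 z.2)).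
Proof.
move=> mF.
have mt : measurable_fun setT (fun z : (R * R) * R => Num.max z.1.1 0).
  by apply: measurable_maxr => //; exact: (measurableT_comp measurable_fst).
have t0 (z : (R * R) * R) : 0 <= Num.max z.1.1 0 by rewrite le_max lexx orbT.
have mx : measurable_fun setT (fun z : (R * R) * R => z.1.2) by exact: (measurableT_comp measurable_snd).
have m1 := measurable_next_time calpha csigma s00 hs mt (measurable_snd : measurable_fun setT (@snd (R * R)%type R)).
have m2 := measurable_next_pos calpha cbeta csigma a b gamma hm s00 hs
  (measurable_cst (if c then 1 else -1 : R)) mt mx (measurable_snd : measurable_fun setT (@snd (R * R)%type R)) t0.
exact: (measurableT_comp mF (measurable_fun_pair m1 m2)).
Qed.

(** The Markov property: [walk_law] applies for each value of the coin, and the two halves recombine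
    into [step_mean]. *)
Lemma walk_mean n (A : set Omega) (F : R -> R -> R) : history T X n A ->
  measurable_fun setT (fun p : R * R => F p.1 p.2) -> (forall t x, 0 <= F t x) ->
  (\int[P]_(w in A) (F (T n.+1 w) (X n.+1 w))%:E = \int[P]_(w in A) smean F (T n w) (X n w))%E.
Proof.
move=> hA mF F0; have mA := history_measurable hA.
pose f c (z : (R * R) * R) : \bar R :=
  (F (nt (Num.max z.1.1 0) z.2) (np (if c then 1 else -1) (Num.max z.1.1 0) z.1.2 z.2))%:E.
have mf c : measurable_fun setT (f c).
  by apply/measurable_EFinP; exact: (measurable_step c mF).
have f0 c z : (0 <= f c z)%E by rewrite lee_fin.
have AE : A = (A `&` [set w | coin n.+1 w = true]) `|` (A `&` [set w | coin n.+1 w = false]).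
  by rewrite -setIUr -[LHS]setIT; congr (_ `&` _); apply/seteqP; split => w //= _; case: (coin _ w); [left|right].
have mTX k : measurable_fun setT (fun w => (F (T k w) (X k w))%:E).
  by apply/measurable_EFinP; exact: (measurableT_comp mF (mY k)).
have mAc c : measurable (A `&` [set w | coin n.+1 w = c]) by exact: measurableI.
rewrite [in LHS]AE ge0_integral_setU//; last 3 first.
- by apply: measurable_funTS.
- by move=> w _; rewrite lee_fin.
- apply/disj_setPS => w /= [[_ ->] [_]]; done.
have H c : (\int[P]_(w in A `&` [set w | coin n.+1 w = c]) (F (T n.+1 w) (X n.+1 w))%:E =
   2^-1%:E * \int[P]_(w in A) \int[PB]_v f c ((T n w, X n w), brownian_exit_time W (size (T n w) (X n w)) v))%E.
  rewrite -(walk_law c hA (mf c) (f0 c)); apply: eq_integral => w; rewrite inE => -[_ /= cw].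
  by rewrite /f /= max_l ?walk_time_ge0// walk_timeE walk_posE cw.
have EI c : (\int[P]_(w in A) \int[PB]_v f c ((T n w, X n w), brownian_exit_time W (size (T n w) (X n w)) v) =
    \int[P]_(w in A) exit_mean (f c) (Y n w))%E.
  by apply: eq_integral => w _; rewrite exit_meanE.
have mI c : measurable_fun setT (fun w => exit_mean (f c) (Y n w)).
  exact: (measurableT_comp (mexit_mean (mf c) (f0 c)) (mY n)).
have I0 c w : (0 <= exit_mean (f c) (Y n w))%E := exit_mean_ge0 (f0 c) _.
have II0 c : (0 <= \int[P]_(w in A) exit_mean (f c) (Y n w))%E by exact: integral_ge0.
have H' c := etrans (H c) (f_equal (fun z => 2^-1%:E * z)%E (EI c)).
apply: (etrans (f_equal2 adde (H' true) (H' false))).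
apply: (etrans (esym (ge0_muleDr _ (II0 true) (II0 false)))).
rewrite -ge0_integralD//; last 2 first.
- exact: measurable_funTS (mI _).
- exact: measurable_funTS (mI _).
rewrite -ge0_integralZl//; last 2 first.
- by apply: emeasurable_funD; exact: measurable_funTS (mI _).
- by move=> w _; rewrite adde_ge0.
apply: eq_integral => w _.
have mfw c : measurable_fun setT (fun v => f c (Y n w, exitlaw (Y n w) v)).
  apply: (measurableT_comp (mf c)); apply: measurable_fun_pair => //.
  have mp : measurable_fun setT (fun v : OmegaB => (Y n w, v)) by exact: measurable_fun_pair.
  exact: (measurableT_comp mexit mp).
rewrite /exit_mean -ge0_integralD// -ge0_integralZl//; last 2 first.
- exact: emeasurable_funD.
- by move=> v _; rewrite adde_ge0.
apply: eq_integral => v _; rewrite exitlawE /f /= max_l ?walk_time_ge0//.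
by rewrite -EFinD -EFinM mulrC.
Qed.

Lemma measurable_step_mean n (F : R -> R -> R) :
  measurable_fun setT (fun p : R * R => F p.1 p.2) -> (forall t x, 0 <= F t x) ->
  measurable_fun setT (fun w => smean F (T n w) (X n w)).
Proof.
move=> mF F0.
pose g (z : (R * R) * R) : \bar R :=
  ((F (nt (Num.max z.1.1 0) z.2) (np 1 (Num.max z.1.1 0) z.1.2 z.2) +
    F (nt (Num.max z.1.1 0) z.2) (np (- 1) (Num.max z.1.1 0) z.1.2 z.2)) / 2)%:E.
have mg : measurable_fun setT g.
  apply/measurable_EFinP; apply: measurable_funM => //; apply: measurable_funD.
    exact: (measurable_step true mF).
  exact: (measurable_step false mF).
have g0 z : (0 <= g z)%E by rewrite lee_fin divr_ge0// addr_ge0.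
rewrite (_ : (fun w => _) = fun w => exit_mean g (Y n w)).
  exact: (measurableT_comp (mexit_mean mg g0) (mY n)).
apply/funext => w; rewrite exit_meanE /step_mean; apply: eq_integral => v _.
by rewrite /g /= max_l// walk_time_ge0.
Qed.

(** [tau n.+1] is known only in law, so it lies in [0, size^2] almost surely; the countably many
    exceptional events are null by [walk_law]. Off them confinement propagates by induction. *)
Lemma walk_good : exists G : set Omega, [/\ measurable G, P (~` G) = 0 &
  forall w n, G w -> [/\ a < X n w < b, T n w <= T n.+1 w, T n.+1 w <= T n w + m &
    gamma * wall_dist a b (X n w) <= wall_dist a b (X n.+1 w)]].
Proof.
pose bad (z : (R * R) * R) := (a < z.1.2) && (z.1.2 < b) &&
  ~~ ((0 <= z.2) && (z.2 <= size (Num.max z.1.1 0) z.1.2 ^+ 2)).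
have mbad : measurable_fun setT bad.
  have mx : measurable_fun setT (fun z : (R * R) * R => z.1.2) by exact: (measurableT_comp measurable_snd).
  have m2 : measurable_fun setT (fun z : (R * R) * R => z.2) by exact: measurable_snd.
  apply: measurable_and.
    by apply: measurable_and; exact: measurable_fun_ltr.
  apply: measurable_neg; apply: measurable_and; first exact: measurable_fun_ler.
  apply: measurable_fun_ler => //; apply: measurable_funX.
  exact: (measurableT_comp msize measurable_fst).
pose f z : \bar R := ((bad z)%:R)%:E.
have mf : measurable_fun setT f.
  apply/measurable_EFinP; rewrite (_ : (fun z => _) = fun z => if bad z then 1 else 0).
    exact: measurable_fun_ifT.
  by apply/funext => z; case: (bad z).
have f0 z : (0 <= f z)%E by rewrite lee_fin.
pose Bad n := [set w | bad (Y n w, tau n.+1 w)].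
have mYt n : measurable_fun setT (fun w => (Y n w, tau n.+1 w)).
  by apply: measurable_fun_pair => //; exact: (ws_tau_measurable hwalk).
have mBad n : measurable (Bad n).
  have := measurableT_comp mbad (mYt n) measurableT (Y := [set true]).
  by rewrite setTI; apply.
have mBadc n c : measurable (Bad n `&` [set w | coin n.+1 w = c]) by exact: measurableI.
have PBad n c : P (Bad n `&` [set w | coin n.+1 w = c]) = 0%E.
  have := walk_law c (@history_setT n) mf f0; rewrite setTI.
  rewrite [X in (_ * X)%E]integral0_eq; last first.
    move=> w _; pose dn := size (T n w) (X n w).
    have [axb|naxb] := boolP ((a < X n w) && (X n w < b)); last first.
      by apply: integral0_eq => v _; rewrite /f /bad /= (negbTE naxb).
    have dn0 : 0 < dn := spheroid_size_gt0 beta calpha csigma hm hgamma s00 hs (walk_time_ge0 n w) axb.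
    have [G [mG PG hG]] := exit_good hW dn0.
    have mfv : measurable_fun setT (fun v => f (Y n w, brownian_exit_time W dn v)).
      apply: (measurableT_comp mf); apply: measurable_fun_pair => //.
      have mp : measurable_fun setT (fun w : OmegaB => (dn, w)) by exact: measurable_fun_pair.
      exact: (measurableT_comp (measurable_brownian_exit_time hW) mp).
    rewrite (@ge0_integral_full _ _ _ PB G (fun v => f (Y n w, brownian_exit_time W dn v)))//.
    apply: integral0_eq => v Gv; rewrite /f /bad /= max_l ?walk_time_ge0//.
    by rewrite brownian_exit_time_ge0 (hG v Gv).1 /= andbF.
  rewrite mule0 => <-.
  transitivity (\int[P]_(w in [set w | coin n.+1 w = c]) (\1_(Bad n) w)%:E)%E.
    by rewrite integral_indic.
  apply: eq_integral => w _; rewrite /f indicE; congr (_%:R)%:E; congr nat_of_bool.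
  by apply/idP/idP; rewrite inE.
have PB0 n : P (Bad n) = 0%E.
  have -> : Bad n = (Bad n `&` [set w | coin n.+1 w = true]) `|` (Bad n `&` [set w | coin n.+1 w = false]).
    by rewrite -setIUr -[LHS]setIT; congr (_ `&` _); apply/seteqP; split => w //= _; case: (coin _ w); [left|right].
  rewrite measureU0; [exact: PBad|exact: mBadc|exact: mBadc|exact: PBad].
exists (~` (\bigcup_n Bad n)); split.
- by apply: measurableC; exact: bigcup_measurable.
- rewrite setCK; apply/negligibleP; first exact: bigcup_measurable.
  by apply: negligible_bigcup => k; apply/negligibleP; [exact: mBad|exact: PB0].
move=> w n Gw.
have ok k : a < X k w < b -> (0 <= tau k.+1 w) && (tau k.+1 w <= size (T k w) (X k w) ^+ 2).
  move=> axb; apply/negPn/negP => h; apply: Gw; exists k => //.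
  by rewrite /Bad /= /bad /= axb max_l ?walk_time_ge0.
have sgn k : `|(if coin k.+1 w then 1 else -1 : R)| <= 1.
  by case: (coin _ w); rewrite ?normrN normr1.
have Xin k : a < X k w < b.
  elim: k => [|k IH]; first by rewrite (ws_X0 hwalk).
  have /andP[t0 t1] := ok k IH; rewrite walk_posE.
  apply: (proj1 (confined_in hgamma IH _)).
  exact: (next_pos_confined calpha cbeta csigma hm hgamma s00 hs (walk_time_ge0 k w) IH).
have /andP[t0 t1] := ok n (Xin n).
have [s [ts sm _ es _]] := next_step calpha csigma hm hgamma s00 hs (walk_time_ge0 n w) (Xin n) t0 t1.
rewrite walk_timeE es; split => //.
rewrite walk_posE; apply: (proj2 (confined_in hgamma (Xin n) _)).
exact: (next_pos_confined calpha cbeta csigma hm hgamma s00 hs (walk_time_ge0 n w) (Xin n)).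
Qed.

End walk.

(** * Tails and moments of the time of the walk *)

Lemma ge0_integral_setI_full d (T : measurableType d) (R : realType)
    (P : {measure set T -> \bar R}) (G A : set T) (f : T -> \bar R) :
  measurable G -> measurable A -> P (~` G) = 0 -> measurable_fun setT f ->
  (forall x, 0 <= f x)%E -> (\int[P]_(x in A) f x = \int[P]_(x in A `&` G) f x)%E.
Proof.
move=> mG mA PG mf f0; rewrite (@ge0_negligible_integral _ _ _ P _ (~` G))//.
- by rewrite setDE setCK.
- exact: measurableC.
- exact: measurable_funTS.
Qed.

Lemma ge0_le_integral_full d (T : measurableType d) (R : realType)
    (P : {measure set T -> \bar R}) (G A : set T) (f g : T -> \bar R) :
  measurable G -> measurable A -> P (~` G) = 0 -> measurable_fun setT f ->
  measurable_fun setT g -> (forall x, 0 <= f x)%E -> (forall x, 0 <= g x)%E ->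
  (forall x, A x -> G x -> f x <= g x)%E ->
  (\int[P]_(x in A) f x <= \int[P]_(x in A) g x)%E.
Proof.
move=> mG mA PG mf mg f0 g0 fg.
rewrite (@ge0_integral_setI_full _ _ _ P G A f)// (@ge0_integral_setI_full _ _ _ P G A g)//.
apply: ge0_le_integral => //.
- exact: measurableI.
- exact: measurable_funTS.
- exact: measurable_funTS.
- by move=> x [Ax Gx]; exact: fg.
Qed.

Lemma ge0_integral_le_cst_full d (T : measurableType d) (R : realType)
    (P : {measure set T -> \bar R}) (G A : set T) (f : T -> \bar R) (k : R) :
  measurable G -> measurable A -> P (~` G) = 0 -> measurable_fun setT f ->
  (forall x, 0 <= f x)%E -> 0 <= k -> (forall x, A x -> G x -> f x <= k%:E)%E ->
  (\int[P]_(x in A) f x <= k%:E * P A)%E.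
Proof.
move=> mG mA PG mf f0 k0 fk; rewrite -integral_cst//.
by apply: (ge0_le_integral_full mG mA PG) => // x; rewrite lee_fin.
Qed.

Lemma measure_setI_full d (T : measurableType d) (R : realType)
    (P : {measure set T -> \bar R}) (G A : set T) :
  measurable G -> measurable A -> P (~` G) = 0 -> P A = P (A `&` G).
Proof.
move=> mG mA PG; apply/eqP; rewrite eq_le; apply/andP; split; last first.
  by apply: le_measure; rewrite ?inE//; exact: measurableI.
rewrite -[leLHS]mul1e -integral_cst// (@ge0_integral_setI_full _ _ _ P G A (cst 1%E))//.
by rewrite integral_cst ?mul1e//; exact: measurableI.
Qed.

(** Once sqrt(k + 1) >= r / c, a step multiplies the bound on g_k (k + 1)^r by at most exp(- c /
    sqrt(k + 1) + r / (k + 1)) <= 1. Before that, g <= 1 and the constant absorbs the power. *)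
Lemma decay_poly (R : realType) (c : R) (r : nat) : 0 < c ->
  exists2 M : R, 0 <= M & forall g : nat -> R, (forall k, 0 <= g k) -> g 0%N <= 1 ->
    (forall k, g k.+1 <= (1 - c / Num.sqrt k.+1%:R) * g k) ->
    forall k, g k <= M / k.+1%:R ^+ r.
Proof.
move=> c0; pose k0 := Num.bound ((r%:R / c) ^+ 2).
have hk0 : (r%:R / c) ^+ 2 <= k0%:R :> R.
  by apply: ltW; apply: le_lt_trans (archi_boundP _); rewrite ?sqr_ge0.
exists (k0.+1%:R ^+ r); first by rewrite exprn_ge0.
move=> g g0 g1 hg.
have gle1 k : g k <= 1.
  elim: k => // k IH; apply: (le_trans (hg k)); apply: le_trans IH.
  rewrite ler_piMl// lerBlDr lerDl divr_ge0 ?sqrtr_ge0 ?(ltW c0)//.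
elim=> [|k IH].
  rewrite expr1n divr1; apply: (le_trans g1); apply: exprn_ege1.
  by rewrite ler1n.
have [kk|kk] := leqP k.+1 k0.
  apply: (le_trans (gle1 _)); rewrite ler_pdivlMr ?exprn_gt0// mul1r.
  by apply: lerXn2r; rewrite ?nnegrE// ler_nat.
have s0 : 0 < Num.sqrt k.+1%:R :> R by rewrite sqrtr_gt0.
set M := k0.+1%:R ^+ r in IH *; have M0 : 0 <= M by rewrite exprn_ge0.
have p1 : 0 < k.+1%:R ^+ r :> R by rewrite exprn_gt0.
have p2 : 0 < k.+2%:R ^+ r :> R by rewrite exprn_gt0.
have h1 : (1 - c / Num.sqrt k.+1%:R) * (k.+2%:R / k.+1%:R) ^+ r <= 1 :> R.
  have q1 : 1 - c / Num.sqrt k.+1%:R <= expR (- (c / Num.sqrt k.+1%:R)) by exact: expR_ge1Dx.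
  have q2 : (k.+2%:R / k.+1%:R) ^+ r <= expR (r%:R / k.+1%:R) :> R.
    rewrite expRM_natl.
    apply: lerXn2r; rewrite ?nnegrE ?expR_ge0 ?divr_ge0//.
    have -> : k.+2%:R / k.+1%:R = 1 + (k.+1%:R)^-1 :> R.
      by rewrite -[k.+2]addn1 natrD mulrDl mulfV ?mul1r// pnatr_eq0.
    exact: expR_ge1Dx.
  have q3 : 0 <= (k.+2%:R / k.+1%:R) ^+ r :> R by rewrite exprn_ge0// divr_ge0.
  apply: (@le_trans _ _ (expR (- (c / Num.sqrt k.+1%:R)) * expR (r%:R / k.+1%:R))).
    apply: (@le_trans _ _ (expR (- (c / Num.sqrt k.+1%:R)) * (k.+2%:R / k.+1%:R) ^+ r)).
      by rewrite ler_wpM2r.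
    by rewrite ler_wpM2l// expR_ge0.
  rewrite -expRD -[leRHS]expR0 ler_expR addrC subr_le0.
  have e : k.+1%:R = Num.sqrt k.+1%:R * Num.sqrt k.+1%:R :> R by rewrite -expr2 sqr_sqrtr.
  rewrite [in leLHS]e invfM mulrA ler_wpM2r ?invr_ge0 ?(ltW s0)//.
  rewrite ler_pdivrMr// mulrC -ler_pdivrMr//.
  rewrite -[leLHS]ger0_norm ?divr_ge0 ?(ltW c0)// -sqrtr_sqr ler_wsqrtr//.
  by apply: (le_trans hk0); rewrite ler_nat ltnW.
apply: (le_trans (hg k)).
(* The factor may be negative; then [g k.+1] is at most 0. *)
have [n1|n1] := leP 0 (1 - c / Num.sqrt k.+1%:R); last first.
  apply: (@le_trans _ _ 0); first by rewrite nmulr_rle0.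
  by rewrite divr_ge0// ltW.
apply: (@le_trans _ _ ((1 - c / Num.sqrt k.+1%:R) * (M / k.+1%:R ^+ r))).
  by rewrite ler_wpM2l.
have -> : (1 - c / Num.sqrt k.+1%:R) * (M / k.+1%:R ^+ r) =
  M / k.+2%:R ^+ r * ((1 - c / Num.sqrt k.+1%:R) * (k.+2%:R / k.+1%:R) ^+ r).
  by rewrite expr_div_n; field; rewrite !gt_eqF.
by rewrite ler_piMr// divr_ge0// ltW.
Qed.

Lemma sum_inv_sqr (R : realType) (n : nat) : \sum_(k < n) (k.+1%:R ^+ 2)^-1 <= 2 :> R.
Proof.
case: n => [|n]; first by rewrite big_ord0.
suff h : \sum_(k < n.+1) (k.+1%:R ^+ 2)^-1 <= 2 - (n.+1%:R)^-1 :> R.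
  by apply: (le_trans h); rewrite gerBl invr_ge0.
elim: n => [|n IH]; first by rewrite big_ord_recl big_ord0 expr1n invr1; lra.
rewrite big_ord_recr /=; apply: (le_trans (lerD IH (lexx _))).
have a1 : 0 < n.+1%:R :> R by rewrite ltr0n.
have e2 : n.+2%:R = n.+1%:R + 1 :> R by rewrite -[n.+2]addn1 natrD.
have a2 : 0 < n.+1%:R + 1 :> R by lra.
rewrite e2 -subr_ge0; move: (n.+1%:R : R) a1 a2 => x x0 x1.
have -> : 2 - (x + 1)^-1 - (2 - x^-1 + ((x + 1) ^+ 2)^-1) = (x * (x + 1) ^+ 2)^-1.
  by field; rewrite !gt_eqF.
by rewrite invr_ge0 mulr_ge0 ?sqr_ge0 ?(ltW x0).
Qed.


Section exit_time_tail.
Context {R : realType}.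
Variables alpha beta sigma : R -> R.
Hypotheses (calpha : {within `[0, +oo[, continuous alpha})
  (cbeta : {within `[0, +oo[, continuous beta})
  (csigma : {within `[0, +oo[, continuous sigma}).
Variables (a b x0 m gamma s0 : R).
Hypotheses (hab : a < b) (hx0 : a < x0 < b) (hm : 0 < m) (hgamma : 0 < gamma < 1).
Hypotheses (s00 : 0 < s0) (hs : forall t, 0 <= t -> s0 <= sigma t).
Context (dB : measure_display) (OmegaB : measurableType dB)
  (PB : probability OmegaB R) (W : R -> OmegaB -> R).
Hypothesis hW : brownian_motion PB W.
Context (d : measure_display) (Omega : measurableType d) (P : probability Omega R)
  (tau : nat -> Omega -> R) (coin : nat -> Omega -> bool) (T X : nat -> Omega -> R).
Hypothesis hwalk : walk_on_spheroids alpha beta sigma a b x0 m gamma PB W P tau coin T X.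
Local Notation rh := (rho alpha sigma).

Let after n t : set Omega := [set w | t <= T n w].

Let mafter n t : measurable (after n t).
Proof.
have := measurable_fun_ler (measurable_cst t : measurable_fun setT _) (ws_T_measurable hwalk n).
by move=> /(_ measurableT [set true]); rewrite setTI; apply.
Qed.

Let hafter n t : history T X n (after n t).
Proof.
have -> : after n t = [set w | [set p : R * R | t <= p.1] (T n w, X n w)] by [].
apply: history_state.
have := measurable_fun_ler (measurable_cst t) (measurable_fst : measurable_fun setT (@fst R R)).
by move=> /(_ measurableT [set true]); rewrite setTI; apply.
Qed.

(** A step lasts at most [m], so the walk enters the block by time tk + m, where the barrier is at
    most 1 - exp(- A) / 2; the extra unit of length leaves room for the intrinsic time required in
    [gap]. The barrier is a supermartingale before [te] and 1 afterwards, so its mean bounds the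
    probability of having passed [te]. *)
Lemma block_decay (tk A : R) n (te := (tk + (m + 1))%R) : 0 <= tk -> 1 <= A ->
  (forall t, 0 <= t -> t <= tk + m -> 15 * block_var alpha a b te A <= rh te - rh t) ->
  (P (after n te) <= (1 - expR (- A) / 2)%:E * P (after n tk))%E.
Proof.
move=> tk0 A1 gap; set q := 1 - expR (- A) / 2.
have te0 : 0 <= te by rewrite /te addr_ge0// addr_ge0// ltW.
have teE : te = tk + m + 1 by rewrite /te addrA.
clearbody te.
have q0 : 0 <= q.
  have : expR (- A) <= 1 by rewrite -[leRHS]expR0 ler_expR; lra.
  rewrite /q; lra.
have [G [mG PG hG]] := walk_good calpha cbeta csigma hx0 hm hgamma s00 hs hW hwalk.
pose f k w := (barrier alpha beta sigma a b te A (T k w) (X k w))%:E.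
have b0 t x : 0 <= t -> 0 <= barrier alpha beta sigma a b te A t x.
  exact: (@barrier_ge0 _ alpha beta sigma calpha csigma a b s0 hab s00 hs te A A1 t x).
have f0 k w : (0 <= f k w)%E by rewrite lee_fin b0// (walk_time_ge0 hwalk).
have mf k : measurable_fun setT (f k).
  apply/measurable_EFinP; apply: (measurable_barrier calpha cbeta csigma) => //.
    exact: (ws_T_measurable hwalk).
  exact: (ws_X_measurable hwalk).
have fE k w : f k w = (barrier alpha beta sigma a b te A (T k w) (X k w))%:E by [].
clearbody f.
have start t x : 0 <= t -> t <= tk + m -> barrier alpha beta sigma a b te A t x <= q.
  move=> t0 tt; apply: barrier_start => //; last exact: gap.
  by rewrite teE; lra.
(* Before [te] this is [step_mean_barrier]; from [te] on, times are nondecreasing and the barrier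
   remains 1. *)
have mean k : (\int[P]_(w in after k tk) f k.+1 w <= \int[P]_(w in after k tk) f k w)%E.
  have AE : after k tk = (after k tk `&` ~` after k te) `|` after k te.
    apply/seteqP; split => w /=; last by case=> [[]//|]; rewrite /after /= teE; have := hm; lra.
    by move=> h; have [h'|h'] := leP te (T k w); [right|left; split => //; apply/negP; rewrite -ltNge].
  have mA1 : measurable (after k tk `&` ~` after k te) by apply: measurableI => //; exact: measurableC.
  have split_int (g : Omega -> \bar R) : measurable_fun setT g -> (forall w, 0 <= g w)%E ->
    (\int[P]_(w in after k tk) g w = \int[P]_(w in after k tk `&` ~` after k te) g w + \int[P]_(w in after k te) g w)%E.
    move=> mg g0; rewrite {1}AE ge0_integral_setU//; first exact: measurable_funTS.
    by apply/disj_setPS => w /= [[]].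
  rewrite (split_int (f k.+1) (mf _) (f0 _)) (split_int (f k) (mf _) (f0 _)).
  apply: leeD; last first.
    apply: (ge0_le_integral_full mG _ PG) => // w /= tw Gw.
    have [_ tt _ _] := hG w k Gw.
    by rewrite !fE lee_fin /barrier ltNge (le_trans tw tt)/= ltNge tw.
  pose F t x := if 0 <= t then barrier alpha beta sigma a b te A t x else 0.
  have F0 t x : 0 <= F t x by rewrite /F; case: ifP => // /b0.
  have mF : measurable_fun setT (fun p : R * R => F p.1 p.2).
    apply: measurable_fun_ifT => //; first exact: measurable_fun_ler.
    exact: (measurable_barrier calpha cbeta csigma).
  have FE k' w : (F (T k' w) (X k' w))%:E = f k' w by rewrite fE /F (walk_time_ge0 hwalk).
  have hA : history T X k (after k tk `&` ~` after k te).
    apply: history_setI => //; exact: history_setC.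
  have := walk_mean calpha cbeta csigma hm s00 hs hW hwalk hA mF F0.
  under eq_integral do rewrite FE.
  move=> ->; apply: (ge0_le_integral_full mG _ PG) => //.
  - exact: (measurable_step_mean calpha cbeta csigma hm s00 hs hW hwalk).
  - by move=> w; apply: integral_ge0 => v _; rewrite lee_fin divr_ge0// addr_ge0.
  move=> w [_ /= /negP]; rewrite -ltNge => tte Gw; have [axb _ _ _] := hG w k Gw.
  rewrite fE; have := step_mean_barrier calpha cbeta csigma hab hm hgamma s00 hs hW te0 A1 (walk_time_ge0 hwalk k w) tte axb.
  apply: le_trans; rewrite /step_mean le_eqVlt; apply/orP; left; apply/eqP.
  by apply: eq_integral => v _; rewrite /F !rho_inv_ge0.
(* Paths that pass [tk] at step [k.+1] bring a barrier of at most [q]; those already past it are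
   handled by [mean] and the induction hypothesis. *)
have key k : (\int[P]_(w in after k tk) f k w <= q%:E * P (after k tk))%E.
  elim: k => [|k IH].
    apply: (ge0_integral_le_cst_full mG _ PG) => // w _ _; rewrite fE lee_fin.
    by rewrite (ws_T0 hwalk) start// addr_ge0// ltW.
  pose C := ~` after k tk `&` after k.+1 tk.
  have mC : measurable C by apply: measurableI => //; exact: measurableC.
  have disj : [disjoint after k tk & C] by apply/disj_setPS => w /= [h [/(_ h)]].
  have sub : after k.+1 tk `<=` after k tk `|` C.
    by move=> w h; have [h'|h'] := pselect (after k tk w); [left|right].
  apply: (@le_trans _ _ (\int[P]_(w in after k tk `|` C) f k.+1 w)%E).
    by apply: ge0_subset_integral => //; [exact: measurableU|exact: measurable_funTS].
  rewrite ge0_integral_setU//; last exact: measurable_funTS.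
  apply: (@le_trans _ _ (q%:E * P (after k tk) + q%:E * P C)%E).
    apply: leeD; first exact: (le_trans (mean k) IH).
    apply: (ge0_integral_le_cst_full mG _ PG) => // w [/negP + _] Gw.
    rewrite -ltNge => tk1; rewrite fE lee_fin; apply: start; first exact: (walk_time_ge0 hwalk).
    have [_ _ tt _] := hG w k Gw; lra.
  rewrite -ge0_muleDr// -measureU//; last by apply/seteqP; split => w //= [h [/(_ h)]].
  apply: lee_wpmul2l; first by rewrite lee_fin.
  have PE : P (after k tk `|` C) = P ((after k tk `|` C) `&` G).
    by apply: measure_setI_full => //; exact: measurableU.
  apply: (le_trans (y := P ((after k tk `|` C) `&` G))); first by rewrite -PE.
  apply: le_measure; rewrite ?inE//; first by apply: measurableI => //; exact: measurableU.
  move=> w [[h|[_ h]]//] Gw; have [_ tt _ _] := hG w k Gw.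
  exact: le_trans tt.
apply: le_trans (key n); rewrite -[leLHS]mul1e -integral_cst//.
apply: (@le_trans _ _ (\int[P]_(w in after n te) f n w)%E).
  apply: ge0_le_integral => //; first exact: measurable_funTS.
  by move=> w /= h; rewrite fE lee_fin /barrier ltNge h.
apply: ge0_subset_integral => //; first exact: measurable_funTS.
by move=> w; rewrite /after /= teE; have := hm; lra.
Qed.

Variable K : R.
Hypotheses (K0 : 0 < K) (hlog : forall t, 0 <= t -> 
  `|alpha t| <= K + (30 * (b - a) ^+ 2 * expR 1 ^+ 4 / s0 ^+ 2)^-1 * ln (1 + t)).

Let tt (k : nat) := k%:R * (m + 1).

(** [Kk] bounds |alpha| up to [te]. The coefficient 1 / (2 C0) of the logarithm in [hlog] makes A a
    constant plus ln(1 + te) / 2, so exp(- A) is a multiple of (1 + te)^(-1/2), and 1 + te <= (m +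
    2) (k + 1). *)
Lemma block_decay_sqrt : exists2 c : R, 0 < c & forall n k,
  (P (after n (tt k.+1)) <= (1 - c / Num.sqrt k.+1%:R)%:E * P (after n (tt k)))%E.
Proof.
pose C0 := 15 * (b - a) ^+ 2 * expR 1 ^+ 4 / s0 ^+ 2.
have C00 : 0 < C0.
  by rewrite /C0 !mulr_gt0 ?invr_gt0 ?exprn_gt0 ?expR_gt0 ?subr_gt0.
have etaE : (30 * (b - a) ^+ 2 * expR 1 ^+ 4 / s0 ^+ 2)^-1 = (2 * C0)^-1.
  by congr (_^-1); rewrite /C0; ring.
have hlog' t : 0 <= t -> `|alpha t| <= K + (2 * C0)^-1 * ln (1 + t).
  by rewrite -etaE; exact: hlog.
pose c := expR (- (1 + C0 * (1 + K))) / 2 / Num.sqrt (m + 2).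
have m2 : 0 < m + 2 by have := hm; lra.
have c0 : 0 < c by rewrite !divr_gt0 ?expR_gt0 ?sqrtr_gt0.
exists c => // n k.
have tk0 : 0 <= tt k by rewrite mulr_ge0// addr_ge0 ?(ltW hm).
have tE : tt k.+1 = tt k + (m + 1) by rewrite /tt -[k.+1]addn1 natrD; ring.
rewrite tE; set te := tt k + (m + 1) in tE *.
have te1 : 1 <= te by rewrite /te; have := hm; lra.
have te0 : 0 <= te by lra.
have l0 : 0 <= ln (1 + te) by rewrite ln_ge0// lerDl.
pose Kk := K + (2 * C0)^-1 * ln (1 + te).
have Kk0 : 0 <= Kk by rewrite addr_ge0 ?(ltW K0)// mulr_ge0// invr_ge0 mulr_ge0// ltW.
pose A := 1 + C0 * (1 + Kk).
have A1 : 1 <= A by rewrite lerDl; apply: mulr_ge0; [exact: ltW|exact: addr_ge0].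
have h1 : (1 + Kk)^-1 <= 1 by rewrite invf_le1 ?lerDl//; lra.
have gap t : 0 <= t -> t <= tt k + m -> 15 * block_var alpha a b te A <= rh te - rh t.
  move=> t0 ttm; apply: (@block_gap _ alpha sigma calpha csigma a b s0 s00 hs te Kk A t Kk0) => //.
  - exact: le_trans te1.
  - move=> s s_ge0 /andP[_ ste]; apply: (le_trans (hlog' _ s_ge0)); rewrite lerD2l ler_wpM2l//.
      by rewrite invr_ge0 mulr_ge0// ltW.
    by rewrite ler_ln ?posrE; lra.
  - by apply: lt_le_trans A1.
  - rewrite /A -/C0 (_ : _ * (1 + Kk) / s0 ^+ 2 = C0 * (1 + Kk)); last by rewrite /C0; ring.
    lra.
  - by rewrite /te; lra.
apply: (le_trans (block_decay n tk0 A1 gap)); apply: lee_wpmul2r => //.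
rewrite lee_fin lerD2l lerN2.
have AE : A = 1 + C0 * (1 + K) + ln (1 + te) / 2 by rewrite /A /Kk; field; rewrite gt_eqF.
have zs : expR (- (ln (1 + te) / 2)) = (Num.sqrt (1 + te))^-1.
  rewrite expRN; congr (_^-1); rewrite -[LHS]ger0_norm ?expR_ge0// -sqrtr_sqr; congr Num.sqrt.
  rewrite -expRM_natl (_ : 2%:R * _ = ln (1 + te)); last by field.
  by rewrite lnK// posrE; lra.
have -> : expR (- A) / 2 = expR (- (1 + C0 * (1 + K))) / 2 * (Num.sqrt (1 + te))^-1.
  by rewrite AE opprD expRD zs; ring.
rewrite /c -!mulrA ler_wpM2l ?expR_ge0// ler_wpM2l//.
have sk : 0 < Num.sqrt k.+1%:R :> R by rewrite sqrtr_gt0.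
have sm : 0 < Num.sqrt (m + 2) by rewrite sqrtr_gt0.
rewrite -invfM lef_pV2 ?posrE ?mulr_gt0 ?sqrtr_gt0//; last by lra.
rewrite -sqrtrM ?(ltW m2)// ler_wsqrtr// -tE /tt.
have k1 : 1 <= k.+1%:R :> R by rewrite ler1n.
have := hm; nra.
Qed.

Lemma walk_time_tail (r : nat) : exists2 M : R, 0 <= M & forall n k,
  (P (after n (tt k)) <= (M / k.+1%:R ^+ r)%:E)%E.
Proof.
have [c c0 hc] := block_decay_sqrt; have [M M0 hM] := decay_poly r c0.
exists M => // n k; pose g k := fine (P (after n (tt k))).
have gE j : P (after n (tt j)) = (g j)%:E by rewrite fineK// fin_num_measure.
rewrite gE lee_fin; apply: hM => [j||j].
- by rewrite -lee_fin -gE.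
- by rewrite -lee_fin -gE probability_le1.
- by rewrite -lee_fin EFinM -!gE.
Qed.

(** Layers along the blocks: (1 + T)^N is at most the sum over k of (1 + t_(k+1))^N on the events T
    >= t_k. A tail of order N + 2 leaves a sum of 1 / (k + 1)^2, bounded independently of [n]; the
    sum is finite since T_n <= n m almost surely. *)
Lemma walk_time_moment (N : nat) : exists2 C : R, 0 <= C & forall n,
  (\int[P]_w ((1 + T n w) ^+ N)%:E <= C%:E)%E.
Proof.
have [M M0 hM] := walk_time_tail N.+2.
have m2 : 0 <= m + 2 by have := hm; lra.
exists ((m + 2) ^+ N * M * 2); first by rewrite !mulr_ge0 ?exprn_ge0.
move=> n; have [G [mG PG hG]] := walk_good calpha cbeta csigma hx0 hm hgamma s00 hs hW hwalk.
have T0 w := walk_time_ge0 hwalk n w.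
have Tn w : G w -> T n w < tt n.+1.
  move=> Gw; have h : T n w <= n%:R * m.
    elim: (n) => [|k IH]; first by rewrite (ws_T0 hwalk) mul0r.
    by have [_ _ h _] := hG w k Gw; apply: (le_trans h); rewrite -[k.+1]addn1 natrD mulrDl mul1r lerD2r.
  apply: (le_lt_trans h); rewrite /tt -[n.+1]addn1 natrD.
  have : 0 <= n%:R :> R by []. have := hm; nra.
pose g k w := (1 + tt k.+1) ^+ N * \1_(after n (tt k)) w.
have tt0 k : 0 <= tt k by rewrite mulr_ge0// addr_ge0 ?(ltW hm).
have g0 k w : 0 <= g k w by rewrite mulr_ge0 ?exprn_ge0// addr_ge0.
have key j w : T n w < tt j -> (1 + T n w) ^+ N <= \sum_(k < j) g k w.
  elim: j => [|j IH]; first by rewrite /tt mul0r ltNge T0.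
  move=> tj; rewrite big_ord_recr /=; have [h|h] := leP (tt j) (T n w).
    rewrite -[leLHS]add0r; apply: lerD; first by apply: sumr_ge0 => k _.
    rewrite /g indicE mem_set// mulr1; apply: lerXn2r; rewrite ?nnegrE ?addr_ge0//.
    by rewrite lerD2l ltW.
  by apply: (le_trans (IH h)); rewrite lerDl.
have mT : measurable_fun setT (fun w => (1 + T n w) ^+ N).
  by apply: measurable_funX; apply: measurable_funD => //; exact: (ws_T_measurable hwalk).
have mg k : measurable_fun setT (g k).
  by apply: measurable_funM => //; exact: measurable_indic.
apply: (@le_trans _ _ (\int[P]_w (\sum_(k < n.+1) (g k w)%:E))%E).
  apply: (ge0_le_integral_full mG _ PG) => //.
  - exact/measurable_EFinP.
  - by apply: emeasurable_sum => k; exact/measurable_EFinP.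
  - by move=> w; rewrite lee_fin exprn_ge0// addr_ge0.
  - by move=> w; apply: sume_ge0 => k _; rewrite lee_fin.
  - by move=> w _ Gw; rewrite sumEFin lee_fin; apply: key; exact: Tn.
rewrite ge0_integral_sum//; last 2 first.
- by move=> k; exact/measurable_EFinP.
- by move=> k w _; rewrite lee_fin.
apply: (@le_trans _ _ (\sum_(k < n.+1) ((m + 2) ^+ N * M * (k.+1%:R ^+ 2)^-1)%:E)%E).
  apply: lee_sum => k _; rewrite /g.
  under eq_integral do rewrite EFinM.
  have t1 : 0 <= (1 + tt k.+1) ^+ N by rewrite exprn_ge0// addr_ge0.
  rewrite ge0_integralZl//; last first.
    by apply/measurable_EFinP; exact: measurable_indic.
  rewrite integral_indic// setIT.
  apply: (@le_trans _ _ (((1 + tt k.+1) ^+ N)%:E * (M / k.+1%:R ^+ N.+2)%:E)%E).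
    by apply: lee_wpmul2l; [rewrite lee_fin|exact: hM].
  rewrite -EFinM lee_fin.
  have k1 : 1 <= k.+1%:R :> R by rewrite ler1n.
  have k0 : 0 < k.+1%:R :> R by lra.
  apply: (@le_trans _ _ (((m + 2) * k.+1%:R) ^+ N * (M / k.+1%:R ^+ N.+2))).
    have u0 : 0 <= 1 + tt k.+1 by rewrite addr_ge0.
    have u1 : 1 + tt k.+1 <= (m + 2) * k.+1%:R by rewrite /tt; have := hm; nra.
    rewrite ler_wpM2r ?divr_ge0 ?exprn_ge0//.
    by apply: lerXn2r; rewrite ?nnegrE// (le_trans u0).
  rewrite le_eqVlt; apply/orP; left; apply/eqP.
  move: (k.+1%:R : R) k0 => y y0; rewrite exprMn -[N.+2]addn2 exprD.
  by field; rewrite ?expf_neq0 ?gt_eqF.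
rewrite sumEFin lee_fin -mulr_sumr ler_wpM2l ?sum_inv_sqr// mulr_ge0 ?exprn_ge0//.
Qed.

End exit_time_tail.

(** * From weighted visits to the number of steps *)

(** The threshold is y = L^(1 / (1 - p)): up to it y^p is at most the second term, beyond it y^(1 -
    p) >= L gives y^p <= y / L. *)
Lemma powR_dichotomy (R : realType) (y L p : R) : 0 <= y -> 1 <= L -> 0 < p < 1 ->
  y `^ p <= y / L + L `^ (p / (1 - p)).
Proof.
move=> y0 L1 /andP[p0 p1]; have q0 : 0 < 1 - p by rewrite subr_gt0.
have L0 : 0 < L by lra.
have [yL|Ly] := leP y (L `^ (1 - p)^-1).
  rewrite -[leLHS]add0r; apply: lerD; first by rewrite divr_ge0// ltW.
  rewrite [p / _]mulrC powRrM; apply: ge0_ler_powR; rewrite ?nnegrE ?powR_ge0//.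
  exact: ltW.
have yp : 0 < y := le_lt_trans (powR_ge0 _ _) Ly.
rewrite -[leLHS]addr0; apply: lerD; last exact: powR_ge0.
have yE : y = y `^ p * y `^ (1 - p).
  rewrite -powRD ?gt_eqF ?implybT// (_ : p + (1 - p) = 1) ?powRr1 ?(ltW yp)//; lra.
have h : L <= y `^ (1 - p).
  have -> : L = (L `^ (1 - p)^-1) `^ (1 - p).
    by rewrite -powRrM mulVf ?powRr1 ?(ltW L0)// gt_eqF.
  by apply: ge0_ler_powR; rewrite ?nnegrE ?powR_ge0 ?(ltW q0)// ltW.
by rewrite ler_pdivlMr// [leRHS]yE ler_wpM2l// powR_ge0.
Qed.

Section number_of_steps.
Context {R : realType}.
Variables alpha beta sigma : R -> R.
Hypotheses (calpha : {within `[0, +oo[, continuous alpha})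
  (cbeta : {within `[0, +oo[, continuous beta})
  (csigma : {within `[0, +oo[, continuous sigma}).
Variables (a b x0 m gamma s0 : R).
Hypotheses (hab : a < b) (hx0 : a < x0 < b) (hm : 0 < m) (hgamma : 0 < gamma < 1).
Hypotheses (s00 : 0 < s0) (hs : forall t, 0 <= t -> s0 <= sigma t).
Context (dB : measure_display) (OmegaB : measurableType dB)
  (PB : probability OmegaB R) (W : R -> OmegaB -> R).
Hypothesis hW : brownian_motion PB W.
Context (d : measure_display) (Omega : measurableType d) (P : probability Omega R)
  (tau : nat -> Omega -> R) (coin : nat -> Omega -> bool) (T X : nat -> Omega -> R).
Hypothesis hwalk : walk_on_spheroids alpha beta sigma a b x0 m gamma PB W P tau coin T X.
Variables (Cg K : R).
Hypotheses (Cg0 : 0 < Cg) (hsg : forall t, 0 <= t -> sigma t <= Cg * (1 + t))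
  (hal : forall t, 0 <= t -> `|alpha t| <= Cg * (1 + t))
  (hbe : forall t, 0 <= t -> `|beta t| <= Cg * (1 + t))
  (hgr : forall t, 0 <= t -> growth alpha t (t + m) <= Cg * (1 + t))
  (K0 : 0 < K) (hlog : forall t, 0 <= t ->
  `|alpha t| <= K + (30 * (b - a) ^+ 2 * expR 1 ^+ 4 / s0 ^+ 2)^-1 * ln (1 + t)).
Local Notation smean := (step_mean alpha beta sigma a b m gamma PB W).

Definition inside (e : R) (n : nat) : set Omega :=
  [set w | forall i, (i <= n)%N -> a + e <= X i w <= b - e].

Lemma insideS e n : inside e n.+1 `<=` inside e n.
Proof. by move=> w h i i_n; apply: h; exact: leqW. Qed.

Lemma inside_history e n : history T X n (inside e n).
Proof.
have H k : history T X k [set w | a + e <= X k w <= b - e].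
  have -> : [set w | a + e <= X k w <= b - e] = [set w | [set p : R * R | a + e <= p.2 <= b - e] (T k w, X k w)] by [].
  apply: history_state.
  have := measurable_and
    (measurable_fun_ler (measurable_cst (a + e)) (measurable_snd : measurable_fun setT (@snd R R)))
    (measurable_fun_ler (measurable_snd : measurable_fun setT (@snd R R)) (measurable_cst (b - e))).
  by move=> /(_ measurableT [set true]); rewrite setTI; apply.
elim: n => [|n IH].
  rewrite (_ : inside e 0 = [set w | a + e <= X 0%N w <= b - e]); first exact: H.
  apply/seteqP; split => w /=; first exact.
  by move=> h i; rewrite leqn0 => /eqP ->.
rewrite (_ : inside e n.+1 = inside e n `&` [set w | a + e <= X n.+1 w <= b - e]).
  by apply: history_setI => //; exact: history_mono.
apply/seteqP; split => w /=; first by move=> h; split; [exact: insideS|exact: h].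
by move=> [h1 h2] i; rewrite leq_eqVlt => /predU1P[->//|]; rewrite ltnS; exact: h1.
Qed.

Lemma measurable_inside e n : measurable (inside e n).
Proof. exact: (history_measurable hwalk (@inside_history e n)). Qed.

Let L (n : nat) (w : Omega) : R := (1 + T n w) ^+ 6.

Let T0 n w : 0 <= T n w. Proof. exact: (walk_time_ge0 hwalk). Qed.

Let L1 n w : 1 <= L n w.
Proof. by apply: exprn_ege1; rewrite lerDl. Qed.

Let mT n : measurable_fun setT (T n). Proof. exact: (ws_T_measurable hwalk). Qed.
Let mX n : measurable_fun setT (X n). Proof. exact: (ws_X_measurable hwalk). Qed.

Let mLV n : measurable_fun setT (fun w => (L n w)^-1).
Proof.
apply: (measurableT_comp (@measurable_invr R)).
by apply: measurable_funX; exact: measurable_funD.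
Qed.

(** Each step taken inside adds at least the mean of c / L_j to the stopped Lyapunov process. When
    stopped, the distance to the boundary is at least gamma e, since the last step starts at
    distance at least e and confinement loses at most a factor gamma. The time term is bounded by
    the 13th moment. *)
Lemma expected_visits : exists c C : R, [/\ 0 < c, 0 <= C & forall e n, 0 < e -> e <= wall_dist a b x0 ->
  (\sum_(j < n) \int[P]_(w in inside e j) (c / L j w)%:E <=
   (2 * (ln (b - a) - ln (gamma * e)) + C)%:E)%E].
Proof.
have [B B0 hB] := @linear_drift_bound _ _ _ a b _ _ hm Cg0 hal hbe.
have [KV [c [KV0 c0 drift]]] := step_mean_lyapunov calpha cbeta csigma hab hm hgamma s00 hs hW Cg0 hsg hgr B0 hB.
have [C13 C130 hC13] := walk_time_moment calpha cbeta csigma hab hx0 hm hgamma s00 hs hW hwalk K0 hlog 13.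
have [G [mG PG hG]] := walk_good calpha cbeta csigma hx0 hm hgamma s00 hs hW hwalk.
have [g0 g1] := andP hgamma.
exists c, (KV * C13); split => //; first by rewrite mulr_ge0// ltW.
move=> e n e0 ex0.
set we := 2 * (ln (b - a) - ln (gamma * e)).
pose V k w := lyapunov0 a b KV (T k w) (X k w).
have V0 k w : 0 <= V k w by rewrite le_max lexx orbT.
have mV k : measurable_fun setT (V k) by exact: measurable_lyapunov0.
pose A := inside e.
have mA k : measurable (A k) by exact: measurable_inside.
(* Follows [V] up to and including the first position outside, then stays frozen; whether it still
   moves at step [j.+1] is decided by [A j], an event of the past. *)
pose Vs := fix Vs k w := if k is j.+1 then (if `[< A j w >] then V j.+1 w else Vs j w) else V 0%N w.
have Vs0 k w : 0 <= Vs k w by elim: k => [|k IH] //=; case: ifP.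
have VsA k w : A k w -> Vs k w = V k w.
  by case: k => [|k] //= h; rewrite asboolT//; exact: insideS.
have mVs k : measurable_fun setT (Vs k).
  elim: k => [|k IH] //=.
  apply: measurable_fun_ifT => //.
  apply: (measurable_fun_bool true); rewrite setTI (_ : _ @^-1` _ = A k)//.
  by apply/seteqP; split => w /=; [move/asboolP|move=> h; apply/asboolP].
have split_int k (g : Omega -> \bar R) : measurable_fun setT g -> (forall w, 0 <= g w)%E ->
    (\int[P]_w g w = \int[P]_(w in A k) g w + \int[P]_(w in ~` A k) g w)%E.
  move=> mg g00; rewrite -(setUv (A k)) ge0_integral_setU//.
  - exact: measurableC.
  - by rewrite setUv.
  - by apply/disj_setPS => w [].
have step k : (\int[P]_w (Vs k w)%:E + \int[P]_(w in A k) (c / L k w)%:E <= \int[P]_w (Vs k.+1 w)%:E)%E.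
  rewrite (split_int k (fun w => (Vs k w)%:E)); last 2 first.
  - exact/measurable_EFinP.
  - by move=> w; rewrite lee_fin.
  rewrite [leRHS](split_int k (fun w => (Vs k.+1 w)%:E)); last 2 first.
  - exact/measurable_EFinP.
  - by move=> w; rewrite lee_fin.
  rewrite addeAC; apply: leeD; last first.
    rewrite le_eqVlt; apply/orP; left; apply/eqP; apply: eq_integral => w; rewrite inE => nA /=.
    by rewrite asboolF.
  have -> : (\int[P]_(w in A k) (Vs k.+1 w)%:E = \int[P]_(w in A k) (V k.+1 w)%:E)%E.
    by apply: eq_integral => w; rewrite inE => Aw /=; rewrite asboolT.
  have -> : (\int[P]_(w in A k) (Vs k w)%:E = \int[P]_(w in A k) (V k w)%:E)%E.
    by apply: eq_integral => w; rewrite inE => Aw /=; rewrite VsA.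
  have cL w : 0 <= c / L k w by rewrite divr_ge0 ?(ltW c0)// (le_trans ler01).
  rewrite -ge0_integralD//; last 4 first.
  - by move=> w _; rewrite lee_fin.
  - by apply/measurable_EFinP; exact: measurable_funTS.
  - by move=> w _; rewrite lee_fin.
  - by apply/measurable_EFinP; apply: measurable_funM => //; exact: measurable_funTS.
  have mF : measurable_fun setT (fun p : R * R => lyapunov0 a b KV p.1 p.2) by exact: measurable_lyapunov0.
  have F0 t x : 0 <= lyapunov0 a b KV t x by rewrite le_max lexx orbT.
  have WM := walk_mean calpha cbeta csigma hm s00 hs hW hwalk (@inside_history e k) mF F0.
  have -> : (\int[P]_(w in A k) (V k.+1 w)%:E = \int[P]_(w in inside e k) smean (lyapunov0 a b KV) (T k w) (X k w))%E by exact: WM.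
  apply: (ge0_le_integral_full mG _ PG) => //.
  - apply: emeasurable_funD; apply/measurable_EFinP => //.
    exact: measurable_funM.
  - exact: (measurable_step_mean calpha cbeta csigma hm s00 hs hW hwalk).
  - by move=> w; rewrite adde_ge0// lee_fin.
  - by move=> w; apply: integral_ge0 => v _; rewrite lee_fin divr_ge0// addr_ge0.
  move=> w _ Gw; have [axb _ _ _] := hG w k Gw.
  apply: le_trans (drift (T k w) (X k w) (T0 k w) axb).
  rewrite -EFinD lee_fin lerD2r /V /lyapunov0 ge_max lexx /=.
  rewrite addr_ge0 ?wall_potential_ge0// mulr_ge0 ?(ltW KV0)// exprn_ge0// addr_ge0//.
have VsT k : (\int[P]_w (Vs 0%N w)%:E + \sum_(j < k) \int[P]_(w in A j) (c / L j w)%:E <= \int[P]_w (Vs k w)%:E)%E.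
  elim: k => [|k IH]; first by rewrite big_ord0 adde0.
  rewrite big_ord_recr /= addeA; apply: le_trans (step k).
  exact: leeD2r.
have we0 y : a < y < b -> gamma * e <= wall_dist a b y -> wall_potential a b y <= we.
  move=> ayb; rewrite /wall_dist le_min => /andP[h1 h2].
  by apply: wall_potential_le => //; exact: mulr_gt0.
have ge_e : gamma * e <= e by rewrite ler_piMl ?(ltW e0)// ltW.
have Vbound k w : G w -> Vs k w <= we + KV * (1 + T k w) ^+ 13.
  move=> Gw.
  have aux j : gamma * e <= wall_dist a b (X j w) -> V j w <= we + KV * (1 + T j w) ^+ 13.
    move=> h; have [axb _ _ _] := hG w j Gw.
    have h1 := we0 _ axb h; have h2 := wall_potential_ge0 axb.
    have h3 : 0 <= KV * (1 + T j w) ^+ 13 by rewrite mulr_ge0 ?(ltW KV0)// exprn_ge0// addr_ge0.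
    by rewrite ge_max; apply/andP; split; rewrite /lyapunov ?lerD2r// addr_ge0// (le_trans h2).
  elim: k => [|k IH] /=.
    by apply: aux; rewrite (ws_X0 hwalk); exact: le_trans ex0.
  case: asboolP => Aw.
    apply: aux; have [_ _ _ h] := hG w k Gw; apply: le_trans h.
    apply: ler_wpM2l; first exact: ltW.
    by have /andP[h1 h2] := Aw k (leqnn k); rewrite le_min; apply/andP; split; lra.
  apply: (le_trans IH); rewrite lerD2l; apply: ler_wpM2l; first exact: ltW.
  by apply: lerXn2r; rewrite ?nnegrE ?addr_ge0// lerD2l; have [_ h _ _] := hG w k Gw.
have we_ge0 : 0 <= we.
  apply: (le_trans (wall_potential_ge0 hx0)); apply: we0 => //; exact: le_trans ex0.
apply: (@le_trans _ _ (\int[P]_w (Vs n w)%:E)%E).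
  apply: le_trans (VsT n); rewrite leeDr//.
  by apply: integral_ge0 => w _; rewrite lee_fin.
have mT13 : measurable_fun setT (fun w => (1 + T n w) ^+ 13).
  by apply: measurable_funX; exact: measurable_funD.
have T130 w : 0 <= (1 + T n w) ^+ 13 by rewrite exprn_ge0// addr_ge0.
apply: (@le_trans _ _ (\int[P]_w (we%:E + KV%:E * ((1 + T n w) ^+ 13)%:E))%E).
  apply: (ge0_le_integral_full mG _ PG) => //.
  - exact/measurable_EFinP.
  - by under eq_fun do rewrite -EFinM -EFinD; apply/measurable_EFinP; apply: measurable_funD => //; exact: measurable_funM.
  - by move=> w; rewrite lee_fin.
  - by move=> w; rewrite -EFinM -EFinD lee_fin addr_ge0// mulr_ge0// ltW.
  - by move=> w _ Gw; rewrite -EFinM -EFinD lee_fin Vbound.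
rewrite ge0_integralD//; last 2 first.
- by move=> w _; rewrite -EFinM lee_fin mulr_ge0// ltW.
- by under eq_fun do rewrite -EFinM; apply/measurable_EFinP; exact: measurable_funM.
have Ewe : (\int[P]_w we%:E = we%:E)%E by rewrite integral_cst//= probability_setT mule1.
rewrite Ewe EFinD; apply: leeD => //.
rewrite ge0_integralZl//; last 3 first.
- exact/measurable_EFinP.
- by move=> w _; rewrite lee_fin.
- by rewrite lee_fin ltW.
by rewrite EFinM; apply: lee_wpmul2l; [rewrite lee_fin ltW|exact: hC13].
Qed.

(** This is the minimum of [n] and the number of steps: [inside e j] holds exactly when [j] is
    smaller than the latter. *)
Definition steps_before (e : R) (n : nat) (w : Omega) : R := \sum_(j < n) \1_(inside e j) w.

Let steps_before_ge0 e n w : 0 <= steps_before e n w.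
Proof. by apply: sumr_ge0. Qed.

Lemma measurable_steps_before e n : measurable_fun setT (steps_before e n).
Proof. by apply: measurable_sum => j; apply: measurable_indic; exact: measurable_inside. Qed.

(** [powR_dichotomy] with the random L = (1 + T_n)^6. Times increase, so L_j <= L_n and y / L is at
    most the weighted count of [expected_visits]. The other term is dominated by the moment of order
    6 N0, where N0 is an integer above p / (1 - p). *)
Lemma truncated_moment (p : R) : 0 < p < 1 -> exists C1 C2 : R, [/\ 0 <= C1, 0 <= C2 &
  forall e n, 0 < e -> e <= wall_dist a b x0 ->
  (\int[P]_w (steps_before e n w `^ p)%:E <=
   (C1 * (2 * (ln (b - a) - ln (gamma * e))) + C2)%:E)%E].
Proof.
move=> hp; have [c [C [c0 C0 visits]]] := expected_visits.
pose s := p / (1 - p); pose N0 := Num.bound s.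
have s0' : 0 <= s by case/andP: hp => p0 p1; rewrite divr_ge0 ?subr_ge0// ltW.
have hN0 : s <= N0%:R by exact/ltW/archi_boundP.
have [CM CM0 hCM] := walk_time_moment calpha cbeta csigma hab hx0 hm hgamma s00 hs hW hwalk K0 hlog (6 * N0).
have [G [mG PG hG]] := walk_good calpha cbeta csigma hx0 hm hgamma s00 hs hW hwalk.
exists c^-1, (C / c + CM); split.
- by rewrite invr_ge0 ltW.
- by rewrite addr_ge0// divr_ge0// ltW.
move=> e n e0 ex0; have Vis := visits e n e0 ex0.
have Lge0 j w : 0 <= L j w by exact: le_trans (L1 j w).
have Tmono w j : G w -> (j <= n)%N -> L j w <= L n w.
  move=> Gw jn; apply: lerXn2r; rewrite ?nnegrE ?addr_ge0// lerD2l.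
  elim: (n) jn => [|k IH]; first by rewrite leqn0 => /eqP ->.
  rewrite leq_eqVlt => /predU1P[->//|]; rewrite ltnS => /IH h; apply: (le_trans h).
  by have [_ h' _ _] := hG w k Gw.
pose v j w : R := \1_(inside e j) w / L j w.
have v0 j w : 0 <= v j w by rewrite divr_ge0.
have mv j : measurable_fun setT (v j).
  by apply: measurable_funM => //; apply: measurable_indic; exact: measurable_inside.
have mL : measurable_fun setT (fun w => (1 + T n w) ^+ (6 * N0)).
  by apply: measurable_funX; exact: measurable_funD.
have L0' w : 0 <= (1 + T n w) ^+ (6 * N0) by rewrite exprn_ge0// addr_ge0.
apply: (@le_trans _ _ (\int[P]_w ((\sum_(j < n) (v j w)%:E) + ((1 + T n w) ^+ (6 * N0))%:E))%E).
  apply: (ge0_le_integral_full mG _ PG) => //.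
  - by apply/measurable_EFinP; apply: (measurableT_comp (measurable_powR p)); exact: measurable_steps_before.
  - apply: emeasurable_funD; last exact/measurable_EFinP.
    by apply: emeasurable_sum => j; exact/measurable_EFinP.
  - by move=> w; rewrite lee_fin powR_ge0.
  - by move=> w; apply: adde_ge0; [apply: sume_ge0 => j _|]; rewrite lee_fin.
  move=> w _ Gw; rewrite sumEFin -EFinD lee_fin.
  apply: (le_trans (powR_dichotomy (steps_before_ge0 e n w) (L1 n w) hp)); apply: lerD.
    rewrite /steps_before mulr_suml; apply: ler_sum => j _.
    apply: ler_wpM2l => //; rewrite lef_pV2 ?posrE ?(lt_le_trans ltr01 (L1 _ _))//.
    by apply: Tmono => //; exact: ltnW.
  rewrite -/s exprM -/(L n w) -powR_mulrn//.
  by apply: ler_powR.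
rewrite ge0_integralD//; last 4 first.
- by move=> w _; apply: sume_ge0 => j _; rewrite lee_fin.
- by apply: emeasurable_sum => j; exact/measurable_EFinP.
- by move=> w _; rewrite lee_fin.
- exact/measurable_EFinP.
rewrite [X in (_ <= X%:E)%E]addrA [leRHS]EFinD; apply: leeD; last exact: hCM.
rewrite ge0_integral_sum//; last 2 first.
- by move=> j; exact/measurable_EFinP.
- by move=> j w _; rewrite lee_fin.
have vE j : (\int[P]_w (v j w)%:E = c^-1%:E * \int[P]_(w in inside e j) (c / L j w)%:E)%E.
  rewrite -ge0_integralZl//; last 4 first.
  - exact: measurable_inside.
  - by apply/measurable_EFinP; apply: measurable_funM => //; exact: measurable_funTS.
  - by move=> w _; rewrite lee_fin divr_ge0// ltW.
  - by rewrite lee_fin invr_ge0 ltW.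
  rewrite integral_mkcond; apply: eq_integral => w _; rewrite patchE /v indicE.
  case: ifPn => h; last by rewrite mul0r.
  by rewrite -EFinM mul1r mulrA mulVf ?mul1r// gt_eqF.
under eq_bigr do rewrite vE.
rewrite -ge0_sume_distrr; last first.
  by move=> j _; apply: integral_ge0 => w _; rewrite lee_fin divr_ge0// ltW.
rewrite [C / c]mulrC -mulrDr EFinM; apply: lee_wpmul2l => //.
by rewrite lee_fin invr_ge0 ltW.
Qed.

Lemma steps_before_mono e w : {homo steps_before e ^~ w : n k / (n <= k)%N >-> n <= k}.
Proof.
move=> n k /subnKC <-; elim: (k - n)%N => [|i IH]; first by rewrite addn0.
by apply: (le_trans IH); rewrite addnS /steps_before [leRHS]big_ord_recr /= lerDl.
Qed.

(** The walk starts inside, so the number of steps N is at least 1 and N^r <= N^p, negative [r]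
    included. If the walk never leaves, the truncated counts tend to +oo. *)
Lemma epow_nb_steps_le (e r p : R) w : r <= p -> 0 < p -> a + e <= x0 <= b - e ->
  (epow (nb_steps a b X e w) r <= limn (fun n => (steps_before e n w `^ p)%:E))%E.
Proof.
move=> rp p0 hx.
pose u n : \bar R := (steps_before e n w `^ p)%:E.
have -> : limn u = ereal_sup (range u).
  apply/cvg_lim => //; apply: ereal_nondecreasing_cvgn => n k nk.
  by rewrite lee_fin; apply: ge0_ler_powR; rewrite ?nnegrE ?steps_before_ge0 ?(ltW p0)//; exact: steps_before_mono.
have ub n : (u n <= ereal_sup (range u))%E by apply: ereal_sup_ubound; exists n.
have cnt n : inside e n w -> steps_before e n.+1 w = n.+1%:R.
  move=> h; rewrite /steps_before (eq_bigr (fun=> 1)) ?sumr_const ?card_ord// => j _.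
  by rewrite indicE mem_set// => i ij; apply: h; rewrite (leq_trans ij)// -ltnS.
have [[n hn]|none] := pselect (exists n, X n w \notin `[a + e, b - e]); last first.
  have ins n : inside e n w.
    move=> i _; apply: contrapT => h; apply: none; exists i; apply/negP.
    by rewrite in_itv/=.
  have sup_oo : ereal_sup (range u) = +oo%E.
    have big (M : R) : 0 <= M -> (M%:E <= ereal_sup (range u))%E.
      move=> M0; pose n := Num.bound (M `^ p^-1).
      apply: le_trans (ub n.+1); rewrite lee_fin cnt//.
      have -> : M = (M `^ p^-1) `^ p by rewrite -powRrM mulVf ?powRr1// gt_eqF.
      apply: ge0_ler_powR; rewrite ?nnegrE ?powR_ge0 ?(ltW p0)//.
      apply: (@le_trans _ _ n%:R); first by apply/ltW/archi_boundP; exact: powR_ge0.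
      by rewrite ler_nat.
    case E : (ereal_sup (range u)) => [z|//|].
      have := big (`|z| + 1); rewrite E lee_fin => /(_ (addr_ge0 (normr_ge0 _) ler01)).
      by move=> h; exfalso; have := ler_norm z; lra.
    by have := big 0 (lexx 0); rewrite E.
  by rewrite sup_oo leey.
have [N hN minN] := ex_minnP (ex_intro _ n hn : exists n, X n w \notin `[a + e, b - e]).
have insN i : (i < N)%N -> inside e i w.
  move=> iN j ji; apply: contrapT => h.
  have : X j w \notin `[a + e, b - e] by apply/negP; rewrite in_itv/=.
  by move=> /minN; rewrite leqNgt (leq_ltn_trans ji iN).
have nbE : nb_steps a b X e w = N%:R%:E.
  apply/eqP; rewrite eq_le; apply/andP; split.
    by apply: ereal_inf_lbound; exists N.
  by apply: le_ereal_inf_tmp => _ [k hk <-]; rewrite lee_fin ler_nat minN.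
case: N => [|N] in hN minN insN nbE.
  by move: hN; rewrite (ws_X0 hwalk) in_itv/= hx.
apply: le_trans (ub N.+1); rewrite nbE /epow /= /u cnt; last exact: insN.
by rewrite lee_fin ler_powR// ler1n.
Qed.

End number_of_steps.

(** * Global constants and the final bound *)

(** The integral of a nonnegative function is a supremum over the simple functions below it, so
    arbitrary functions can be compared; the power of [nb_steps] is thus bounded without a proof
    that it is measurable. *)
Lemma ge0_le_integralT d (T : measurableType d) (R : realType)
    (P : {measure set T -> \bar R}) (f g : T -> \bar R) :
  (forall x, 0 <= f x)%E -> (forall x, f x <= g x)%E ->
  (\int[P]_x f x <= \int[P]_x g x)%E.
Proof.
move=> f0 fg; have g0 x : (0 <= g x)%E := le_trans (f0 x) (fg x).
rewrite !ge0_integralTE//; apply: ereal_sup_le => _ [h /= hf <-]; exists h => //= x.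
exact: le_trans (fg x).
Qed.

Lemma epow_ge0 (R : realType) (x : \bar R) (r : R) : (0 <= epow x r)%E.
Proof. by rewrite /epow; case: ifP => // _; exact: poweR_ge0. Qed.

(** The coefficient 1 / m matches the window: integrated over length [m] it gives ln(1 + t + m),
    whose exponential is linear. *)
Lemma growth_linear (R : realType) (alpha : R -> R) (m K : R) :
  {within `[0, +oo[, continuous alpha} -> 0 < m -> 0 < K ->
  (forall t, 0 <= t -> `|alpha t| <= K + m^-1 * ln (1 + t)) ->
  forall t, 0 <= t -> growth alpha t (t + m) <= expR (m * K) * (1 + m) * (1 + t).
Proof.
move=> calpha m0 K0 hl t t0; have tm : t <= t + m by rewrite lerDl ltW.
have ca : {within `[0, +oo[, continuous (fun s => `|alpha s|)}.
  by move=> s; apply: cvg_norm; exact: calpha.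
have l0 : 0 < 1 + (t + m) by lra.
have h : \int[lebesgue_measure]_(s in `[t, t + m]) `|alpha s| <= (K + m^-1 * ln (1 + (t + m))) * (t + m - t).
  apply: Rintegral_le_cst => // s /andP[ts sm]; have s0 := le_trans t0 ts.
  apply: (le_trans (hl s s0)); rewrite lerD2l ler_wpM2l ?invr_ge0 ?(ltW m0)//.
  by rewrite ler_ln ?posrE; lra.
have E : (K + m^-1 * ln (1 + (t + m))) * (t + m - t) = m * K + ln (1 + (t + m)).
  by field; rewrite gt_eqF.
rewrite E in h.
apply: (@le_trans _ _ (expR (m * K + ln (1 + (t + m))))); first by rewrite ler_expR.
rewrite expRD lnK ?posrE// -mulrA ler_wpM2l ?expR_ge0//.
by have := mulr_ge0 (ltW m0) t0; lra.
Qed.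

Lemma log_affine_bound (R : realType) (C1 C2 u v z : R) : 0 <= C1 -> 0 <= C2 -> 1 <= - z ->
  C1 * (2 * (u - (v + z))) + C2 <= (C1 * (2 * (1 + `|u| + `|v|)) + C2 + 1) * - z.
Proof.
move=> C10 C20 z1.
have n1 := ler_norm u; have n2 : - v <= `|v| by rewrite -normrN ler_norm.
have n3 := normr_ge0 u; have n4 := normr_ge0 v.
have h : u - (v + z) <= (1 + `|u| + `|v|) * - z by nra.
have h1 : C1 * (2 * (u - (v + z))) <= C1 * (2 * ((1 + `|u| + `|v|) * - z)).
  by rewrite ler_wpM2l// ler_wpM2l.
have h2 : C2 * 1 <= C2 * - z by rewrite ler_wpM2l.
lra.
Qed.

Lemma coefficient_bounds (R : realType) (alpha beta sigma : R -> R)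
    (a b m q q' Csb sigma_low : R) :
  a < b -> 0 < m -> {within `[0, +oo[, continuous alpha} ->
  {within `[0, +oo[, continuous beta} -> {within `[0, +oo[, continuous sigma} ->
  (forall t, 0 <= t -> 0 < sigma t) -> 0 <= q' < 1 -> 0 <= q <= 1 ->
  0 < Csb -> 0 < sigma_low ->
  (exists K : R, \forall t \near +oo_R, `|alpha t| <= K * ln t `^ q') ->
  (\forall t \near +oo_R, [/\ sigma_low <= sigma t, sigma t <= Csb * t `^ (q / 4)
       & `|beta t| <= Csb * t `^ (q / 4)]) ->
  exists s0 C K : R, [/\ 0 < s0 /\ (forall t, 0 <= t -> s0 <= sigma t), 0 < C,
    [/\ forall t, 0 <= t -> sigma t <= C * (1 + t),
        forall t, 0 <= t -> `|alpha t| <= C * (1 + t),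
        forall t, 0 <= t -> `|beta t| <= C * (1 + t) &
        forall t, 0 <= t -> growth alpha t (t + m) <= C * (1 + t)], 0 < K &
    forall t, 0 <= t -> `|alpha t| <=
      K + (30 * (b - a) ^+ 2 * expR 1 ^+ 4 / s0 ^+ 2)^-1 * ln (1 + t)].
Proof.
move=> hab hm halpha hbeta hsigma sigma_gt0 hq' hq hCsb hsigma_low halphaO hbounds.
have [s0 s00 hs] := lower_bound hsigma sigma_gt0 hsigma_low
  (filterS (fun t (h : [/\ _, _ & _]) => let: And3 h1 _ _ := h in h1) hbounds).
have [K1 K10 hsg0] : exists2 K : R, 0 < K & forall t, 0 <= t -> `|sigma t| <= K * (1 + t).
  apply: (sublinear_growth hsigma hq hCsb); apply: filterS hbounds => t [h1 h2 _].
  by rewrite ger0_norm//; apply: le_trans h1; exact: ltW.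
have [K2 K20 hbe0] : exists2 K : R, 0 < K & forall t, 0 <= t -> `|beta t| <= K * (1 + t).
  by apply: (sublinear_growth hbeta hq hCsb); apply: filterS hbounds => t [].
have hlog eta : 0 < eta -> exists2 K : R, 0 < K & forall t, 0 <= t -> `|alpha t| <= K + eta * ln (1 + t).
  exact: sublog_growth halpha hq' halphaO eta.
have [K3 K30 hal0] := hlog 1 ltr01.
have [K4 K40 hgr0] : exists2 K : R, 0 < K & forall t, 0 <= t -> growth alpha t (t + m) <= K * (1 + t).
  have [K K0 hK] : exists2 K : R, 0 < K & forall t, 0 <= t -> `|alpha t| <= K + m^-1 * ln (1 + t).
    by apply: hlog; rewrite invr_gt0.
  exists (expR (m * K) * (1 + m)); last exact: (growth_linear halpha hm K0 hK).
  by rewrite mulr_gt0 ?expR_gt0// addr_gt0.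
have [K5 K50 hal1] : exists2 K : R, 0 < K & forall t, 0 <= t -> `|alpha t| <=
    K + (30 * (b - a) ^+ 2 * expR 1 ^+ 4 / s0 ^+ 2)^-1 * ln (1 + t).
  apply: hlog; rewrite invr_gt0 divr_gt0 ?mulr_gt0 ?exprn_gt0 ?expR_gt0 ?subr_gt0//.
exists s0, (K1 + K2 + (K3 + 1) + K4), K5.
have scale (k t y : R) : 0 <= t -> k <= K1 + K2 + (K3 + 1) + K4 -> y <= k * (1 + t) ->
    y <= (K1 + K2 + (K3 + 1) + K4) * (1 + t).
  by move=> t0 kC /le_trans; apply; rewrite ler_wpM2r// addr_ge0.
split => //; first by move: K10 K20 K30 K40; clear; lra.
have [k1 k2 k3 k4] : [/\ K1 <= K1 + K2 + (K3 + 1) + K4, K2 <= K1 + K2 + (K3 + 1) + K4,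
    K3 + 1 <= K1 + K2 + (K3 + 1) + K4 & K4 <= K1 + K2 + (K3 + 1) + K4].
  by move: K10 K20 K30 K40; clear; split; lra.
split => t t0.
- by apply: (scale K1) => //; apply: (le_trans (ler_norm _)); exact: hsg0.
- apply: (scale (K3 + 1)) => //; apply: (le_trans (hal0 t t0)); rewrite mul1r.
  have : ln (1 + t) <= t by apply: ln1D_le; rewrite ltr_pwDl.
  by have := mulr_ge0 (ltW K30) t0; move: t0; clear; lra.
- by apply: (scale K2) => //; exact: hbe0.
- by apply: (scale K4) => //; exact: hgr0.
Qed.

Unset Implicit Arguments.

Theorem theorem2p8 (R : realType)
  (a b x0 m gamma : R) (alpha beta sigma : R -> R)
  (hab : a < b) (hx0 : a < x0 < b) (hm : 0 < m) (hgamma : 0 < gamma < 1)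
  (halpha : {within `[0, +oo[, continuous alpha})
  (hbeta : {within `[0, +oo[, continuous beta})
  (hsigma : {within `[0, +oo[, continuous sigma})
  (hsigma_gt0 : forall t : R, 0 <= t -> 0 < sigma t)
  (dB : measure_display) (OmegaB : measurableType dB)
  (PB : probability OmegaB R) (W : R -> OmegaB -> R)
  (hW : brownian_motion PB W)
  (d : measure_display) (Omega : measurableType d) (P : probability Omega R)
  (tau : nat -> Omega -> R) (coin : nat -> Omega -> bool)
  (T X : nat -> Omega -> R)
  (hwalk : walk_on_spheroids alpha beta sigma a b x0 m gamma
             PB W P tau coin T X)
  (q' q Csb sigma_low chi : R)
  (hq' : 0 <= q' < 1) (hq : 0 <= q <= 1)
  (hCsb : 0 < Csb) (hsigma_low : 0 < sigma_low)
  (halphaO : exists K : R, \forall t \near +oo_R, `|alpha t| <= K * ln t `^ q')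
  (hbounds : \forall t \near +oo_R,
     [/\ sigma_low <= sigma t, sigma t <= Csb * t `^ (q / 4)
       & `|beta t| <= Csb * t `^ (q / 4)])
  (hchi : 0 < chi)
  (hinfsup : \forall t \near +oo_R,
     chi * sup (sigma @` `[t, t + m]) <= inf (sigma @` `[t, t + m])) :
  forall qt : R, q < qt ->
  exists2 C : R, 0 < C &
  \forall e \near 0^'+,
    (\int[P]_w epow (nb_steps a b X e w) (1 - qt) <= (C * `|ln e|)%:E)%E.
Proof.
move=> qt qqt.
have [s0 [Cg [K [[s00 hs] Cg0 [hsg hal hbe hgr] K0 hlog]]]] := @coefficient_bounds _ alpha beta sigma
  a b m q q' Csb sigma_low hab hm halpha hbeta hsigma hsigma_gt0 hq' hq hCsb hsigma_low halphaO hbounds.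
(* The exponent must lie in (0, 1) and dominate 1 - qt: the maximum with 1/2 makes it positive also
   when qt >= 1, and qt > q >= 0 keeps it below 1. *)
pose p : R := Num.max (1 - qt) (1 / 2).
have hp : 0 < p < 1.
  move: hq qqt; clear => /andP[q_ge0 _] qqt.
  by rewrite lt_max gt_max; apply/andP; split; [apply/orP; right|apply/andP; split]; lra.
have rp : 1 - qt <= p by rewrite le_max lexx.
have p0 : 0 < p by case/andP: hp.
have [C1 [C2 [C10 C20 moment]]] := truncated_moment halpha hbeta hsigma hab hx0 hm hgamma
  s00 hs hW hwalk Cg0 hsg hal hbe hgr K0 hlog hp.
exists (C1 * (2 * (1 + `|ln (b - a)| + `|ln gamma|)) + C2 + 1).
  by rewrite ltr_wpDl// addr_ge0// mulr_ge0// mulr_ge0// !addr_ge0.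
have wx0 := wall_dist_gt0 hx0.
near=> e.
have e0 : 0 < e by near: e; exact: nbhs_right_gt.
have ex : e <= wall_dist a b x0 by near: e; exact: nbhs_right_le.
(* Ensures |ln e| >= 1, so that the additive constants are absorbed into a multiple of |ln e|. *)
have e1 : e <= expR (- 1) by near: e; apply: nbhs_right_le; exact: expR_gt0.
have le1 : ln e <= - 1 by rewrite -[leRHS]expRK ler_ln ?posrE ?expR_gt0.
have hx : a + e <= x0 <= b - e.
  by move: ex; rewrite /wall_dist le_min => /andP[h1 h2]; rewrite -lerBrDl h2 lerBrDr -lerBrDl.
pose y n w : \bar R := (steps_before a b X e n w `^ p)%:E.
have y0 n w : (0 <= y n w)%E by rewrite lee_fin powR_ge0.
have my n : measurable_fun setT (y n).
  apply/measurable_EFinP; apply: (measurableT_comp (measurable_powR p)).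
  exact: (measurable_steps_before hwalk).
have ymono w : {homo y ^~ w : n k / (n <= k)%N >-> (n <= k)%E}.
  move=> n k nk; rewrite lee_fin; apply: ge0_ler_powR; rewrite ?nnegrE ?(ltW p0)//.
  - by apply: sumr_ge0.
  - by apply: sumr_ge0.
  - exact: steps_before_mono.
apply: (@le_trans _ _ (\int[P]_w limn (y ^~ w))%E).
  apply: ge0_le_integralT => w; first exact: epow_ge0.
  exact: (epow_nb_steps_le hwalk).
rewrite monotone_convergence//.
apply: lime_le.
  by apply: ereal_nondecreasing_is_cvgn => n k nk; apply: ge0_le_integral => //; move=> w _; exact: ymono.
apply: nearW => n; apply: (le_trans (moment e n e0 ex)); rewrite lee_fin.
have g0 : 0 < gamma by case/andP: hgamma.
rewrite lnM ?posrE// (ler0_norm (le_trans le1 _)); last by rewrite oppr_le0.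
by apply: log_affine_bound => //; rewrite lerNr.
Unshelve. all: by end_near.
Qed.
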